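(* Assume $H_0$ holds, i.e. $\theta^*\in\Theta(\bar h)$, $\gamma_n\in(0,\alpha/4)$, and there are constants $0<c_1<1/2$ and $C_1>0$ such that $$\max_{j\in[p]}E\big[|\sigma_{\theta^*,j}^{-1}\{m_j(W,\theta^* )-E[m_j(W,\theta^* )]\}|^3\big]\log^{3/2}(p/\alpha)\le C_1n^{1/2-c_1},$$ $$\Big\{E\Big[\max_{j\in[p]}|\sigma_{\theta^*,j}^{-1}\{m_j(W,\theta^* )-E[m_j(W,\theta^* )]\}|^4\Big]\Big\}^{1/2}\log^2(p/\gamma_n)\le C_1n^{1/2-c_1}.$$ Then $$P\Big(T_n(\bar h)>\max_{\theta\in\widehat\Theta^{SN}_n}c^{SN,2S}_n(\theta,\alpha)\Big)\le\alpha+Cn^{-c},$$ where $c,C>0$ depend only on the other constants of the problem.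
   Context: $(W_i)_{i=1}^n$ are i.i.d. random elements of $(S,\mathcal S)$ with distribution $P$, $W$ a generic copy; $\Theta\subseteq\mathbb{R}^{d_\theta}$; moment functions $m_j:S\times\Theta\to\mathbb{R}$, $j\in[p]$; $\Theta_I=\{\theta\in\Theta:E[m_j(W,\theta)]\le0\ \forall j\}$ and the true parameter $\theta^*\in\Theta_I$; $h:\Theta\to\mathbb{R}^{d_h}$ known, $\bar h\in h[\Theta]$, $\Theta(\bar h)=\{\theta\in\Theta:h(\theta)=\bar h\}$, $H_0:h(\theta^* )=\bar h$; $P,p,d_\theta$ may depend on $n$. $\bar m_{\theta,j}=n^{-1}\sum_im_j(W_i,\theta)$, $\hat\sigma^2_{\theta,j}=n^{-1}\sum_i(m_j(W_i,\theta)-\bar m_{\theta,j})^2$, $\sigma^2_{\theta,j}=\mathrm{Var}(m_j(W,\theta))$. $T_n(\bar h)=\inf_{\theta\in\Theta(\bar h)}\max_j\sqrt n\bar m_{\theta,j}/\hat\sigma_{\theta,j}$ (ratio $:=\infty\cdot\mathrm{sign}(\bar m_{\theta,j})$ if $\hat\sigma_{\theta,j}=0$). For $a\in(0,1)$ and integer $k\ge1$, $c^{SN}_n(k,a)=\Phi^{-1}(1-a/k)/\sqrt{1-\Phi^{-1}(1-a/k)^2/n}$ ($\Phi$ the standard normal cdf). For $\theta\in\Theta(\bar h)$: $\hat J^{SN}_n(\theta)=\{j\in[p]:\sqrt n\bar m_{\theta,j}/\hat\sigma_{\theta,j}>-2c^{SN}_n(p,\gamma_n)\}$; $c^{SN,2S}_n(\theta,\alpha)=\Phi^{-1}(1-(\alpha-3\gamma_n)/|\hat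 J^{SN}_n(\theta)|)/\sqrt{1-\Phi^{-1}(1-(\alpha-3\gamma_n)/|\hat J^{SN}_n(\theta)|)^2/n}$ if $|\hat J^{SN}_n(\theta)|\ge1$ and $c^{SN,2S}_n(\theta,\alpha)=0$ if $|\hat J^{SN}_n(\theta)|=0$; $\widehat\Theta^{SN}_n=\{\theta\in\Theta(\bar h):\max_{j\in[p]}\sqrt n\bar m_{\theta,j}/\hat\sigma_{\theta,j}\le c^{SN}_n(p,\gamma_n)\}$. *)

(* Defs.v *)
From HB Require Import structures.
From mathcomp Require Import all_boot all_order all_algebra.
From mathcomp Require Import all_classical all_reals all_analysis.
Set Implicit Arguments. Unset Strict Implicit. Unset Printing Implicit Defensive.
Import Order.TTheory GRing.Theory Num.Theory.
Import numFieldNormedType.Exports.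
Local Open Scope classical_set_scope.
Local Open Scope ring_scope.

Section Defs.
Variable R : realType.

Definition Phi (x : R) : R :=
  fine (\int[@lebesgue_measure R]_(t in `]-oo, x]) 
          ((expR (- t ^+ 2 / 2) / Num.sqrt (2 * pi))%:E)).
Definition Phi_inv (q : R) : R := inf [set x | q <= Phi x].

Definition cSN (n k : nat) (a : R) : R :=
  let z := Phi_inv (1 - a / k%:R) in z / Num.sqrt (1 - z ^+ 2 / n%:R).

Definition Emean d (S : measurableType d) (mu : probability S R) (f : S -> R) : R :=
  fine (\int[mu]_s (f s)%:E).
Definition Esd d (S : measurableType d) (mu : probability S R) (f : S -> R) : R :=
  Num.sqrt (fine (\int[mu]_s (((f s - Emean mu f) ^+ 2))%:E)).

Variables (n p dth dh : nat) (d : measure_display) (S : measurableType d).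
Implicit Types (x : 'I_n -> S) (f : S -> R) (m : 'I_p -> S -> 'rV[R]_dth -> R).

Definition mbar x f : R := n%:R^-1 * \sum_(i < n) f (x i).
Definition sighat x f : R :=
  Num.sqrt (n%:R^-1 * \sum_(i < n) (f (x i) - mbar x f) ^+ 2).
Definition ratio x f : \bar R :=
  if sighat x f != 0 then (Num.sqrt n%:R * mbar x f / sighat x f)%:E
  else if 0 < mbar x f then +oo%E else if mbar x f < 0 then -oo%E else 0%E.
Definition maxratio x m (th : 'rV[R]_dth) : \bar R :=
  \big[Order.max/-oo%E]_(j < p) ratio x (fun s => m j s th).

Definition Theta_h (Theta : set 'rV[R]_dth) (h : 'rV[R]_dth -> 'rV[R]_dh)
  (hbar : 'rV[R]_dh) : set 'rV[R]_dth := [set th | Theta th /\ h th = hbar].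

Definition Tn x m Theta h hbar : \bar R :=
  ereal_inf [set maxratio x m th | th in Theta_h Theta h hbar].

Definition Jhat x m (gam : R) (th : 'rV[R]_dth) : {set 'I_p} :=
  [set j : 'I_p | ((- 2 * cSN n p gam)%:E < ratio x (fun s => m j s th))%E].

Definition c2S x m (alpha gam : R) (th : 'rV[R]_dth) : R :=
  if (0 < #|Jhat x m gam th|)%N then cSN n #|Jhat x m gam th| (alpha - 3 * gam)
  else 0.

Definition ThetaHat x m Theta h hbar (gam : R) : set 'rV[R]_dth :=
  [set th | Theta_h Theta h hbar th /\ (maxratio x m th <= (cSN n p gam)%:E)%E].

(* max over ThetaHat of c^{SN,2S}_n (sup; -oo if ThetaHat is empty) *)
Definition maxc2S x m Theta h hbar (alpha gam : R) : \bar R :=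
  ereal_sup [set (c2S x m alpha gam th)%:E | th in ThetaHat x m Theta h hbar gam].

Definition reject d' (Omega : measurableType d') (W : 'I_n -> Omega -> S) m Theta h hbar
  (alpha gam : R) : set Omega :=
  [set w | (maxc2S (fun i => W i w) m Theta h hbar alpha gam
            < Tn (fun i => W i w) m Theta h hbar)%E].

End Defs.

(* Main.v *)
Require Import Defs.
From HB Require Import structures.
From mathcomp Require Import all_boot all_order all_algebra.
From mathcomp Require Import all_classical all_reals all_analysis.
From mathcomp Require Import measurable_realfun ring lra.
Import Order.TTheory GRing.Theory Num.Theory.
Import numFieldNormedType.Exports.
Local Open Scope classical_set_scope.
Local Open Scope ring_scope.
Set Implicit Arguments.
Unset Strict Implicit.
Unset Printing Implicit Defensive.

(** Under the fourth-moment condition all the summands may be truncated at a level t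
    slightly below sqrt n at a polynomially small cost.  For truncated sums the tail
    probability is compared with the Gaussian one by Lindeberg replacement along the heat
    flow u(w, v) = Phi(w / sqrt v): all derivatives of u are bounded by exp(b w + b^2 v / 2),
    so that with b = x the replacement error is of order exp(- x^2 / 2), that is, relatively
    small compared with 1 - Phi(x) even in the moderate deviation range x^2 <= 2 log(p / gamma).
    Exponential inequalities make all the empirical standard deviations 1 + O(r / log(p / gamma)),
    with r a small negative power of n, so that studentization does not affect the tails.

    If J1 is the set of moments whose drift exceeds - c(p, gamma), then up to an event of
    probability about gamma J1 is included in the selected set, and rejection forces either
    a deviation of size Phi^-1(1 - gamma / p) (probability about gamma) or an element of J1
    above the critical value (probability about alpha - 3 gamma).  Negative critical
    values, which arise when alpha - 3 gamma > 1/2 and a single moment is selected, require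
    a separate argument when J1 is empty. *)

(** * The standard normal distribution *)

(** The tail comparison has to be relative: deviation probabilities are summed over up to [p]
    moments, and an additive error, however small in [n], would be multiplied by [p], whereas an
    error proportional to [1 - Phi x] is not. The tilt [exp(b w + b^2 v / 2)] makes this possible.
    It solves the same heat equation as [u], so its expectation stays bounded along the replacement
    scheme, and with [b = x] it leaves a factor [exp(- x^2 / 2)], which a Mills bound turns into
    [(1 + x) (1 - Phi x)] up to a constant. All errors are measured by one number
    [r = n^(- c1 / 16)] together with [L = ln (p / gamma)]. With [A^2] the fourth moment of the
    maximum, the moment condition reads [A L^2 <= C1 sqrt n r^16]. The powers of [r] are spent on
    the smoothing width [r^2 / (1 + b)], on the truncation level [sqrt n r^4 / L] and on the
    exponential inequalities, with room to spare each time. The accuracy [r / L] of the standard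
    deviations is what a critical value of order [sqrt L] tolerates. *)

Lemma MVT_on (R : realType) (f df : R -> R) (a b : R) :
  (forall x, a <= x <= b -> is_derive x 1 f (df x)) -> a <= b ->
  exists2 c, a <= c <= b & f b - f a = df c * (b - a).
Proof.
move=> fdf ab; have [||c] := @MVT_segment R f df a b ab.
- by move=> x; rewrite in_itv /= => /andP[ax xb]; apply: fdf; rewrite !ltW.
- apply: derivable_within_continuous => x; rewrite in_itv /= => abx.
  by have [] := fdf x abx.
by rewrite in_itv /= => cab E; exists c.
Qed.

Section NormalCdf.
Variable R : realType.
Implicit Types (x y z : R) (f df : R -> R).

Definition gauss_density x : R := expR (- x ^+ 2 / 2) / Num.sqrt (2 * pi).
Local Notation phi := gauss_density.
Local Notation Phi := (@Phi R).
Local Notation Phi_inv := (@Phi_inv R).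

(** The endpoints come in either order because the increments in [taylor3] have either sign. *)
Lemma MVT_norm f df a b : (forall x, is_derive x 1 f (df x)) ->
  exists2 c, `|c - a| <= `|b - a| & f b - f a = df c * (b - a).
Proof.
move=> fdf.
have cf : continuous f.
  by move=> x; apply/differentiable_continuous/derivable1_diffP.
have [ab|/ltW ba] := leP a b.
  have [|c] := @MVT_segment R f df a b ab (fun x _ => fdf x).
    exact: continuous_subspaceT.
  rewrite in_itv /= => /andP[ac cb] E; exists c => //.
  by rewrite !ger0_norm ?subr_ge0// lerB.
have [|c] := @MVT_segment R f df b a ba (fun x _ => fdf x).
  exact: continuous_subspaceT.
rewrite in_itv /= => /andP[ac cb] E; exists c; last first.
  by rewrite -[LHS]opprB E; ring.
by rewrite !ler0_norm ?subr_le0// !opprB lerB.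
Qed.

Lemma MVT_between f df a b : (forall x, is_derive x 1 f (df x)) -> a <= b ->
  exists2 c, a <= c <= b & f b - f a = df c * (b - a).
Proof. by move=> fdf; apply: MVT_on. Qed.

Lemma gauss_densityE x : phi x = normal_pdf 0 1 x.
Proof.
rewrite normal_pdfE ?oner_neq0// /normal_peak /normal_fun subr0 expr1n mul1r.
by rewrite /gauss_density mulrC mulr_natl.
Qed.

Lemma gauss_density_gt0 x : 0 < phi x.
Proof. by rewrite divr_gt0 ?expR_gt0// sqrtr_gt0 mulr_gt0// pi_gt0. Qed.

Lemma gauss_densityN x : phi (- x) = phi x.
Proof. by rewrite /gauss_density sqrrN. Qed.

Lemma sqrt2pi_ge1 : 1 <= Num.sqrt (2 * pi : R).
Proof.
rewrite -[leLHS]sqrtr1 ler_wsqrtr//; have := @pi_ge2 R.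
lra.
Qed.

Lemma gauss_density_le x : phi x <= expR (- x ^+ 2 / 2).
Proof.
by rewrite ler_pdivrMr ?(lt_le_trans ltr01 sqrt2pi_ge1)// ler_peMr ?expR_ge0// sqrt2pi_ge1.
Qed.

Lemma gauss_density_le1 x : phi x <= 1.
Proof.
apply: (le_trans (gauss_density_le x)); rewrite -[leRHS]expR0 ler_expR.
by have := sqr_ge0 x; lra.
Qed.

Lemma is_derive_expR_comp f x (a : R) : is_derive x 1 f a ->
  is_derive x 1 (fun y => expR (f y)) (a * expR (f x)).
Proof. by move=> ?; apply: is_derive_eq; rewrite /GRing.scale /= mulrC. Qed.

Lemma is_derive_gauss_density x : is_derive x 1 phi (- x * phi x).
Proof.
rewrite /gauss_density.
have h : is_derive x 1 (fun y : R => - y ^+ 2 / 2) (- x).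
  by apply: is_derive_eq; rewrite !scaler0 /GRing.scale /=; field.
have := is_derive_expR_comp h => h2.
by apply: is_derive_eq; rewrite /GRing.scale /=; field; rewrite gt_eqF ?(lt_le_trans ltr01 sqrt2pi_ge1).
Qed.

Local Notation NP := (@normal_prob R 0 1 : probability (measurableTypeR R) R).

Let idTR : measurableTypeR R -> R := idfun.

#[local] HB.instance Definition _ :=
  @isMeasurableFun.Build _ _ _ _ idTR (@measurable_id _ _ setT).

(** Seeing [Phi] as the cdf of the identity under the normal law yields its bounds, monotonicity and
    limits. *)
Lemma PhiE x : (Phi x)%:E = cdf (idTR : {RV NP >-> R}) x.
Proof.
rewrite /Defs.Phi /cdf /distribution /pushforward /= preimage_id /normal_prob.
under eq_integral => y _ do rewrite -/(phi y) gauss_densityE.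
rewrite fineK//.
have -> : (\int[lebesgue_measure]_(x0 in `]-oo, x]) (normal_pdf 0 1 x0)%:E =
  NP [set` `]-oo, x]%R])%E by [].
exact: fin_num_measure.
Qed.

Lemma fine_cdf : fine \o cdf (idTR : {RV NP >-> R}) = Phi.
Proof. by apply/funext => x /=; rewrite -[LHS]/(fine (cdf _ x)) -PhiE. Qed.

Lemma Phi_ge0 x : 0 <= Phi x.
Proof. by rewrite -lee_fin PhiE cdf_ge0. Qed.

Lemma Phi_le1 x : Phi x <= 1.
Proof. by rewrite -lee_fin PhiE cdf_le1. Qed.

Lemma Phi_homo : {homo Phi : x y / x <= y}.
Proof. by move=> x y xy; rewrite -lee_fin !PhiE cdf_nondecreasing. Qed.

Lemma Phi_vanishing e : 0 < e -> exists2 x, x <= 0 & Phi x < e.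
Proof.
move=> e0; have /fine_cvgP[_] := @cvg_cdfNy0 _ _ _ _ (idTR : {RV NP >-> R}).
rewrite fine_cdf => /cvgr_lt /(_ e e0) [M [_ h]].
exists (Num.min M 0 - 1); last first.
  apply: h.
  by rewrite ltrBlDr gt_min ltrDl ltr01.
by rewrite lerBlDr ge_min; apply/orP; right; rewrite add0r ler01.
Qed.

Lemma is_derive_Phi x : is_derive x 1 Phi (phi x).
Proof.
have int : lebesgue_measure.-integrable [set: R] (EFin \o phi).
  rewrite (_ : EFin \o phi = fun x => (normal_pdf 0 1 x)%:E).
    exact: integrable_normal_pdf.
  by apply/funext => y /=; rewrite gauss_densityE.
(* The endpoint [x + 1] only makes [x] an interior point. *)
have [||||d e] := @continuous_FTC1 R phi -oo%O x (x + 1) _ _ _ _.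
- by rewrite ltrDl.
- exact: (integrableS _ _ (subsetT _)).
- by rewrite ltNyr.
- have -> : phi = normal_pdf 0 1 by apply/funext => y; rewrite gauss_densityE.
  by apply: continuous_normal_pdf; rewrite oner_neq0.
apply: DeriveDef; first exact: d.
by rewrite -derive1E -e.
Qed.

Lemma Phi_near1 e y : 0 < e -> exists2 x, y <= x & 1 - e < Phi x.
Proof.
move=> e0; have /fine_cvgP[_] := @cvg_cdfy1 _ _ _ _ (idTR : {RV NP >-> R}).
have e1 : 1 - e < 1 by lra.
rewrite fine_cdf => /cvgr_gt /(_ _ e1) [M [_ h]].
exists (Num.max M y + 1); last first.
  apply: h.
  by rewrite ltr_pwDr// le_max lexx.
by rewrite ler_wpDr// le_max lexx orbT.
Qed.

Lemma Phi_lt : {homo Phi : x y / x < y}.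
Proof.
move=> x y xy; have [c _ E] := MVT_between is_derive_Phi (ltW xy).
by rewrite -subr_gt0 E mulr_gt0 ?subr_gt0// gauss_density_gt0.
Qed.

Lemma Phi_lipschitz x y : x <= y -> Phi y - Phi x <= y - x.
Proof.
move=> xy; have [c _ ->] := MVT_between is_derive_Phi xy.
by rewrite ler_piMl ?subr_ge0// gauss_density_le1.
Qed.

Lemma Phi_lt1 x : Phi x < 1.
Proof. by apply: (lt_le_trans (Phi_lt (ltr_pwDr ltr01 (lexx x)))); exact: Phi_le1. Qed.

(** The density is even, so [Phi t + Phi (- t)] has derivative zero; its constant value is read off
    from the limits at infinity. *)
Lemma PhiN x : Phi (- x) = 1 - Phi x.
Proof.
have dg y : is_derive y 1 (fun t => Phi t + Phi (- t)) 0.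
  have h1 := is_derive_Phi y; have h2 := is_derive_Phi (- y).
  have h3 : is_derive y 1 (fun t => Phi (- t)) (- phi y).
    apply: is_derive_eq; rewrite gauss_densityN /GRing.scale /=; ring.
  by apply: is_derive_eq; ring.
have cst y : Phi x + Phi (- x) = Phi y + Phi (- y).
  have [c _] := MVT_norm x y dg.
  by move/eqP; rewrite mul0r subr_eq0 => /eqP.
suff : Phi x + Phi (- x) = 1 by move=> <-; ring.
apply/eqP; rewrite eq_le; apply/andP; split; apply/ler_addgt0Pr => e e0.
  have [y y0 ye] := Phi_vanishing e0.
  by rewrite (cst y); have := Phi_le1 (- y); lra.
have [y _ ye] := @Phi_near1 e 0 e0.
by rewrite (cst y); have := Phi_ge0 (- y); lra.
Qed.

Lemma Phi0 : Phi 0 = 1 / 2.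
Proof. by have := PhiN 0; rewrite oppr0; lra. Qed.

Lemma continuous_Phi : continuous Phi.
Proof.
move=> x; apply/differentiable_continuous/derivable1_diffP.
by have [] := is_derive_Phi x.
Qed.

Lemma Phi_inv_unique q x : Phi x = q -> Phi_inv q = x.
Proof.
move=> xq; rewrite /Defs.Phi_inv.
have -> : [set x | q <= Phi x] = [set` `[x, +oo[%R].
  apply/seteqP; split => y /=; rewrite in_itv /= andbT -xq.
    by rewrite leNgt => /negP h; rewrite leNgt; apply/negP => /Phi_lt.
  exact: Phi_homo.
by rewrite inf_itv.
Qed.

Lemma Phi_invK q : 0 < q < 1 -> Phi (Phi_inv q) = q.
Proof.
move=> /andP[q0 q1].
have [a a0 aq] := Phi_vanishing q0.
have q1' : 0 < 1 - q by lra.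
have [b b0 bq] := @Phi_near1 (1 - q) 0 q1'.
have ab : a <= b by lra.
have [||x _ xq] := @IVT R Phi a b q ab.
- exact/continuous_subspaceT/continuous_Phi.
- apply/andP; split; first by rewrite ge_min (ltW aq).
  by rewrite le_max; apply/orP; right; lra.
by rewrite (Phi_inv_unique xq).
Qed.

Lemma Phi_inv_le q1 q2 : 0 < q1 -> q1 <= q2 -> q2 < 1 ->
  Phi_inv q1 <= Phi_inv q2.
Proof.
move=> q10 q12 q21; rewrite leNgt; apply/negP => /Phi_lt.
rewrite !Phi_invK; last 2 first.
- by rewrite q10 (le_lt_trans q12).
- by rewrite (lt_le_trans q10).
by rewrite ltNge q12.
Qed.

(** Beyond 1 the function [Phi + phi] has derivative [(1 - t) * phi t <= 0], so it decreases to its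
    limit 1. *)
Lemma Phi_tail_le z : 1 <= z -> 1 - Phi z <= phi z.
Proof.
move=> z1; rewrite leNgt; apply/negP => h.
have e0 : 0 < 1 - Phi z - phi z by lra.
have [y zy hy] := @Phi_near1 _ z e0.
have dg (t : R) : is_derive t 1 (fun t : R => Phi t + phi t) ((1 - t) * phi t).
  have h1 := is_derive_Phi t; have h2 := is_derive_gauss_density t.
  by apply: is_derive_eq; ring.
have [c /andP[zc _] E] := MVT_between dg zy.
have : (1 - c) * phi c * (y - z) <= 0.
  apply: mulr_le0_ge0; last by rewrite subr_ge0.
  by apply: mulr_le0_ge0; [lra|exact/ltW/gauss_density_gt0].
by rewrite -E; have := gauss_density_gt0 y; lra.
Qed.

Lemma gauss_density_decr x y : 0 <= x -> x <= y -> phi y <= phi x.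
Proof.
move=> x0 xy; rewrite /gauss_density ler_pM2r ?invr_gt0 ?(lt_le_trans ltr01 sqrt2pi_ge1)//.
rewrite ler_expR; have : x ^+ 2 <= y ^+ 2 by rewrite ler_sqr ?nnegrE; lra.
lra.
Qed.

(* Mills-type bound: [1 - Phi x] exceeds the mass of [[x, x + 1/(1+x)]]. *)
Lemma Phi_tail_ge x : 0 <= x -> phi x * expR (- (3 / 2)) / (1 + x) <= 1 - Phi x.
Proof.
move=> x0; set d := (1 + x)^-1.
have x1 : 0 < 1 + x by lra.
have d0 : 0 < d by rewrite invr_gt0.
have dx : d * x <= 1 by rewrite /d mulrC ler_pdivrMr; lra.
have d1 : d <= 1 by rewrite invf_le1//; lra.
have xd : x <= x + d by lra.
have [c /andP[xc cd] E] := MVT_between is_derive_Phi xd.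
have h : phi c * d <= 1 - Phi x.
  by have := Phi_le1 (x + d); move: E; rewrite addrAC subrr add0r; lra.
apply: le_trans h; rewrite ler_pM2r//.
apply: (@le_trans _ _ (phi (x + d))); last by apply: gauss_density_decr; lra.
rewrite /gauss_density mulrAC ler_pM2r ?invr_gt0 ?(lt_le_trans ltr01 sqrt2pi_ge1)//.
rewrite -expRD ler_expR.
nra.
Qed.

(** A shift of relative size [d * (1 + x)] changes the tail by a comparable factor. On [[x - d, x]]
    the density grows by at most [expR 1], and [Phi_tail_ge] converts [phi x] into the tail at the
    price [expR (3 / 2) * (1 + x)]; hence the exponent 5/2. *)
Lemma Phi_tail_shift x d : 0 <= x -> 0 <= d -> d * (1 + x) <= 1 ->
  1 - Phi (x - d) <= (1 - Phi x) * (1 + expR (5 / 2) * (d * (1 + x))).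
Proof.
move=> x0 d0 dx.
have xd : x - d <= x by lra.
have [c /andP[xc cd] E] := MVT_between is_derive_Phi xd.
have {E} : Phi x - Phi (x - d) = phi c * d by rewrite E; ring.
have x1 : 0 < 1 + x by lra.
have h1 : phi c <= phi x * expR 1.
  rewrite /gauss_density mulrAC ler_pM2r ?invr_gt0 ?(lt_le_trans ltr01 sqrt2pi_ge1)//.
  rewrite -expRD ler_expR.
  have [c0|c0] := leP 0 (x + c); last by nra.
  have : (x - c) * (x + c) <= d * (2 * x) by nra.
  nra.
have h2 : phi x <= expR (3 / 2) * (1 + x) * (1 - Phi x).
  have := Phi_tail_ge x0; rewrite ler_pdivrMr// expRN ler_pdivrMr ?expR_gt0//.
  by lra.
have -> : 5 / 2 = 3 / 2 + 1 :> R by lra.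
rewrite expRD => E.
suff : phi c * d <= (1 - Phi x) * (expR (3/2) * expR 1 * (d * (1 + x))) by lra.
have h3 : phi c <= expR (3 / 2) * (1 + x) * (1 - Phi x) * expR 1.
  by apply: (le_trans h1); rewrite ler_pM2r ?expR_gt0.
have := ler_wpM2r d0 h3; move/le_trans; apply.
lra.
Qed.

(** The density decreases on the half-line, so [Phi t - Phi (t + v)] increases in [t >= 0]. This
    bounds the sum of an upper and a lower tail when only the sum of the two levels is
    controlled. *)
Lemma Phi_subadditive u v : 0 <= u -> 0 <= v -> Phi 0 + Phi (u + v) <= Phi u + Phi v.
Proof.
move=> u0 v0.
have dg (t : R) : is_derive t 1 (fun t : R => Phi t - Phi (t + v)) (phi t - phi (t + v)).
  have h1 := is_derive_Phi t; have h2 := is_derive_Phi (t + v).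
  have h3 : is_derive t 1 (fun t => Phi (t + v)) (phi (t + v)).
    by apply: is_derive_eq; rewrite /GRing.scale /=; ring.
  by apply: is_derive_eq.
have [c /andP[c0 _]] := MVT_between dg u0.
rewrite add0r subr0 => E.
have : 0 <= (phi c - phi (c + v)) * u.
  by rewrite mulr_ge0// subr_ge0 gauss_density_decr//; lra.
by rewrite -E; lra.
Qed.

End NormalCdf.

(** * The heat semigroup *)

Section HeatKernel.
Variable R : realType.
Implicit Types (w y v b h : R).
Local Notation Phi := (@Phi R).
Local Notation phi := (@gauss_density R).

(* [heat w v] is P(w + sqrt v G >= 0) for G standard normal; [heat1], ..., [heat4]
   are its derivatives in [w], and d/dv = (1/2) d^2/dw^2. *)
Definition heat w v : R := Phi (w / Num.sqrt v).
Definition heat1 w v : R := phi (w / Num.sqrt v) / Num.sqrt v.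
Definition heat2 w v : R :=
  - (w / Num.sqrt v) * phi (w / Num.sqrt v) / Num.sqrt v ^+ 2.
Definition heat3 w v : R :=
  ((w / Num.sqrt v) ^+ 2 - 1) * phi (w / Num.sqrt v) / Num.sqrt v ^+ 3.
Definition heat4 w v : R :=
  (3 * (w / Num.sqrt v) - (w / Num.sqrt v) ^+ 3) * phi (w / Num.sqrt v)
  / Num.sqrt v ^+ 4.

Let is_derive_scale (x s : R) : is_derive x 1 (fun x : R => x / s) s^-1.
Proof. by apply: is_derive_eq; rewrite scaler0 add0r /GRing.scale /= mulr1. Qed.

Lemma is_derive_heat w v : is_derive w 1 (heat^~ v) (heat1 w v).
Proof.
rewrite /heat /heat1.
exact: (@is_derive1_comp _ Phi _ w _ _ (is_derive_Phi _) (is_derive_scale _ _)).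
Qed.

Lemma is_derive_phi_scale (x s : R) :
  is_derive x 1 (fun x : R => phi (x / s)) (- (x / s) * phi (x / s) * s^-1).
Proof.
exact: (@is_derive1_comp _ phi _ x _ _ (is_derive_gauss_density _) (is_derive_scale _ _)).
Qed.

Lemma is_derive_heat1 w v : 0 < v -> is_derive w 1 (heat1^~ v) (heat2 w v).
Proof.
rewrite -sqrtr_gt0 => v0; rewrite /heat1 /heat2; set s := Num.sqrt v in v0 *.
have h1 := is_derive_phi_scale w s.
by apply: is_derive_eq; rewrite scaler0 add0r /GRing.scale /=; field; rewrite gt_eqF.
Qed.

Lemma is_derive_heat2 w v : 0 < v -> is_derive w 1 (heat2^~ v) (heat3 w v).
Proof.
rewrite -sqrtr_gt0 => v0; rewrite /heat2 /heat3; set s := Num.sqrt v in v0 *.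
have h1 := is_derive_phi_scale w s; have h2 := is_derive_scale w s.
by apply: is_derive_eq; rewrite !scaler0 !add0r /GRing.scale /=; field; rewrite gt_eqF.
Qed.

Let is_derive_inv_sqrt w v : 0 < v ->
  is_derive v 1 (fun v => w / Num.sqrt v) (- w / (2 * Num.sqrt v ^+ 3)).
Proof.
move=> v0; have s0 : 0 < Num.sqrt v by rewrite sqrtr_gt0.
have h1 := is_derive1_sqrt v0.
have h2 := is_deriveV (lt0r_neq0 s0) h1.
by apply: is_derive_eq; rewrite /GRing.scale /=; field; rewrite gt_eqF.
Qed.

Lemma is_derive_heat_time w v : 0 < v ->
  is_derive v 1 (heat w) (heat2 w v / 2).
Proof.
move=> v0; have s0 : 0 < Num.sqrt v by rewrite sqrtr_gt0.
have := @is_derive1_comp _ Phi _ v _ _ (is_derive_Phi _) (is_derive_inv_sqrt w v0).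
move=> h; apply: (is_derive_eq h); rewrite /heat2; field; rewrite ?gt_eqF//.
Qed.

Lemma is_derive_heat2_time w v : 0 < v ->
  is_derive v 1 (heat2 w) (heat4 w v / 2).
Proof.
move=> v0; have s0 : 0 < Num.sqrt v by rewrite sqrtr_gt0.
have h1 := @is_derive1_comp _ phi _ v _ _ (is_derive_gauss_density _) (is_derive_inv_sqrt w v0).
have h2 := is_derive_inv_sqrt w v0.
have h3 := is_derive1_sqrt v0.
have s20 : Num.sqrt v ^+ 2 != 0 by rewrite expf_neq0// gt_eqF.
have h4 : is_derive v 1 (fun v => Num.sqrt v ^+ 2) 1.
  by apply: is_derive_eq; rewrite /GRing.scale /=; field; rewrite gt_eqF.
have h5 := @is_deriveV R (fun v => Num.sqrt v ^+ 2) v _ _ s20 h4.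
have h6 : is_derive v 1 (fun v => phi (w / Num.sqrt v)) _ := h1.
rewrite /heat2 /heat4; apply: is_derive_eq.
rewrite /GRing.scale /=; field; rewrite ?gt_eqF//.
Qed.

Let cube_le_expR (q : R) : 0 <= q -> (1 + q) ^+ 3 <= 8 * expR (q ^+ 2 / 2).
Proof.
move=> q0; have h : 1 + q ^+ 2 / 4 <= expR (q ^+ 2 / 4) by exact: expR_ge1Dx.
have -> : q ^+ 2 / 2 = q ^+ 2 / 4 + q ^+ 2 / 4 by field.
rewrite expRD; have q2 := sqr_ge0 q.
have : (1 + q ^+ 2 / 4) ^+ 2 <= expR (q ^+ 2 / 4) ^+ 2.
  by rewrite ler_sqr ?nnegrE ?expR_ge0//; lra.
have := sqr_ge0 (q ^+ 2 - q); have := sqr_ge0 (q - 3).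
nra.
Qed.

(* Completing the square in the exponent trades the Gaussian decay of [phi] for the tilt [expR (b * w)]. *)
Lemma poly_gauss_le w v b k : 0 < v -> 0 <= b -> (k <= 3)%N ->
  (1 + `|w / Num.sqrt v|) ^+ k * phi (w / Num.sqrt v) <=
  8 * (1 + b * Num.sqrt v) ^+ k * expR (b * w + b ^+ 2 * v / 2).
Proof.
move=> v0 b0 k3; have s0 : 0 < Num.sqrt v by rewrite sqrtr_gt0.
set s := Num.sqrt v in s0 *; set y := w / s.
have vE : v = s ^+ 2 by rewrite sqr_sqrtr// ltW.
set q := y + b * s.
have ws : w = y * s by rewrite /y divfK// gt_eqF.
have -> : b * w + b ^+ 2 * v / 2 = q ^+ 2 / 2 + - y ^+ 2 / 2.
  by rewrite vE ws /q; field.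
rewrite expRD mulrA; apply: ler_pM; rewrite ?exprn_ge0 ?addr_ge0 ?(ltW (gauss_density_gt0 _))//.
  rewrite mulrAC; apply: (@le_trans _ _ ((1 + `|q|) ^+ k * (1 + b * s) ^+ k)).
    rewrite -exprMn lerXn2r ?nnegrE ?mulr_ge0 ?addr_ge0 ?mulr_ge0 ?(ltW s0)//.
    have : `|y| <= `|q| + b * s.
      have -> : y = q - b * s by rewrite /q; ring.
      by rewrite (le_trans (ler_normB _ _))// lerD2l ger0_norm// mulr_ge0// ltW.
    have : 0 <= `|q| * (b * s) by rewrite !mulr_ge0// ltW.
    lra.
  rewrite ler_wpM2r ?exprn_ge0 ?addr_ge0 ?mulr_ge0 ?(ltW s0)//.
  apply: (le_trans _ (le_trans (cube_le_expR (normr_ge0 q)) _)).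
    by rewrite ler_weXn2l// lerDl.
  by rewrite -normrX ger0_norm// sqr_ge0.
exact: gauss_density_le.
Qed.

Section bounds.
Variables (w v b B : R).
Hypotheses (v0 : 0 < v) (b0 : 0 <= b) (bB : b <= B) (vB : 1 <= B * Num.sqrt v).
Let s := Num.sqrt v.
Let s0 : 0 < s. Proof. by rewrite sqrtr_gt0. Qed.
Let E := expR (b * w + b ^+ 2 * v / 2).
Let E0 : 0 <= E. Proof. exact: expR_ge0. Qed.
Let B0 : 0 <= B. Proof. exact: le_trans bB. Qed.
Let sB : s^-1 <= B. Proof. by rewrite -[s^-1]mul1r ler_pdivrMr. Qed.
Let bsB : (1 + b * s) / s <= 2 * B.
Proof.
rewrite mulrDl mulfK ?gt_eqF// mul1r; have := sB; have := bB; lra.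
Qed.
Let sV0 : 0 <= s^-1. Proof. by rewrite invr_ge0 ltW. Qed.
Let bs0 : 0 <= (1 + b * s) / s.
Proof. by rewrite divr_ge0 ?addr_ge0 ?mulr_ge0// ltW. Qed.

Let pow_bound k : ((1 + b * s) / s) ^+ k / s <= 2 ^+ k * B ^+ k.+1.
Proof.
rewrite exprS mulrCA -exprMn mulrC.
by apply: ler_pM; rewrite ?exprn_ge0// lerXn2r ?nnegrE// mulr_ge0.
Qed.

(** Each derivative of the heat flow is a polynomial times [phi (w / s) / s ^+ k.+1]. The constant
    24 is 3 times the 8 of [poly_gauss_le]. Since [B] dominates both the tilt [b] and [1 / s], each
    factor [(1 + b * s) / s] costs [2 * B] and the last [1 / s] costs [B]. *)
Let gen k (P : R) : (k <= 3)%N -> `|P| <= 3 * (1 + `|w / s|) ^+ k ->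
  `|P * phi (w / s) / s ^+ k.+1| <= 24 * (2 ^+ k * B ^+ k.+1) * E.
Proof.
move=> k3 hP; rewrite normrM (@ger0_norm _ (_^-1)) ?invr_ge0 ?exprn_ge0 ?(ltW s0)//.
rewrite normrM (gtr0_norm (gauss_density_gt0 _)).
have h := poly_gauss_le w v0 b0 k3; rewrite -/s -/E in h.
apply: (@le_trans _ _ (3 * (8 * (1 + b * s) ^+ k * E) / s ^+ k.+1)).
  rewrite ler_wpM2r ?invr_ge0 ?exprn_ge0 ?(ltW s0)//.
  apply: (@le_trans _ _ (3 * ((1 + `|w / s|) ^+ k * phi (w / s)))).
    by rewrite mulrA ler_wpM2r// ltW// gauss_density_gt0.
  by rewrite ler_wpM2l.
have -> : 3 * (8 * (1 + b * s) ^+ k * E) / s ^+ k.+1 =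
    24 * (((1 + b * s) / s) ^+ k / s) * E.
  by rewrite expr_div_n exprS; field; rewrite ?expf_neq0 gt_eqF.
by rewrite ler_wpM2r// ler_wpM2l// pow_bound.
Qed.

Lemma heat1_bound : `|heat1 w v| <= 24 * B * E.
Proof.
have /= := @gen 0 1 isT; rewrite mul1r normr1 !expr1 mul1r; apply.
by rewrite expr0; lra.
Qed.

Lemma heat2_bound : `|heat2 w v| <= 48 * B ^+ 2 * E.
Proof.
have := @gen 1 (- (w / s)) isT; rewrite normrN expr1.
have -> : 24 * (2 * B ^+ 2) * E = 48 * B ^+ 2 * E by ring.
by apply; rewrite /=; have := normr_ge0 (w / s); lra.
Qed.

Lemma heat3_bound : `|heat3 w v| <= 96 * B ^+ 3 * E.
Proof.
have := @gen 2 ((w / s) ^+ 2 - 1) isT.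
have -> : 24 * (2 ^+ 2 * B ^+ 3) * E = 96 * B ^+ 3 * E by ring.
apply; rewrite /= (le_trans (ler_normB _ _))// normr1 normrX.
by have := normr_ge0 (w / s); nra.
Qed.

Lemma heat4_bound : `|heat4 w v| <= 192 * B ^+ 4 * E.
Proof.
have := @gen 3 (3 * (w / s) - (w / s) ^+ 3) isT.
have -> : 24 * (2 ^+ 3 * B ^+ 4) * E = 192 * B ^+ 4 * E by ring.
apply; rewrite /= (le_trans (ler_normB _ _))// normrM normrX (@ger0_norm _ 3)//.
by have := normr_ge0 (w / s); set a := `|_|; move=> a0; have := exprn_ge0 3 a0;
  have := exprn_ge0 2 a0; lra.
Qed.

End bounds.
End HeatKernel.

(** * Sums of independent variables *)

Section IndependentPair.
Context (R : realType) (d d1 d2 : measure_display) (Omega : measurableType d)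
  (T1 : measurableType d1) (T2 : measurableType d2)
  (Pr : probability Omega R) (mu : probability T2 R).

(** The law of [(X, V)] conditioned on [D] agrees with the product on rectangles, hence everywhere
    by uniqueness of the product measure; a null [D] is treated apart. In the application [D] is an
    event about the later variables. *)
Lemma independent_pair_law (X : {mfun Omega >-> T1}) (V : {mfun Omega >-> T2})
    (D : set Omega) : measurable D ->
  (forall A B, measurable A -> measurable B ->
    Pr (X @^-1` A `&` (V @^-1` B `&` D)) =
    (Pr (X @^-1` A) * (mu B * Pr D))%E) ->
  forall C : set (T1 * T2), measurable C ->
  Pr ((fun w => (X w, V w)) @^-1` C `&` D) =
  ((distribution Pr X \x mu) C * Pr D)%E.
Proof.
move=> mD indep C mC.
have mXV : measurable_fun setT (fun w => (X w, V w)).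
  exact: measurable_fun_pair.
have mCD E : measurable E -> measurable ((fun w => (X w, V w)) @^-1` E).
  by move=> mE; rewrite -[_ @^-1` _]setTI; exact: mXV.
have [PD0|PD0] := eqVneq (Pr D) 0%E.
  rewrite PD0 mule0; apply/eqP; rewrite -measure_le0 -PD0.
  apply: le_measure; rewrite ?inE//; exact: measurableI (mCD _ mC) mD.
have Dfin : Pr D \is a fin_num by exact: fin_num_measure.
have q0 : 0 < fine (Pr D).
  by rewrite fine_gt0// lt0e PD0 measure_ge0 -ge0_fin_numE.
have qV0 : 0 <= (fine (Pr D))^-1 by rewrite invr_ge0 ltW.
pose XV0 := isMeasurableFun.Build _ _ _ _ _ mXV.
pose XV : {mfun _ >-> _} := HB.pack (fun w => (X w, V w)) XV0.
pose m'0 : {measure set (T1 * T2) -> \bar R} :=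
  mscale (NngNum qV0) (pushforward (mrestr Pr mD) XV).
pose m' := m'0 mXV.
have m'E E : m' E = ((fine (Pr D))^-1%:E * Pr ((fun w => (X w, V w)) @^-1` E `&` D))%E.
  by [].
rewrite (@product_measure_unique _ _ _ _ _ _ _ m')//.
  rewrite m'E muleAC; have -> : ((fine (Pr D))^-1%:E * Pr D = 1)%E.
    by rewrite -[X in (_ * X)%E](fineK Dfin) -EFinM mulVf// gt_eqF.
  by rewrite mul1e.
move=> A B mA mB; rewrite m'E.
have -> : (fun w => (X w, V w)) @^-1` (A `*` B) `&` D =
    X @^-1` A `&` (V @^-1` B `&` D).
  by apply/seteqP; split => w /= [] => [[]|? []].
rewrite indep// muleCA; congr (_ * _)%E; rewrite muleCA.
rewrite -[X in (_ * (_ * X))%E](fineK Dfin) -EFinM mulVf ?mule1// gt_eqF//.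
Qed.

End IndependentPair.

Section IidSums.
Context (R : realType) (d1 d2 : measure_display) (Omega : measurableType d1)
  (Pr : probability Omega R) (S : measurableType d2) (mu : probability S R).
Variables (n : nat) (W : 'I_n -> Omega -> S).
Hypothesis mW : forall i, measurable_fun setT (W i).
Hypothesis lawW : forall i (A : set S), measurable A -> Pr (W i @^-1` A) = mu A.
Hypothesis indepW : forall A : 'I_n -> set S, (forall i, measurable (A i)) ->
  Pr (\bigcap_i (W i @^-1` A i)) = (\big[*%E/1%E]_(i < n) Pr (W i @^-1` A i))%E.
Variable Y : S -> R.
Hypothesis mY : measurable_fun setT Y.

Definition psum k (w : Omega) : R := \sum_(i < n | (i < k)%N) Y (W i w).

Lemma measurable_psum k : measurable_fun setT (psum k).
Proof.
have -> : psum k = fun w => \sum_(i < n) if (i < k)%N then Y (W i w) else 0.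
  by apply/funext => w; rewrite /psum big_mkcond.
apply: (@measurable_sum _ _ _ _ _ _ (fun (i : 'I_n) w => if (i < k)%N then Y (W i w) else 0)).
by move=> i; case: (i < k)%N; [exact: measurableT_comp|exact: measurable_cst].
Qed.

Lemma psumS (k : 'I_n) w : psum k.+1 w = psum k w + Y (W k w).
Proof.
rewrite /psum (bigD1 k)//= addrC; congr (_ + _); apply: eq_bigl => i.
by rewrite ltnS ltn_neqAle andbC.
Qed.

Lemma psum_full w : psum n w = \sum_(i < n) Y (W i w).
Proof. by rewrite /psum; apply: eq_bigl => i; rewrite ltn_ord. Qed.

Let tail k (B : 'I_n -> set S) : set Omega :=
  \bigcap_(i in [set i : 'I_n | (k <= i)%N]) (W i @^-1` B i).

Let mtail k B : (forall i, measurable (B i)) -> measurable (tail k B).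
Proof.
move=> mB; apply: fin_bigcap_measurable => // i _.
by rewrite -[_ @^-1` _]setTI; exact: mW.
Qed.

Let mpair k (i : 'I_n) : measurable_fun setT (fun w => (psum k w, W i w)).
Proof. exact: measurable_fun_pair (measurable_psum k) (mW i). Qed.

Let tailS (k : 'I_n) B : tail k B = W k @^-1` B k `&` tail k.+1 B.
Proof.
apply/seteqP; split => w /=.
  by move=> h; split; [exact: (h k (leqnn _))|move=> i /= /ltnW; exact: h].
move=> [h1 h2] i /=; rewrite leq_eqVlt => /orP[/eqP/val_inj <-//|]; exact: h2.
Qed.

Let PrtailE k B : (forall i, measurable (B i)) ->
  Pr (tail k B) = (\big[*%E/1%E]_(i < n | (k <= i)%N) mu (B i))%E.
Proof.
move=> mB; have -> : tail k B =
    \bigcap_i (W i @^-1` (if (k <= i)%N then B i else setT)).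
  apply/seteqP; split => w /= h i /=.
    by move=> _; case: ifP => // ki; exact: h.
  by move=> ki; have := h i I; rewrite ki.
rewrite indepW; last by move=> i; case: ifP.
rewrite [RHS]big_mkcond; apply: eq_bigr => i _; case: ifP => _.
  exact: lawW.
by rewrite preimage_setT probability_setT.
Qed.

Let PrtailS (k : 'I_n) B : (forall i, measurable (B i)) ->
  Pr (tail k B) = (mu (B k) * Pr (tail k.+1 B))%E.
Proof.
move=> mB; rewrite !PrtailE// (bigD1 k)//=; congr (_ * _)%E.
by apply: eq_bigl => i; rewrite ltn_neqAle eq_sym andbC.
Qed.

Let psumM k : {mfun Omega >-> R} :=
  HB.pack (psum k) (isMeasurableFun.Build _ _ _ _ _ (measurable_psum k)).
Let WM i : {mfun Omega >-> S} :=
  HB.pack (W i) (isMeasurableFun.Build _ _ _ _ _ (mW i)).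

Let tailT k : tail k (fun=> setT) = setT.
Proof. by apply/seteqP; split. Qed.

Let pair_law (k : 'I_n) :
  (forall A B, measurable A -> (forall i, measurable (B i)) ->
    Pr (psum k @^-1` A `&` tail k B) = (Pr (psum k @^-1` A) * Pr (tail k B))%E) ->
  forall B, (forall i, measurable (B i)) ->
  forall C : set (R * S), measurable C ->
  Pr ((fun w => (psum k w, W k w)) @^-1` C `&` tail k.+1 B) =
  ((distribution Pr (psumM k) \x mu) C * Pr (tail k.+1 B))%E.
Proof.
move=> IH B mB C mC.
apply: (@independent_pair_law _ _ _ _ _ _ _ Pr mu (psumM k) (WM k)) => //.
  exact: mtail.
(* [B'] puts the constraint [V] at index [k], which [tail k.+1] does not see, so the hypothesis at
   level [k] applies to it. *)
move=> A V mA mV; pose B' i := if i == k then V else B i.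
have mB' i : measurable (B' i) by rewrite /B'; case: ifP.
have tB' : tail k.+1 B = tail k.+1 B'.
  apply/seteqP; split => w /= h i /= ki; have := h i ki;
    by rewrite /B' [i == k]gtn_eqF.
have B'k : B' k = V by rewrite /B' eqxx.
by have := IH A B' mA mB'; rewrite PrtailS// tailS -tB' B'k.
Qed.

(** The induction carries all the later variables jointly: passing from [k] to [k + 1] absorbs [W k]
    into the sum, and the new sum must still be independent of the rest. *)
Let psum_tail_indep k : (k <= n)%N ->
  forall A B, measurable A -> (forall i, measurable (B i)) ->
  Pr (psum k @^-1` A `&` tail k B) = (Pr (psum k @^-1` A) * Pr (tail k B))%E.
Proof.
elim: k => [_ A B mA mB|k IH kn A B mA mB].
  have -> : psum 0 = cst 0 by apply/funext => w; rewrite /psum big_pred0.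
  rewrite preimage_cst; case: ifP => _.
    by rewrite setTI probability_setT mul1e.
  by rewrite set0I measure0 mul0e.
pose ik := Ordinal kn; have IHk := IH (ltnW kn).
pose C := [set x : R * S | A (x.1 + Y x.2)].
have mC : measurable C.
  rewrite -[C]setTI; have : measurable_fun setT (fun x : R * S => x.1 + Y x.2); last by exact.
  apply: measurable_funD => //.
  exact: measurableT_comp.
have CE : psum k.+1 @^-1` A = (fun w => (psum k w, W ik w)) @^-1` C.
  by apply/seteqP; split => w; rewrite /C /= (psumS ik).
have := @pair_law ik IHk (fun=> setT) (fun=> measurableT) C mC.
rewrite tailT setIT probability_setT mule1 CE => ->.
exact: (@pair_law ik IHk B mB C mC).
Qed.

(** Integrates out the newest summand. Independence enters the exponential moments and the Lindeberg
    replacement through this identity. *)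
Lemma integral_psumS (k : 'I_n) (F : R -> \bar R) : measurable_fun setT F ->
  (forall x, (0 <= F x)%E) ->
  (\int[Pr]_w F (psum k.+1 w) = \int[Pr]_w \int[mu]_s F (psum k w + Y s)%R)%E.
Proof.
move=> mF F0.
pose G (x : R * S) := F (x.1 + Y x.2).
have mG : measurable_fun setT G.
  apply: (measurableT_comp mF); apply: measurable_funD => //.
  exact: measurableT_comp.
pose XV : {mfun Omega >-> (R * S)%type} := HB.pack (fun w => (psum k w, W k w))
  (isMeasurableFun.Build _ _ _ _ _ (mpair k k)).
transitivity (\int[distribution Pr XV]_x G x)%E.
  rewrite ge0_integral_distribution//; last by move=> x; exact: F0.
  by apply: eq_integral => w _; rewrite /G /= psumS.
transitivity (\int[distribution Pr (psumM k) \x mu]_x G x)%E.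
  apply: eq_measure_integral => C mC _.
  have kn : (k <= n)%N by exact: ltnW.
  have := @pair_law k (psum_tail_indep kn) (fun=> setT) (fun=> measurableT) C mC.
  by rewrite tailT setIT probability_setT mule1.
rewrite fubini_tonelli1//; last by move=> x; exact: F0.
rewrite ge0_integral_distribution//.
- by apply: measurable_fun_fubini_tonelli_F => // x; exact: F0.
- by move=> x; apply: integral_ge0 => s _; exact: F0.
Qed.

End IidSums.

(** Three nested mean value theorems, which give the remainder with constant 1 instead of 1/6 but
    ask for no more than pointwise derivatives. *)
Lemma taylor3 (R : realType) (f f1 f2 f3 : R -> R) (w y : R) :
  (forall x : R, is_derive x 1 f (f1 x)) -> (forall x : R, is_derive x 1 f1 (f2 x)) ->
  (forall x : R, is_derive x 1 f2 (f3 x)) ->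
  exists2 c, `|c| <= `|y| &
    `|f (w + y) - f w - y * f1 w - y ^+ 2 / 2 * f2 w| <= `|y| ^+ 3 * `|f3 (w + c)|.
Proof.
move=> d1 d2 d3.
pose g (z : R) := f (w + z) - z * f1 w - z ^+ 2 / 2 * f2 w.
pose g1 (z : R) := f1 (w + z) - f1 w - z * f2 w.
have dsh (h h1 : R -> R) (z : R) : (forall x : R, is_derive x 1 h (h1 x)) ->
    is_derive z 1 (fun z : R => h (w + z)) (h1 (w + z)).
  move=> dh; have h0 := dh (w + z).
  by apply: is_derive_eq; rewrite add0r /GRing.scale /= mulr1.
have dg (z : R) : is_derive z 1 g (g1 z).
  have h0 := dsh _ _ z d1.
  by apply: is_derive_eq; rewrite /g1 !scaler0 /GRing.scale /=; field.
have [c1 c1y E1] := MVT_norm 0 y dg.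
have dg1 (z : R) : is_derive z 1 (fun z : R => f1 (w + z) - z * f2 w) (f2 (w + z) - f2 w).
  have h0 := dsh _ _ z d2.
  by apply: is_derive_eq; rewrite !scaler0 /GRing.scale /=; ring.
have [c2 c2c1 E2] := MVT_norm 0 c1 dg1.
have [c3 c3c2 E3] := MVT_norm w (w + c2) d3.
rewrite !subr0 in c1y c2c1 E1 E2.
exists (c3 - w).
  by rewrite (le_trans c3c2)// addrAC subrr add0r (le_trans c2c1).
have -> : f (w + y) - f w - y * f1 w - y ^+ 2 / 2 * f2 w = g1 c1 * y.
  by rewrite -E1 /g !addr0; ring.
have -> : g1 c1 = (f2 (w + c2) - f2 w) * c1.
  by rewrite -E2 /g1 addr0; ring.
rewrite E3 addrAC subrr add0r subrKC 3!normrM.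
have c21 : `|c2| * `|c1| <= `|y| * `|y|.
  by apply: ler_pM => //; exact: le_trans c2c1 _.
have : `|c2| * `|c1| * (`|y| * `|f3 c3|) <= `|y| * `|y| * (`|y| * `|f3 c3|).
  by rewrite ler_wpM2r// mulr_ge0.
lra.
Qed.

(** * Moments of truncated variables and exponential inequalities *)

Section Markov.
Context (R : realType) (d : measure_display) (Omega : measurableType d)
  (Pr : probability Omega R).

Lemma markov_nonneg (A : set Omega) (F : Omega -> R) (c : R) :
  measurable A -> measurable_fun setT F -> 0 <= c -> (forall w, 0 <= F w) ->
  (forall w, A w -> c <= F w) ->
  (c%:E * Pr A <= \int[Pr]_w (F w)%:E)%E.
Proof.
move=> mA mF c0 F0 cF; rewrite -integral_cst//.
apply: (@le_trans _ _ (\int[Pr]_(w in A) (F w)%:E)%E).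
  apply: ge0_le_integral => //.
  - by apply/measurable_EFinP; exact: measurable_funTS.
apply: ge0_subset_integral => //.
- exact/measurable_EFinP.
- by move=> w _; rewrite lee_fin.
Qed.

End Markov.

Section Moments.
Context (R : realType) (d2 : measure_display) (S : measurableType d2)
  (mu : probability S R).
Variables (Z : S -> R) (A : R).
Hypothesis mZ : measurable_fun setT Z.
Hypothesis iZ : mu.-integrable setT (EFin \o Z).
Hypothesis EZ : (\int[mu]_s (Z s)%:E = 0)%E.
Hypothesis iZ2 : mu.-integrable setT (fun s => (Z s ^+ 2)%:E).
Hypothesis EZ2 : (\int[mu]_s (Z s ^+ 2)%:E = 1)%E.
Hypothesis EZ4 : (\int[mu]_s (Z s ^+ 4)%:E <= (A ^+ 2)%:E)%E.

Lemma integral_cst1 (c : R) : (\int[mu]_s c%:E = c%:E)%E.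
Proof.
transitivity (c%:E * mu setT)%E; first exact: (integral_cst mu measurableT c%:E).
have -> : mu setT = 1%E by exact: probability_setT.
by rewrite mule1.
Qed.

Lemma integrable_pow4 : mu.-integrable setT (fun s => (Z s ^+ 4)%:E).
Proof.
apply/integrableP; split.
  by apply/measurable_EFinP; exact: measurable_funX.
under eq_integral do rewrite gee0_abs ?lee_fin ?exprn_even_ge0//.
by apply: (le_lt_trans EZ4); rewrite ltry.
Qed.

(** Expectations of functions of the truncated variable are bounded by dominating them pointwise by
    a polynomial in the untruncated [Z], whose moments are 0, 1 and at most [A ^+ 2]. A cubic term
    is avoided by [trunc_cube_le]. *)
Lemma integral_le_poly (f : S -> R) (c0 k1 k2 k4 : R) : measurable_fun setT f ->
  (forall s, 0 <= f s) -> 0 <= k4 ->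
  (forall s, f s <= c0 + k1 * Z s + k2 * Z s ^+ 2 + k4 * Z s ^+ 4) ->
  (\int[mu]_s (f s)%:E <= (c0 + k2 + k4 * A ^+ 2)%:E)%E.
Proof.
move=> mf f0 k40 fle.
apply: (@le_trans _ _
  (\int[mu]_s (c0 + k1 * Z s + k2 * Z s ^+ 2 + k4 * Z s ^+ 4)%:E)%E).
  apply: ge0_le_integral => //.
  - by move=> s _; rewrite lee_fin.
  - exact/measurable_EFinP.
  - apply/measurable_EFinP.
    repeat apply: measurable_funD => //; apply: measurable_funM => //;
      exact: measurable_funX.
  - by move=> s _; rewrite lee_fin.
have i4 := integrable_pow4.
have ic : mu.-integrable setT (fun s : S => c0%:E).
  exact: finite_measure_integrable_cst.
have i1 : mu.-integrable setT (fun s => (k1%:E * (Z s)%:E)%E).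
  exact: integrableZl.
have i2 : mu.-integrable setT (fun s => (k2%:E * (Z s ^+ 2)%:E)%E).
  exact: integrableZl.
have i4' : mu.-integrable setT (fun s => (k4%:E * (Z s ^+ 4)%:E)%E).
  exact: integrableZl.
have -> : (fun s => (c0 + k1 * Z s + k2 * Z s ^+ 2 + k4 * Z s ^+ 4)%:E) =
  (fun s => (c0%:E + k1%:E * (Z s)%:E + k2%:E * (Z s ^+ 2)%:E + k4%:E * (Z s ^+ 4)%:E)%E).
  by apply/funext => s; rewrite !EFinD !EFinM.
rewrite integralD//; last by repeat apply: integrableD.
rewrite integralD//; last by apply: integrableD.
have Ec : (\int[mu]_s c0%:E = c0%:E)%E.
  exact: integral_cst1.
rewrite integralD// Ec.
rewrite !integralZl// EZ EZ2 mule0 adde0 mule1 !EFinD EFinM.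
by rewrite leeD2l// lee_wpmul2l.
Qed.

(** Integrate [(Z ^+ 2 - 1) ^+ 2 >= 0]. *)
Lemma moment4_ge1 : 1 <= A ^+ 2.
Proof.
have h : (\int[mu]_s 1%:E <= (2 + - 2 + 1 * A ^+ 2)%:E)%E.
  apply: (@integral_le_poly (fun=> 1) 2 0 (- 2) 1) => // s.
  by have := sqr_ge0 (Z s ^+ 2 - 1); lra.
move: h; rewrite (_ : (\int[mu]_s 1%:E = 1)%E).
  by rewrite lee_fin; lra.
exact: integral_cst1.
Qed.

Definition trunc t (s : S) : R := if `|Z s| <= t then Z s else 0.

Lemma measurable_trunc t : measurable_fun setT (trunc t).
Proof.
apply: measurable_fun_ifT => //.
by apply: measurable_fun_ler => //; apply: measurableT_comp.
Qed.

Lemma trunc_le t s : 0 <= t -> `|trunc t s| <= t.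
Proof. by move=> t0; rewrite /trunc; case: ifP => // _; rewrite normr0. Qed.

Lemma trunc_sqr_le t s : trunc t s ^+ 2 <= Z s ^+ 2.
Proof. by rewrite /trunc; case: ifP => // _; rewrite expr0n/= sqr_ge0. Qed.

Lemma trunc_pow4_le t s : trunc t s ^+ 4 <= Z s ^+ 4.
Proof. by rewrite /trunc; case: ifP => // _; rewrite expr0n/= exprn_even_ge0. Qed.

Lemma trunc_err t s : 0 < t -> `|trunc t s - Z s| <= Z s ^+ 4 / t ^+ 3.
Proof.
have z4 : 0 <= Z s ^+ 4 by exact: exprn_even_ge0.
move=> t0; rewrite /trunc; case: ifPn => [_|].
  by rewrite subrr normr0 divr_ge0 ?z4// exprn_ge0// ltW.
rewrite -ltNge => tZ; rewrite sub0r normrN ler_pdivlMr ?exprn_gt0//.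
have -> : Z s ^+ 4 = `|Z s| * `|Z s| ^+ 3.
  by rewrite -exprS -normrX ger0_norm// exprn_even_ge0.
by rewrite ler_wpM2l// lerXn2r ?nnegrE ?ltW// (lt_trans t0).
Qed.

Lemma trunc_sqr_err t s : 0 < t ->
  `|trunc t s ^+ 2 - Z s ^+ 2| <= Z s ^+ 4 / t ^+ 2.
Proof.
have z4 : 0 <= Z s ^+ 4 by exact: exprn_even_ge0.
move=> t0; rewrite /trunc; case: ifPn => [_|].
  by rewrite subrr normr0 divr_ge0 ?z4// exprn_ge0// ltW.
rewrite -ltNge => tZ; rewrite expr0n/= sub0r normrN ler_pdivlMr ?exprn_gt0//.
have -> : Z s ^+ 4 = `|Z s ^+ 2| * `|Z s| ^+ 2.
  by rewrite normrX -exprD -normrX ger0_norm// exprn_even_ge0.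
by rewrite ler_wpM2l// lerXn2r ?nnegrE ?ltW// (lt_trans t0).
Qed.

(** Arithmetic-geometric mean inequality, weighted by [A] so that both terms on the right have
    expectation at most [A]. *)
Lemma trunc_cube_le t s : 0 < A ->
  `|trunc t s| ^+ 3 <= (A * Z s ^+ 2 + Z s ^+ 4 / A) / 2.
Proof.
move=> A0; apply: (@le_trans _ _ (`|Z s| ^+ 3)).
  rewrite lerXn2r ?nnegrE// /trunc; case: ifP => // _; by rewrite normr0.
have -> : Z s ^+ 2 = `|Z s| ^+ 2 by rewrite -normrX ger0_norm// sqr_ge0.
have -> : Z s ^+ 4 = `|Z s| ^+ 4.
  by rewrite -normrX ger0_norm// exprn_even_ge0.
have z0 := normr_ge0 (Z s); set z := `|Z s| in z0 *.
rewrite ler_pdivlMr// -subr_ge0.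
have -> : A * z ^+ 2 + z ^+ 4 / A - z ^+ 3 * 2 = z ^+ 2 * ((A - z) ^+ 2 / A).
  by field; rewrite gt_eqF.
by rewrite mulr_ge0 ?sqr_ge0// divr_ge0 ?sqr_ge0// ltW.
Qed.

End Moments.

Section Chernoff.
Context (R : realType) (d1 d2 : measure_display) (Omega : measurableType d1)
  (Pr : probability Omega R) (S : measurableType d2) (mu : probability S R).
Variables (n : nat) (W : 'I_n -> Omega -> S).
Hypothesis mW : forall i, measurable_fun setT (W i).
Hypothesis lawW : forall i (A : set S), measurable A -> Pr (W i @^-1` A) = mu A.
Hypothesis indepW : forall A : 'I_n -> set S, (forall i, measurable (A i)) ->
  Pr (\bigcap_i (W i @^-1` A i)) = (\big[*%E/1%E]_(i < n) Pr (W i @^-1` A i))%E.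
Variable g : S -> R.
Hypothesis mg : measurable_fun setT g.

Lemma psum0 w : psum W g 0 w = 0.
Proof. by rewrite /psum big_pred0. Qed.

Lemma mgf_psum (q : R) : 0 <= q -> (\int[mu]_s (expR (g s))%:E <= q%:E)%E ->
  forall k, (k <= n)%N -> (\int[Pr]_w (expR (psum W g k w))%:E <= (q ^+ k)%:E)%E.
Proof.
move=> q0 hq; elim=> [_|k IH kn].
  under eq_integral do rewrite psum0 expR0.
  by rewrite integral_cst1 expr0.
have mE : measurable_fun setT (fun x : R => (expR x)%:E).
  by apply/measurable_EFinP; exact: measurable_expR.
have mps j : measurable_fun setT (fun w => (expR (psum W g j w))%:E).
  apply/measurable_EFinP; apply: measurableT_comp => //.
  exact: measurable_psum.
rewrite (integral_psumS mW lawW indepW mg (Ordinal kn) mE); last first.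
  by move=> x; rewrite lee_fin expR_ge0.
have mgE : measurable_fun setT (fun s => (expR (g s))%:E).
  by apply/measurable_EFinP; exact: measurableT_comp.
have splitE w : (\int[mu]_s (expR (psum W g k w + g s))%:E =
    (expR (psum W g k w))%:E * \int[mu]_s (expR (g s))%:E)%E.
  under eq_integral do rewrite expRD EFinM.
  by rewrite ge0_integralZl// => s _; rewrite lee_fin expR_ge0.
apply: (@le_trans _ _ (\int[Pr]_w (q%:E * (expR (psum W g k w))%:E))%E).
  apply: ge0_le_integral => //.
  - by move=> w _; apply: integral_ge0 => s _; rewrite lee_fin expR_ge0.
  - by under eq_fun do rewrite splitE; exact: emeasurable_funM.
  - exact: emeasurable_funM.
  - by move=> w _; rewrite splitE muleC lee_wpmul2r// lee_fin expR_ge0.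
rewrite ge0_integralZl//.
by rewrite exprS EFinM lee_wpmul2l// IH// ltnW.
Qed.

Lemma measurable_sumW : measurable_fun setT (fun w => \sum_(i < n) g (W i w)).
Proof.
have -> : (fun w => \sum_(i < n) g (W i w)) = psum W g n.
  by apply/funext => w; rewrite psum_full.
exact: measurable_psum.
Qed.

Lemma measurable_sumW_ge (x : R) :
  measurable [set w | x <= \sum_(i < n) g (W i w)].
Proof.
rewrite -[X in measurable X]setTI.
have := measurable_sumW measurableT (measurable_itv `[x, +oo[).
by congr measurable; apply/seteqP; split=> w /=; rewrite in_itv/= andbT.
Qed.

Lemma chernoff_iid (q x : R) : 0 <= q -> (\int[mu]_s (expR (g s))%:E <= q%:E)%E ->
  (Pr [set w | (x <= \sum_(i < n) g (W i w))%R] <= (expR (- x) * q ^+ n)%:E)%E.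
Proof.
move=> q0 hq.
have mF : measurable_fun setT (fun w => expR (psum W g n w)).
  by apply: measurableT_comp => //; exact: measurable_psum.
have mA := measurable_sumW_ge x.
have := @markov_nonneg _ _ _ Pr _ (fun w => expR (psum W g n w)) (expR x)
  mA mF (expR_ge0 _) (fun=> expR_ge0 _).
move=> /(_ _)/le_trans/(_ (mgf_psum q0 hq (leqnn n))) h.
rewrite expRN mulrC EFinM lee_pdivlMr ?expR_gt0// muleC; apply: h.
by move=> w /= xw; rewrite ler_expR psum_full.
Qed.

End Chernoff.

Ltac nonneg :=
  lazymatch goal with
  | |- is_true (0 <= _ * _) => apply: mulr_ge0; nonneg
  | |- is_true (0 <= _ + _) => apply: addr_ge0; nonneg
  | |- is_true (0 <= _^-1) => rewrite invr_ge0; nonneg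
  | |- is_true (0 <= _ ^+ 2) => exact: sqr_ge0
  | |- is_true (0 <= _ ^+ _) => apply: exprn_ge0; nonneg
  | |- is_true (0 <= _%:R) => exact: ler0n
  | |- is_true (0 <= expR _) => exact: expR_ge0
  | |- is_true (0 <= `|_|) => exact: normr_ge0
  | |- is_true (0 <= Num.sqrt _) => exact: sqrtr_ge0
  | |- _ => first [assumption | apply: ltW; assumption | done]
  end.

Lemma expR_taylor (R : realType) (u D : R) : `|u| <= D ->
  expR u <= 1 + u + u ^+ 2 / 2 + `|u| ^+ 3 * expR D.
Proof.
move=> uD; have [c cu] := taylor3 0 u (@is_derive_expR R) (@is_derive_expR R)
  (@is_derive_expR R).
rewrite !add0r expR0 => /ler_normlP[_].
have : `|u| ^+ 3 * `|expR c| <= `|u| ^+ 3 * expR D.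
  rewrite ler_wpM2l// ger0_norm ?expR_ge0// ler_expR.
  exact: le_trans (ler_norm c) (le_trans cu uD).
lra.
Qed.

(** * Moderate deviations of truncated sums *)

Section HeatStep.
Context (R : realType) (d2 : measure_display) (S : measurableType d2)
  (mu : probability S R).
Variables (Z : S -> R) (A : R).
Hypothesis mZ : measurable_fun setT Z.
Hypothesis iZ : mu.-integrable setT (EFin \o Z).
Hypothesis EZ : (\int[mu]_s (Z s)%:E = 0)%E.
Hypothesis iZ2 : mu.-integrable setT (fun s => (Z s ^+ 2)%:E).
Hypothesis EZ2 : (\int[mu]_s (Z s ^+ 2)%:E = 1)%E.
Hypothesis EZ4 : (\int[mu]_s (Z s ^+ 4)%:E <= (A ^+ 2)%:E)%E.
Hypothesis A0 : 0 < A.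
Variables (N t b B D : R).
Hypotheses (N0 : 0 < N) (t0 : 0 < t) (b0 : 0 <= b) (bB : b <= B) (B0 : 0 < B).
Hypothesis btD : b * t / N <= D.

Local Notation Y := (trunc Z t).

Let bYD s : b * `|Y s / N| <= D.
Proof.
apply: le_trans btD; rewrite normrM (@ger0_norm _ N^-1) ?invr_ge0 ?(ltW N0)//.
rewrite -mulrA ler_wpM2l// ler_wpM2r ?invr_ge0 ?(ltW N0)//.
by apply: trunc_le; exact: ltW.
Qed.

Let mYN : measurable_fun setT (fun s => Y s / N).
Proof. by apply: measurable_funM => //; exact: measurable_trunc. Qed.

(** Excess of the log-Laplace transform of the whole sum over the Gaussian value [b ^+ 2 / 2]: the
    bias of the truncated mean, then the cubic Taylor remainder. *)
Definition mgf_rate : R := b * A ^+ 2 * N / t ^+ 3 + b ^+ 3 * expR D * A / N.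

Lemma mgf_rate_ge0 : 0 <= mgf_rate.
Proof. rewrite /mgf_rate; nonneg. Qed.

Lemma mgf_trunc :
  (\int[mu]_s (expR (b * (Y s / N)))%:E <=
   (expR ((b ^+ 2 / 2 + mgf_rate) / N ^+ 2))%:E)%E.
Proof.
have NV0 : 0 <= N^-1 by rewrite invr_ge0 ltW.
have K0 : 0 <= b ^+ 3 * expR D by rewrite mulr_ge0 ?exprn_ge0// expR_ge0.
set K := b ^+ 3 * expR D in K0.
apply: (@le_trans _ _ (1 + (b ^+ 2 / 2 / N ^+ 2 + K * A / 2 / N ^+ 3) +
    (b / N / t ^+ 3 + K / A / 2 / N ^+ 3) * A ^+ 2)%:E).
  apply: (@integral_le_poly _ _ _ mu Z A mZ iZ EZ iZ2 EZ2 EZ4 _ _ (b / N)) => //.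
  - by apply: measurableT_comp => //; apply: measurable_funM.
  - nonneg.
  - move=> s; have hu : `|b * (Y s / N)| <= D by rewrite normrM ger0_norm.
    have := expR_taylor hu.
    have e1 : b * (Y s / N) <= b / N * Z s + b / N / t ^+ 3 * Z s ^+ 4.
      have := trunc_err Z s t0; move/ler_normlP => [_ h].
      have : b / N * (Y s - Z s) <= b / N * (Z s ^+ 4 / t ^+ 3).
        by rewrite ler_wpM2l// mulr_ge0.
      lra.
    have e2 : (b * (Y s / N)) ^+ 2 / 2 <= b ^+ 2 / 2 / N ^+ 2 * Z s ^+ 2.
      have -> : (b * (Y s / N)) ^+ 2 / 2 = b ^+ 2 / 2 / N ^+ 2 * Y s ^+ 2.
        by field; rewrite gt_eqF.
      by rewrite ler_wpM2l ?trunc_sqr_le//; nonneg.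
    have e3 : `|b * (Y s / N)| ^+ 3 * expR D <=
       K * A / 2 / N ^+ 3 * Z s ^+ 2 + K / A / 2 / N ^+ 3 * Z s ^+ 4.
      have -> : `|b * (Y s / N)| ^+ 3 * expR D = K / N ^+ 3 * `|Y s| ^+ 3.
        rewrite !normrM (ger0_norm b0) (ger0_norm NV0) /K; field.
        by rewrite gt_eqF.
      have h := trunc_cube_le Z t s A0.
      have := ler_wpM2l _ h => /(_ (K / N ^+ 3)).
      have -> : K / N ^+ 3 * ((A * Z s ^+ 2 + Z s ^+ 4 / A) / 2) =
        K * A / 2 / N ^+ 3 * Z s ^+ 2 + K / A / 2 / N ^+ 3 * Z s ^+ 4.
        by field; rewrite ?gt_eqF.
      by apply; rewrite mulr_ge0// invr_ge0 exprn_ge0// ltW.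
    lra.
rewrite lee_fin.
have -> : 1 + (b ^+ 2 / 2 / N ^+ 2 + K * A / 2 / N ^+ 3) +
    (b / N / t ^+ 3 + K / A / 2 / N ^+ 3) * A ^+ 2 =
    1 + (b ^+ 2 / 2 + mgf_rate) / N ^+ 2.
  by rewrite /mgf_rate -/K; field; rewrite ?gt_eqF.
exact: expR_ge1Dx.
Qed.

(** The four terms are, in order, the truncation bias of the mean, that of the variance, the
    third-order remainder in space and the second-order remainder in time. *)
Definition heat_rate : R :=
  24 * B * A ^+ 2 * N / t ^+ 3 + 24 * B ^+ 2 * A ^+ 2 / t ^+ 2 +
  96 * B ^+ 3 * expR D * A / N + 48 * B ^+ 4 / N ^+ 2.

Lemma heat_rate_ge0 : 0 <= heat_rate.
Proof. rewrite /heat_rate; nonneg. Qed.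

(* Replacing one summand by a Gaussian increment of the same variance, i.e. by
   1/N^2 units of heat flow; the error carries the tilt [expR (b * w)]. *)
Lemma heat_step w v : 0 < v -> 1 <= B * Num.sqrt v ->
  (\int[mu]_s (heat (w + Y s / N) v)%:E <=
   (heat w (v + (N ^+ 2)^-1) + heat_rate / N ^+ 2 *
    expR (b * w + b ^+ 2 * (v + (N ^+ 2)^-1) / 2))%:E)%E.
Proof.
move=> v0 Bv.
have NV0 : 0 <= N^-1 by rewrite invr_ge0 ltW.
have NV2 : 0 < (N ^+ 2)^-1 by rewrite invr_gt0 exprn_gt0.
set dl := (N ^+ 2)^-1 in NV2 *.
set E := expR _; have E0 : 0 <= E by exact: expR_ge0.
have expE x v' : v' <= v + dl -> b * x <= b * w ->
    expR (b * x + b ^+ 2 * v' / 2) <= E.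
  move=> hv hx; rewrite ler_expR.
  have : b ^+ 2 * v' <= b ^+ 2 * (v + dl) by rewrite ler_wpM2l ?exprn_ge0.
  lra.
have sqv v' : v <= v' -> 1 <= B * Num.sqrt v'.
  by move=> vv; apply: (le_trans Bv); rewrite ler_wpM2l ?(ltW B0)// ler_wsqrtr.
have vdl : v <= v + dl by rewrite lerDl ltW.
(* Time expansion: its term [dl / 2 * heat2 w v] cancels the variance term of the space expansion
   below, since the summand has variance [dl] before truncation. *)
have htime : heat w v <= heat w (v + dl) - dl / 2 * heat2 w v + 48 * B ^+ 4 * E * dl ^+ 2.
  have [|c /andP[vc cv] E1] := @MVT_on _ (heat w) (fun v => heat2 w v / 2) v (v + dl) _ vdl.
    by move=> x /andP[vx _]; apply: is_derive_heat_time; exact: lt_le_trans vx.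
  have [|c' /andP[vc' cc'] E2] := @MVT_on _ (heat2 w) (fun v => heat4 w v / 2) v c _ vc.
    by move=> x /andP[vx _]; apply: is_derive_heat2_time; exact: lt_le_trans vx.
  have c'0 : 0 < c' by exact: lt_le_trans vc'.
  have h4 := heat4_bound w c'0 b0 bB (sqv _ vc').
  have h4E : `|heat4 w c'| <= 192 * B ^+ 4 * E.
    apply: (le_trans h4); apply: ler_wpM2l; first by nonneg.
    by apply: expE => //; exact: le_trans cv.
  have dE : v + dl - v = dl by rewrite addrAC subrr add0r.
  rewrite dE in E1.
  have -> : heat w v = heat w (v + dl) - dl / 2 * heat2 w v
       - dl / 2 * (heat4 w c' / 2 * (c - v)).
    rewrite -E2; move: E1; set x1 := heat w (v + dl); set x0 := heat w v.
    by move: x1 x0 => x1 x0; lra.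
  rewrite lerD2l -mulrN.
  have cv0 : 0 <= c - v <= dl by lra.
  case/andP: cv0 => cv0 cv1.
  have h5 : - (heat4 w c' / 2 * (c - v)) <= 192 * B ^+ 4 * E / 2 * dl.
    apply: (le_trans (ler_norm _)); rewrite normrN normrM.
    apply: ler_pM => //; last by rewrite ger0_norm.
    by rewrite normrM (@ger0_norm _ 2^-1)// ler_wpM2r.
  have : dl / 2 * - (heat4 w c' / 2 * (c - v)) <= dl / 2 * (192 * B ^+ 4 * E / 2 * dl).
    by rewrite ler_wpM2l// mulr_ge0// ltW.
  lra.
have h1E : `|heat1 w v| <= 24 * B * E.
  apply: (le_trans (heat1_bound w v0 b0 bB Bv)).
  by rewrite ler_wpM2l ?mulr_ge0 ?(ltW B0)// expE.
have h2E : `|heat2 w v| <= 48 * B ^+ 2 * E.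
  apply: (le_trans (heat2_bound w v0 b0 bB Bv)).
  by rewrite ler_wpM2l ?mulr_ge0 ?exprn_ge0 ?(ltW B0)// expE.
pose K := 96 * B ^+ 3 * (expR D * E).
have K0 : 0 <= K by rewrite !mulr_ge0 ?exprn_ge0 ?expR_ge0 ?(ltW B0).
(* Space expansion: truncation gives [b * c <= D] at the intermediate point, so the factor [expR D]
   moves the tilt from [w + c] back to [w]. *)
have hspace s : heat (w + Y s / N) v <= heat w v + Y s / N * heat1 w v +
    (Y s / N) ^+ 2 / 2 * heat2 w v + `|Y s / N| ^+ 3 * K.
  have [c cy] := taylor3 w (Y s / N) (fun x => is_derive_heat x v)
    (fun x => is_derive_heat1 x v0) (fun x => is_derive_heat2 x v0).
  move/ler_normlP => [_].
  have h3 := heat3_bound (w + c) v0 b0 bB Bv.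
  have h3E : `|heat3 (w + c) v| <= K.
    apply: (le_trans h3); rewrite ler_wpM2l ?mulr_ge0 ?exprn_ge0 ?(ltW B0)//.
    rewrite /E -expRD ler_expR.
    have : b * c <= D.
      apply: le_trans (bYD s); rewrite ler_wpM2l//.
      exact: le_trans (ler_norm c) cy.
    have : 0 <= b ^+ 2 * dl by rewrite mulr_ge0 ?exprn_ge0// ltW.
    lra.
  have : `|Y s / N| ^+ 3 * `|heat3 (w + c) v| <= `|Y s / N| ^+ 3 * K.
    by rewrite ler_wpM2l.
  clear htime h1E h2E h3 h3E K0 E0 expE sqv vdl NV0 NV2 cy Bv v0; lra.
set h1 := heat1 w v in h1E hspace; set h2 := heat2 w v in h2E hspace htime.
apply: (@le_trans _ _ ((heat w v) + (h2 / 2 * dl + K * A / 2 / N ^+ 3) +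
    (`|h1| / N / t ^+ 3 + `|h2| / 2 * dl / t ^+ 2 + K / A / 2 / N ^+ 3) * A ^+ 2)%:E).
  apply: (@integral_le_poly _ _ _ mu Z A mZ iZ EZ iZ2 EZ2 EZ4 _ _ (h1 / N)) => //.
  - have mPhi : measurable_fun setT (@Phi R).
      exact: continuous_measurable_fun (@continuous_Phi R).
    apply: measurableT_comp => //; apply: measurable_funM => //.
    exact: measurable_funD.
  - by move=> s; exact: Phi_ge0.
  - nonneg.
  - move=> s; apply: (le_trans (hspace s)).
    have e1 : Y s / N * h1 <= h1 / N * Z s + `|h1| / N / t ^+ 3 * Z s ^+ 4.
      have h := trunc_err Z s t0.
      have : h1 / N * (Y s - Z s) <= `|h1| / N * (Z s ^+ 4 / t ^+ 3).
        apply: (le_trans (ler_norm _)); rewrite !normrM (ger0_norm NV0).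
        by rewrite ler_wpM2l// mulr_ge0.
      lra.
    have e2 : (Y s / N) ^+ 2 / 2 * h2 <=
        h2 / 2 * dl * Z s ^+ 2 + `|h2| / 2 * dl / t ^+ 2 * Z s ^+ 4.
      have -> : (Y s / N) ^+ 2 / 2 * h2 = h2 / 2 * dl * Y s ^+ 2.
        by rewrite /dl; field; rewrite gt_eqF.
      have h := trunc_sqr_err Z s t0.
      have : h2 / 2 * dl * (Y s ^+ 2 - Z s ^+ 2) <= `|h2| / 2 * dl * (Z s ^+ 4 / t ^+ 2).
        apply: (le_trans (ler_norm _)); rewrite normrM.
        rewrite (normrM _ dl) (normrM h2) (@ger0_norm _ 2^-1)// (gtr0_norm NV2).
        by rewrite ler_wpM2l// !mulr_ge0// ltW.
      lra.
    have e3 : `|Y s / N| ^+ 3 * K <=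
       K * A / 2 / N ^+ 3 * Z s ^+ 2 + K / A / 2 / N ^+ 3 * Z s ^+ 4.
      have -> : `|Y s / N| ^+ 3 * K = K / N ^+ 3 * `|Y s| ^+ 3.
        by rewrite !normrM (ger0_norm NV0); field; rewrite gt_eqF.
      have h := trunc_cube_le Z t s A0.
      have := ler_wpM2l _ h => /(_ (K / N ^+ 3)).
      have -> : K / N ^+ 3 * ((A * Z s ^+ 2 + Z s ^+ 4 / A) / 2) =
        K * A / 2 / N ^+ 3 * Z s ^+ 2 + K / A / 2 / N ^+ 3 * Z s ^+ 4.
        by field; rewrite ?gt_eqF.
      by apply; rewrite mulr_ge0// invr_ge0 exprn_ge0// ltW.
    lra.
rewrite lee_fin.
have f1 : `|h1| / N / t ^+ 3 * A ^+ 2 <= 24 * B * E / N / t ^+ 3 * A ^+ 2.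
  rewrite ler_wpM2r ?exprn_ge0 ?(ltW A0)// ler_wpM2r ?invr_ge0 ?exprn_ge0 ?(ltW t0)//.
  by rewrite ler_wpM2r.
have f2 : `|h2| / 2 * dl / t ^+ 2 * A ^+ 2 <= 48 * B ^+ 2 * E / 2 * dl / t ^+ 2 * A ^+ 2.
  rewrite ler_wpM2r ?exprn_ge0 ?(ltW A0)// ler_wpM2r ?invr_ge0 ?exprn_ge0 ?(ltW t0)//.
  by rewrite ler_wpM2r ?(ltW NV2)// ler_wpM2r.
have g1 : 24 * B * E / N / t ^+ 3 * A ^+ 2 = 24 * B * A ^+ 2 * N / t ^+ 3 * dl * E.
  by rewrite /dl; field; rewrite ?gt_eqF.
have g2 : K * A / 2 / N ^+ 3 + K / A / 2 / N ^+ 3 * A ^+ 2 =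
   96 * B ^+ 3 * expR D * A / N * dl * E.
  by rewrite /dl /K; field; rewrite ?gt_eqF.
have g3 : 48 * B ^+ 4 * E * dl ^+ 2 = 48 * B ^+ 4 / N ^+ 2 * dl * E.
  by rewrite /dl; field; rewrite ?gt_eqF.
have g4 : 48 * B ^+ 2 * E / 2 * dl / t ^+ 2 * A ^+ 2 =
   24 * B ^+ 2 * A ^+ 2 / t ^+ 2 * dl * E.
  by field; rewrite ?gt_eqF.
rewrite -/dl /heat_rate -/(E).
rewrite g1 in f1; rewrite g4 in f2; rewrite g3 in htime.
lra.
Qed.

End HeatStep.

Section Lindeberg.
Context (R : realType) (d1 d2 : measure_display) (Omega : measurableType d1)
  (Pr : probability Omega R) (S : measurableType d2) (mu : probability S R).
Variables (n : nat) (W : 'I_n -> Omega -> S).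
Hypothesis n0 : (0 < n)%N.
Hypothesis mW : forall i, measurable_fun setT (W i).
Hypothesis lawW : forall i (A : set S), measurable A -> Pr (W i @^-1` A) = mu A.
Hypothesis indepW : forall A : 'I_n -> set S, (forall i, measurable (A i)) ->
  Pr (\bigcap_i (W i @^-1` A i)) = (\big[*%E/1%E]_(i < n) Pr (W i @^-1` A i))%E.
Variables (Z : S -> R) (A : R).
Hypothesis mZ : measurable_fun setT Z.
Hypothesis iZ : mu.-integrable setT (EFin \o Z).
Hypothesis EZ : (\int[mu]_s (Z s)%:E = 0)%E.
Hypothesis iZ2 : mu.-integrable setT (fun s => (Z s ^+ 2)%:E).
Hypothesis EZ2 : (\int[mu]_s (Z s ^+ 2)%:E = 1)%E.
Hypothesis EZ4 : (\int[mu]_s (Z s ^+ 4)%:E <= (A ^+ 2)%:E)%E.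
Hypothesis A0 : 0 < A.
Variables (t b D : R).
Hypotheses (t0 : 0 < t) (b0 : 0 <= b).
Local Notation N := (Num.sqrt n%:R : R).
Hypothesis btD : b * t / N <= D.

Let N0 : 0 < N. Proof. by rewrite sqrtr_gt0 ltr0n. Qed.
Let N2 : N ^+ 2 = n%:R. Proof. by rewrite sqr_sqrtr ?ler0n. Qed.

Let g s := trunc Z t s / N.
Let mg : measurable_fun setT g.
Proof. by apply: measurable_funM => //; exact: measurable_trunc. Qed.

Local Notation T := (psum W g).
Local Notation rho := (mgf_rate A N t b D).

Lemma mgf_trunc_psum k : (k <= n)%N ->
  (\int[Pr]_w (expR (b * T k w))%:E <=
   (expR (b ^+ 2 / 2 * (k%:R / n%:R) + rho))%:E)%E.
Proof.
move=> kn.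
have mbg : measurable_fun setT (fun s => b * g s) by exact: measurable_funM.
have h := mgf_psum mW lawW indepW mbg (expR_ge0 _)
  (mgf_trunc mZ iZ EZ iZ2 EZ2 EZ4 A0 N0 t0 b0 btD) kn.
have -> : (fun w => (expR (b * T k w))%:E) =
    (fun w => (expR (psum W (fun s => b * g s) k w))%:E).
  by apply/funext => w; rewrite /psum mulr_sumr.
apply: (le_trans h); rewrite lee_fin -expRM_natl ler_expR N2.
have n1 : 0 < n%:R :> R by rewrite ltr0n.
have -> : k%:R * ((b ^+ 2 / 2 + rho) / n%:R) =
  b ^+ 2 / 2 * (k%:R / n%:R) + rho * (k%:R / n%:R).
  by field; rewrite gt_eqF.
rewrite lerD2l ler_piMr ?mgf_rate_ge0//.
by rewrite ler_pdivrMr// mul1r ler_nat.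
Qed.

Variables (h B x' : R).
Hypotheses (bB : b <= B) (B0 : 0 < B) (h0 : 0 < h) (hB : 1 <= B * h).
Local Notation rate := (heat_rate A N t B D).

Let rate_ge0 : 0 <= rate. Proof. exact: heat_rate_ge0. Qed.

(** Heat time left after [k] summands: the smoothing [h ^+ 2] plus the variance of the summands not
    yet added. *)
Let v k : R := h ^+ 2 + (n - k)%:R / n%:R.

Let v0 k : 0 < v k.
Proof. by rewrite ltr_pwDl ?exprn_gt0// divr_ge0. Qed.

Let Bv k : 1 <= B * Num.sqrt (v k).
Proof.
apply: (le_trans hB); rewrite ler_wpM2l ?(ltW B0)//.
rewrite -[leLHS](@ger0_norm _ h) ?(ltW h0)// -sqrtr_sqr ler_wsqrtr//.
by rewrite lerDl divr_ge0.
Qed.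

Let vS k : (k < n)%N -> v k.+1 + (N ^+ 2)^-1 = v k.
Proof.
move=> kn; rewrite N2 /v -addrA; congr (_ + _).
have -> : (n - k)%N = (n - k.+1).+1 by rewrite -subSn.
by rewrite -[in RHS]natr1 mulrDl mul1r.
Qed.

Let mheat (u y : R) : measurable_fun setT (fun x : R => heat (x - y) u).
Proof.
have mPhi : measurable_fun setT (@Phi R).
  exact: continuous_measurable_fun (@continuous_Phi R).
apply: measurableT_comp => //; apply: measurable_funM => //.
exact: measurable_funB.
Qed.

Let Err := rate * expR (- b * x' + b ^+ 2 / 2 * (h ^+ 2 + 1) + rho).

(** The variance gained by [T k] is lost by [v k], so the expected tilt at every step is bounded by
    the same exponential in [Err]. Each step therefore costs at most [Err / n]. *)
Let lindeberg_iter k : (k <= n)%N ->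
  (\int[Pr]_w (heat (T k w - x') (v k))%:E <=
   (heat (- x') (h ^+ 2 + 1) + k%:R / n%:R * Err)%:E)%E.
Proof.
have n1 : 0 < n%:R :> R by rewrite ltr0n.
elim: k => [_|k IH kn].
  under eq_integral do rewrite psum0 sub0r.
  rewrite integral_cst1 /v subn0 divff ?gt_eqF// mul0r mul0r addr0//.
have mH j u : measurable_fun setT (fun w => (heat (T j w - x') u)%:E).
  apply/measurable_EFinP; apply: (measurableT_comp (mheat u x')).
  exact: measurable_psum.
have mE j : measurable_fun setT (fun w => (expR (b * T j w))%:E).
  apply/measurable_EFinP; apply: measurableT_comp => //.
  by apply: measurable_funM => //; exact: measurable_psum.
rewrite (integral_psumS mW lawW indepW mg (Ordinal kn)
  (F := fun x => (heat (x - x') (v k.+1))%:E)); last 2 first.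
- exact/measurable_EFinP.
- by move=> x; rewrite lee_fin Phi_ge0.
set c := rate / N ^+ 2 * expR (- b * x' + b ^+ 2 * v k / 2).
have c0 : 0 <= c by have r0 := rate_ge0; rewrite /c; nonneg.
apply: (@le_trans _ _ (\int[Pr]_w ((heat (T k w - x') (v k))%:E +
    c%:E * (expR (b * T k w))%:E))%E).
  apply: ge0_le_integral => //.
  - by move=> w _; apply: integral_ge0 => s _; rewrite lee_fin Phi_ge0.
  - apply: (measurableT_comp (f := fun x : R => (\int[mu]_s (heat (x + g s - x') (v k.+1))%:E)%E)).
      apply: (measurable_fun_fubini_tonelli_F
        (fun p : R * S => (heat (p.1 + g p.2 - x') (v k.+1))%:E)).
        apply/measurable_EFinP; apply: (measurableT_comp (mheat _ x')).
        by apply: measurable_funD => //; exact: measurableT_comp.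
      by move=> p; rewrite lee_fin Phi_ge0.
    exact: measurable_psum.
  - by apply: emeasurable_funD => //; exact: emeasurable_funM.
  - move=> w _.
    have := heat_step mZ iZ EZ iZ2 EZ2 EZ4 A0 N0 t0 b0 bB B0 btD
      (T k w - x') (v0 k.+1) (Bv k.+1).
    rewrite vS// => hs.
    under eq_integral => s _ do rewrite addrAC.
    apply: (le_trans hs); rewrite -EFinM -EFinD lee_fin lerD2l /c -[leRHS]mulrA -expRD.
    by rewrite le_eqVlt; apply/orP; left; apply/eqP; congr (_ * expR _); ring.
rewrite ge0_integralD//; last 3 first.
- by move=> w _; rewrite lee_fin Phi_ge0.
- by move=> w _; rewrite mule_ge0// lee_fin// expR_ge0.
- exact: emeasurable_funM.
rewrite ge0_integralZl//.
have -> : heat (- x') (h ^+ 2 + 1) + k.+1%:R / n%:R * Err =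
   (heat (- x') (h ^+ 2 + 1) + k%:R / n%:R * Err) + Err / n%:R.
  by rewrite -natr1; field; rewrite gt_eqF.
rewrite EFinD; apply: leeD; first exact/IH/ltnW.
apply: (@le_trans _ _ (c%:E * (expR (b ^+ 2 / 2 * (k%:R / n%:R) + rho))%:E)%E).
  by rewrite lee_wpmul2l ?lee_fin//; apply: mgf_trunc_psum; exact: ltnW.
rewrite -EFinM lee_fin /c -[leLHS]mulrA -expRD N2 (_ : Err / n%:R = rate / n%:R *
  expR (- b * x' + b ^+ 2 / 2 * (h ^+ 2 + 1) + rho)); last by rewrite mulrAC.
rewrite ler_wpM2l//; first by rewrite divr_ge0// heat_rate_ge0.
rewrite ler_expR /v natrB ?(ltnW kn)//.
by rewrite le_eqVlt; apply/orP; left; apply/eqP; field; rewrite gt_eqF.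
Qed.

(** Markov's inequality for the smooth step [Phi ((y - x') / h)], which is the heat function at the
    final time [h ^+ 2] and is at least [Phi ((x - x') / h)] on the event. *)
Lemma lindeberg_tail x :
  (Pr [set w | (x <= \sum_(i < n) g (W i w))%R] * (Phi ((x - x') / h))%:E <=
   (heat (- x') (h ^+ 2 + 1) +
    rate * expR (- b * x' + b ^+ 2 / 2 * (h ^+ 2 + 1) + rho))%:E)%E.
Proof.
have mA := measurable_sumW_ge mW mg x.
have := lindeberg_iter (leqnn n).
rewrite divff ?pnatr_eq0 -?lt0n// mul1r; apply: le_trans.
rewrite muleC; apply: markov_nonneg => //.
- by apply: (measurableT_comp (mheat _ x')); exact: measurable_psum.
- exact: Phi_ge0.
- by move=> w; exact: Phi_ge0.
- move=> w /= xw; rewrite /heat /v subnn mul0r addr0 sqrtr_sqr (gtr0_norm h0).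
  apply: Phi_homo; rewrite ler_wpM2r ?invr_ge0 ?(ltW h0)//.
  by rewrite lerD2r psum_full.
Qed.

End Lindeberg.

(** * Calibration of the error terms in powers of r *)

Section Rates.
Variable R : realType.
Variables (C1 r L A N b : R).
Hypotheses (C10 : 0 < C1) (r0 : 0 < r) (r1 : r <= 1) (L1 : 1 <= L) (A1 : 1 <= A) (N0 : 0 < N).
Hypothesis ALN : A * L ^+ 2 <= C1 * N * r ^+ 16.
Hypotheses (b0 : 0 <= b) (bL : b ^+ 2 <= 2 * L).

Let L0 : 0 < L. Proof. exact: lt_le_trans L1. Qed.
Let A0 : 0 < A. Proof. exact: lt_le_trans A1. Qed.
(** Eliminating [A] through this quotient, bounded by [C1], turns each error term into a power of
    [r] times ratios that are bounded because [b ^+ 2 <= 2 * L]. *)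
Let y := A * L ^+ 2 / (N * r ^+ 16).
Let y0 : 0 <= y. Proof. rewrite /y; nonneg. Qed.
Let yC : y <= C1.
Proof. rewrite ler_pdivrMr ?mulr_gt0 ?exprn_gt0//; move: ALN; lra. Qed.
Let AE : A = y * N * r ^+ 16 / L ^+ 2.
Proof. by rewrite /y; field; rewrite ?gt_eqF. Qed.
Let rX k : r ^+ k <= 1. Proof. by rewrite exprn_ile1// ltW. Qed.
Let rX1 k : r ^+ k.+1 <= r.
Proof. by rewrite exprS ler_piMr ?rX// ltW. Qed.
Let y2C : y ^+ 2 <= C1 ^+ 2. Proof. by rewrite lerXn2r// ?nnegrE// ltW. Qed.

(* Chosen so that P(max |Z_ij| > t), the truncation bias and the Chernoff
   exponents are all controlled by powers of [r]. *)
Definition trunc_level : R := N * r ^+ 4 / L.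
Local Notation t := trunc_level.
Lemma trunc_level_gt0 : 0 < t.
Proof. by rewrite /t divr_gt0 ?mulr_gt0 ?exprn_gt0. Qed.

Let b15 : b <= 3 / 2 * L.
Proof. have := sqr_ge0 (b - 1); move: bL L1; lra. Qed.

Lemma tilt_trunc_level_le : b * t / N <= 2.
Proof.
have -> : b * t / N = b / L * r ^+ 4 by rewrite /t; field; rewrite ?gt_eqF.
have : b / L <= 3 / 2 by rewrite ler_pdivrMr//; lra.
have : 0 <= b / L by nonneg.
have := rX 4; have : 0 <= r ^+ 4 by nonneg.
nra.
Qed.

Definition mgf_bound : R := 3 / 2 * C1 ^+ 2 + 3 * expR 2 * C1.

Lemma mgf_rate_le : mgf_rate A N t b 2 <= mgf_bound.
Proof.
rewrite /mgf_rate /mgf_bound.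
have -> : b * A ^+ 2 * N / t ^+ 3 = b / L * (y ^+ 2 * r ^+ 20).
  by rewrite AE /t; field; rewrite ?gt_eqF.
have -> : b ^+ 3 * expR 2 * A / N = b ^+ 3 / L ^+ 2 * (expR 2 * (y * r ^+ 16)).
  by rewrite AE; field; rewrite ?gt_eqF.
apply: lerD.
  apply: ler_pM; [by nonneg|by nonneg| |].
    by rewrite ler_pdivrMr.
  by rewrite -[leRHS]mulr1; apply: ler_pM; rewrite ?exprn_ge0// ltW.
rewrite -[leRHS]mulrA; apply: ler_pM; [by nonneg|by nonneg| |].
  rewrite ler_pdivrMr ?exprn_gt0//.
  have -> : b ^+ 3 = b ^+ 2 * b by ring.
  have -> : 3 * L ^+ 2 = (2 * L) * (3 / 2 * L) by field.
  by apply: ler_pM => //; nonneg.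
rewrite ler_wpM2l ?expR_ge0// -[leRHS]mulr1.
by apply: ler_pM; rewrite ?exprn_ge0// ltW.
Qed.

Let q := 1 + b.
Let q1 : 1 <= q. Proof. by rewrite /q lerDl. Qed.
Let q0 : 0 < q. Proof. exact: lt_le_trans q1. Qed.
Let q2 : q ^+ 2 <= 6 * L.
Proof. rewrite /q; have := sqr_ge0 (b - 1); move: bL L1; lra. Qed.
Let q6 : q <= 6 * L.
Proof. by apply: le_trans q2; rewrite expr2 ler_peMl// ltW. Qed.
Let q4 : q ^+ 4 <= (6 * L) ^+ 2.
Proof.
have -> : q ^+ 4 = (q ^+ 2) ^+ 2 by rewrite -exprM.
by rewrite lerXn2r ?nnegrE//; nonneg.
Qed.
Let q3 : q ^+ 3 <= (6 * L) ^+ 2.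
Proof. by apply: le_trans q4; rewrite ler_weXn2l. Qed.
Let q5 : q ^+ 5 <= (6 * L) ^+ 3.
Proof.
rewrite exprS (exprS _ 2); apply: ler_pM => //; nonneg.
Qed.

Definition heat_bound : R :=
  (24 * 6 + 24 * 36 + 48 * 216) * C1 ^+ 2 + 96 * 36 * expR 2 * C1.

(** The factor [q] pays for the Mills ratio, which compares [exp(- b^2 / 2)] with the tail at [b];
    [q / r ^+ 2] is the inverse of the smoothing width in [moderate_deviation]. *)
Lemma heat_rate_le : q * heat_rate A N t (q / r ^+ 2) 2 <= heat_bound * r.
Proof.
rewrite /heat_rate /heat_bound.
have -> : q * (24 * (q / r ^+ 2) * A ^+ 2 * N / t ^+ 3 +
     24 * (q / r ^+ 2) ^+ 2 * A ^+ 2 / t ^+ 2 +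
     96 * (q / r ^+ 2) ^+ 3 * expR 2 * A / N + 48 * (q / r ^+ 2) ^+ 4 / N ^+ 2) =
  24 * (q ^+ 2 / L * (y ^+ 2 * r ^+ 18)) +
  24 * (q ^+ 3 / L ^+ 2 * (y ^+ 2 * r ^+ 20)) +
  96 * expR 2 * (q ^+ 4 / L ^+ 2 * (y * r ^+ 10)) +
  48 * (q ^+ 5 / L ^+ 4 * ((y / A) ^+ 2 * r ^+ 24)).
  by rewrite /y /t; field; rewrite ?gt_eqF.
have yA : (y / A) ^+ 2 <= C1 ^+ 2.
  rewrite lerXn2r ?nnegrE//; [by nonneg|by nonneg|].
  by apply: le_trans yC; rewrite ler_pdivrMr// ler_peMr.
have gen c u k c' u' : 0 <= c -> 0 <= u -> c <= c' -> u <= u' ->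
    c * (u * r ^+ k.+1) <= c' * (u' * r).
  move=> c0 u0 cc uu; apply: ler_pM => //; [by nonneg|].
  by apply: ler_pM => //; nonneg.
have g1 : q ^+ 2 / L * (y ^+ 2 * r ^+ 18) <= 6 * (C1 ^+ 2 * r).
  apply: gen; [by nonneg|by nonneg| |by []].
  by rewrite ler_pdivrMr.
have g2 : q ^+ 3 / L ^+ 2 * (y ^+ 2 * r ^+ 20) <= 36 * (C1 ^+ 2 * r).
  apply: gen; [by nonneg|by nonneg| |by []].
  by rewrite ler_pdivrMr ?exprn_gt0// (le_trans q3)//; lra.
have g3 : q ^+ 4 / L ^+ 2 * (y * r ^+ 10) <= 36 * (C1 * r).
  apply: gen; [by nonneg|by nonneg| |by []].
  by rewrite ler_pdivrMr ?exprn_gt0// (le_trans q4)//; lra.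
have g4 : q ^+ 5 / L ^+ 4 * ((y / A) ^+ 2 * r ^+ 24) <= 216 * (C1 ^+ 2 * r).
  apply: gen; [by nonneg|by nonneg| |by []].
  rewrite ler_pdivrMr ?exprn_gt0// (le_trans q5)//.
  have -> : (6 * L) ^+ 3 = 216 * (L ^+ 3) by ring.
  by apply: ler_wpM2l; [exact: ler0n|exact: ler_weXn2l].
have : 96 * expR 2 * (q ^+ 4 / L ^+ 2 * (y * r ^+ 10)) <=
    96 * expR 2 * (36 * (C1 * r)).
  by rewrite ler_wpM2l//; nonneg.
lra.
Qed.

End Rates.

Section TailConstants.
Variables (R : realType) (C1 : R).
Hypothesis C10 : 0 < C1.

Definition lindeberg_const : R :=
  heat_bound C1 * (Num.sqrt (2 * pi) * expR (3 + mgf_bound C1)).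

Definition tail_const : R := 2 * (2 * expR (5 / 2) + 4 + lindeberg_const) + 2.

Lemma lindeberg_const_ge0 : 0 <= lindeberg_const.
Proof. rewrite /lindeberg_const /heat_bound; nonneg. Qed.

Lemma tail_const_ge0 : 0 <= tail_const.
Proof. have := lindeberg_const_ge0; rewrite /tail_const => ?; nonneg. Qed.

End TailConstants.

Section Tail.
Context (R : realType) (d1 d2 : measure_display) (Omega : measurableType d1)
  (Pr : probability Omega R) (S : measurableType d2) (mu : probability S R).
Variables (n : nat) (W : 'I_n -> Omega -> S).
Hypothesis n0 : (0 < n)%N.
Hypothesis mW : forall i, measurable_fun setT (W i).
Hypothesis lawW : forall i (A : set S), measurable A -> Pr (W i @^-1` A) = mu A.
Hypothesis indepW : forall A : 'I_n -> set S, (forall i, measurable (A i)) ->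
  Pr (\bigcap_i (W i @^-1` A i)) = (\big[*%E/1%E]_(i < n) Pr (W i @^-1` A i))%E.
Variables (Z : S -> R) (A : R).
Hypothesis mZ : measurable_fun setT Z.
Hypothesis iZ : mu.-integrable setT (EFin \o Z).
Hypothesis EZ : (\int[mu]_s (Z s)%:E = 0)%E.
Hypothesis iZ2 : mu.-integrable setT (fun s => (Z s ^+ 2)%:E).
Hypothesis EZ2 : (\int[mu]_s (Z s ^+ 2)%:E = 1)%E.
Hypothesis EZ4 : (\int[mu]_s (Z s ^+ 4)%:E <= (A ^+ 2)%:E)%E.
Hypothesis A1 : 1 <= A.
Local Notation N := (Num.sqrt n%:R : R).
Variables (C1 r L : R).
Hypotheses (C10 : 0 < C1) (r0 : 0 < r) (r1 : r <= 1 / 2) (L1 : 1 <= L).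
Hypothesis ALN : A * L ^+ 2 <= C1 * N * r ^+ 16.
Local Notation t := (trunc_level r L N).

Lemma moderate_deviation x : (0 <= x -> x ^+ 2 <= 2 * L) ->
  (Pr [set w | (x <= \sum_(i < n) trunc Z t (W i w) / N)%R] <=
   ((1 - Phi x) * (1 + tail_const C1 * r))%:E)%E.
Proof.
move: r0 r1 L1 => r0' r1' L1' xL.
have N0 : 0 < N by rewrite sqrtr_gt0 ltr0n.
have r11 : r <= 1 by lra.
have A0 : 0 < A by exact: lt_le_trans A1.
have t0 : 0 < t by exact: trunc_level_gt0.
(* The tilt is the level itself; at a negative level the tail exceeds 1/2 and no tilt is
   required. *)
pose b := Num.max x 0.
have b0 : 0 <= b by rewrite /b le_max lexx orbT.
have xb : x <= b by rewrite /b le_max lexx.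
have bL : b ^+ 2 <= 2 * L.
  rewrite /b; have [x0|x0] := leP 0 x; first exact: xL.
  by rewrite expr0n/=; lra.
pose q := 1 + b.
have q1 : 1 <= q by rewrite /q lerDl.
have q0 : 0 < q by lra.
(* The step is centred [r / q] below [x], that is [1 / r] smoothing widths, so its value at [x] is
   [Phi r^-1 >= 1 - r]; a shift by [r / q] costs the tail only a factor [1 + O(r)]. *)
pose h := r ^+ 2 / q; pose B := q / r ^+ 2; pose x' := x - r / q.
have h0 : 0 < h by rewrite divr_gt0 ?exprn_gt0.
have B0 : 0 < B by rewrite divr_gt0 ?exprn_gt0.
have Bh : B * h = 1 by rewrite /B /h; field; rewrite ?gt_eqF.
have hB : 1 <= B * h by rewrite Bh.
have bB : b <= B.
  rewrite /B ler_pdivlMr ?exprn_gt0//.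
  have : r ^+ 2 <= 1 by rewrite exprn_ile1// ltW.
  move=> r21; have : b * r ^+ 2 <= b * 1 by rewrite ler_wpM2l.
  by rewrite /q; lra.
have btD := tilt_trunc_level_le r0 r11 L1 N0 b0 bL.
have := lindeberg_tail n0 mW lawW indepW mZ iZ EZ iZ2 EZ2 EZ4 A0 t0 b0 btD x' bB B0 h0 hB x.
have -> : (x - x') / h = r^-1 by rewrite /x' /h; field; rewrite ?gt_eqF.
have hr := heat_rate_le C10 r0 r11 L1 A1 N0 ALN b0 bL.
have mr := mgf_rate_le C10 r0 r11 L1 A1 N0 ALN b0 bL.
rewrite -/q -/B in hr.
set rate := heat_rate _ _ _ _ _ in hr *; set rho := mgf_rate _ _ _ _ _ in mr *.
have rate0 : 0 <= rate by exact: heat_rate_ge0.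
have bh : b * h <= 1.
  by apply: (@le_trans _ _ (B * h)); [rewrite ler_wpM2r// ltW|rewrite Bh].
set P := Pr _.
set tl := 1 - Phi x.
have tl0 : 0 < tl by rewrite subr_gt0 Phi_lt1.
have dens0 : 0 < Num.sqrt (2 * pi : R) by exact: lt_le_trans ltr01 (@sqrt2pi_ge1 R).
(* Since [b * x = b ^+ 2], the exponent is [- b ^+ 2 / 2] up to a constant, and the Mills bound
   absorbs it into [q] times the tail. *)
have err : rate * expR (- b * x' + b ^+ 2 / 2 * (h ^+ 2 + 1) + rho) <=
    lindeberg_const C1 * r * tl.
  have e1 : expR (- b * x' + b ^+ 2 / 2 * (h ^+ 2 + 1) + rho) <=
      expR (3 / 2 + mgf_bound C1) * expR (- b ^+ 2 / 2).
    rewrite -expRD ler_expR.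
    have -> : - b * x' = - (b * x) + r * (b / q).
      by rewrite /x'; field; rewrite gt_eqF.
    have -> : b * x = b ^+ 2.
      rewrite /b; have [x0|x0] := leP 0 x; first by rewrite expr2.
      by rewrite expr0n/= mul0r.
    have : r * (b / q) <= 1.
      rewrite -[leRHS]mulr1; apply: ler_pM; rewrite ?divr_ge0 ?(ltW r0) ?(ltW q0)//.
      by rewrite ler_pdivrMr// mul1r /q; lra.
    have : (b * h) ^+ 2 <= 1 by rewrite exprn_ile1// mulr_ge0// ltW.
    have -> : b ^+ 2 / 2 * (h ^+ 2 + 1) = (b * h) ^+ 2 / 2 + b ^+ 2 / 2 by ring.
    lra.
  have e2 : expR (- b ^+ 2 / 2) <= Num.sqrt (2 * pi) * expR (3 / 2) * q * tl.
    have tlb : 1 - Phi b <= tl by rewrite lerD2l lerN2 Phi_homo.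
    have := le_trans (Phi_tail_ge b0) tlb.
    rewrite ler_pdivrMr// -/q /gauss_density expRN ler_pdivrMr ?expR_gt0// ler_pdivrMr//.
    lra.
  apply: (@le_trans _ _ (rate * (expR (3 / 2 + mgf_bound C1) *
      (Num.sqrt (2 * pi) * expR (3 / 2) * q * tl)))).
    rewrite ler_wpM2l//; apply: (le_trans e1).
    by rewrite ler_wpM2l ?expR_ge0.
  have -> : rate * (expR (3 / 2 + mgf_bound C1) *
      (Num.sqrt (2 * pi) * expR (3 / 2) * q * tl)) =
    (q * rate) * (Num.sqrt (2 * pi) * (expR (3 / 2) * expR (3 / 2 + mgf_bound C1)) * tl).
    by ring.
  rewrite -expRD.
  have -> : 3 / 2 + (3 / 2 + mgf_bound C1) = 3 + mgf_bound C1 by field.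
  have -> : lindeberg_const C1 * r * tl = (heat_bound C1 * r) *
     (Num.sqrt (2 * pi) * expR (3 + mgf_bound C1) * tl).
    by rewrite /lindeberg_const; ring.
  rewrite ler_wpM2r//; nonneg.
(* The offset [r / q] and the rescaling by [sqrt(h^2 + 1)] together amount to a shift of at most
   [d = 2 * r / q]. *)
have main : heat (- x') (h ^+ 2 + 1) <= tl * (1 + (2 * expR (5 / 2) + 4) * r).
  pose d := 2 * r / q.
  have s1 : 1 <= Num.sqrt (h ^+ 2 + 1).
    by rewrite -[leLHS]sqrtr1 ler_wsqrtr// lerDr exprn_ge0// ltW.
  have s0 : 0 < Num.sqrt (h ^+ 2 + 1) by exact: lt_le_trans s1.
  have s2 : Num.sqrt (h ^+ 2 + 1) <= 1 + h ^+ 2.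
    rewrite -[leRHS](@ger0_norm _ (1 + h ^+ 2)) ?addr_ge0 ?exprn_ge0 ?(ltW h0)//.
    rewrite -sqrtr_sqr ler_wsqrtr//.
    by have := sqr_ge0 h; nra.
  have hr' : h <= r / q.
    rewrite /h ler_wpM2r ?invr_ge0 ?(ltW q0)// expr2 ler_piMr// ltW//.
  have le1 : - x' / Num.sqrt (h ^+ 2 + 1) <= - (x - d).
    rewrite ler_pdivrMr//.
    have xd : - (x - d) = - x' + r / q by rewrite /x' /d; ring.
    rewrite xd.
    have rq0 : 0 <= r / q by rewrite divr_ge0// ltW.
    have [x0|x0] := leP 0 x'.
      have : x' * (Num.sqrt (h ^+ 2 + 1) - 1) <= b * h ^+ 2.
        apply: ler_pM => //; [by rewrite subr_ge0| |by lra].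
        by rewrite (le_trans _ xb)// /x' gerBl.
      have : b * h ^+ 2 <= r / q.
        have -> : b * h ^+ 2 = (b * h) * h by ring.
        by apply: le_trans hr'; rewrite ler_piMl// ltW.
      have : r / q <= r / q * Num.sqrt (h ^+ 2 + 1) by rewrite ler_peMr.
      lra.
    have : 0 <= - x' * (Num.sqrt (h ^+ 2 + 1) - 1).
      by rewrite mulr_ge0 ?subr_ge0// oppr_ge0 ltW.
    have : 0 <= r / q * Num.sqrt (h ^+ 2 + 1) by rewrite mulr_ge0// ltW.
    lra.
  apply: (le_trans (Phi_homo le1)); rewrite PhiN.
  have d0 : 0 <= d by rewrite /d divr_ge0 ?mulr_ge0// ltW.
  have [x0|x0] := leP 0 x.
    have bx : b = x by rewrite /b max_l.
    have dq : d * (1 + x) = 2 * r.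
      by rewrite /d /q bx divfK// gt_eqF// ltr_pwDl.
    have dx1 : d * (1 + x) <= 1 by rewrite dq; lra.
    have := Phi_tail_shift x0 d0 dx1; rewrite dq => /le_trans; apply.
    rewrite -/tl ler_wpM2l ?(ltW tl0)//.
    have := expR_gt0 (5 / 2 : R); nra.
  have tl12 : 1 / 2 <= tl.
    by have := @Phi_homo R _ _ (ltW x0); rewrite Phi0 /tl; lra.
  have dr : d <= 2 * r.
    by rewrite /d ler_pdivrMr// ler_peMr// mulr_ge0// ltW.
  have : Phi x - Phi (x - d) <= d.
    have := @Phi_lipschitz R (x - d) x; rewrite subKr; apply.
    by rewrite gerBl.
  have : 0 <= tl * (expR (5 / 2) * r) by nonneg.
  have : r <= tl * (2 * r) by nra.
  rewrite /tl; lra.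
have Phir : 1 - r <= Phi r^-1.
  have rV1 : 1 <= r^-1 by rewrite invf_ge1.
  have := le_trans (Phi_tail_le rV1) (gauss_density_le _).
  have -> : - r^-1 ^+ 2 / 2 = - (r^-1 ^+ 2 / 2) by rewrite mulNr.
  rewrite expRN.
  have h1 : 1 + r^-1 ^+ 2 / 2 <= expR (r^-1 ^+ 2 / 2) by exact: expR_ge1Dx.
  have : (expR (r^-1 ^+ 2 / 2))^-1 <= r.
    rewrite invf_ple ?posrE ?expR_gt0//.
    apply: le_trans h1.
    have : 2 <= r^-1 by rewrite -[2]invrK lef_pV2 ?posrE//; lra.
    nra.
  lra.
have mg : measurable_fun setT (fun s => trunc Z t s / N).
  by apply: measurable_funM => //; exact: measurable_trunc.
have Pfin : P = (fine P)%:E.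
  by rewrite fineK// fin_num_measure//; exact: (measurable_sumW_ge mW mg).
have P0 : 0 <= fine P by exact/fine_ge0/measure_ge0.
rewrite Pfin -EFinM !lee_fin => hP.
have hP1 : fine P * (1 - r) <= tl * (1 + (2 * expR (5 / 2) + 4 + lindeberg_const C1) * r).
  apply: (@le_trans _ _ (fine P * Phi r^-1)); first by rewrite ler_wpM2l.
  by apply: (le_trans hP); move: err main; lra.
set k := 2 * expR (5 / 2) + 4 + lindeberg_const C1 in hP1.
have k0 : 0 <= k by have l0 := lindeberg_const_ge0 C10; rewrite /k; nonneg.
have -> : tail_const C1 = 2 * k + 2 by [].
(* Division by [Phi r^-1 >= 1 - r] becomes multiplication by [1 + 2 * r], whence the shape
   [2 * k + 2] of [tail_const]. *)
have e1 : 1 <= (1 - r) * (1 + 2 * r) by nra.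
have e2 : (1 + k * r) * (1 + 2 * r) <= 1 + (2 * k + 2) * r.
  have : 0 <= k * r * (1 - 2 * r) by apply: mulr_ge0; [nonneg|lra].
  lra.
have : fine P * 1 <= fine P * ((1 - r) * (1 + 2 * r)) by rewrite ler_wpM2l.
have : fine P * (1 - r) * (1 + 2 * r) <= tl * (1 + k * r) * (1 + 2 * r).
  by rewrite ler_wpM2r//; lra.
have : tl * ((1 + k * r) * (1 + 2 * r)) <= tl * (1 + (2 * k + 2) * r).
  by rewrite ler_wpM2l// ltW.
lra.
Qed.

End Tail.

(** * A good event *)

Section UnionBound.
Context (R : realType) (d : measure_display) (Omega : measurableType d)
  (Pr : probability Omega R).

Lemma union_bound (I : finType) (J : pred I) (E : I -> set Omega) (c : R) :
  (forall j, measurable (E j)) -> (forall j, J j -> (Pr (E j) <= c%:E)%E) ->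
  measurable (\bigcup_(j in [set` J]) E j) /\
  (Pr (\bigcup_(j in [set` J]) E j) <= (#|J|%:R * c)%:E)%E.
Proof.
move=> mE Ec; rewrite bigcup_pred.
have -> : (#|J|%:R * c)%:E = (\sum_(j | J j) c%:E)%E.
  by rewrite sumEFin sumr_const mulr_natl.
apply: (@big_rec2 _ _ (fun U x => measurable U /\ (Pr U <= x)%E)).
  by split; [exact: measurable0|rewrite measure0].
move=> j x U Jj [mU Ux]; split; first exact: measurableU.
exact: (le_trans (measureU2 _ (mE j) mU)) (leeD (Ec j Jj) Ux).
Qed.

End UnionBound.

Lemma sighat_sqr (R : realType) (n : nat) (d : measure_display)
    (S : measurableType d) (x : 'I_n -> S) (f : S -> R) : (0 < n)%N ->
  n%:R^-1 * (\sum_(i < n) (f (x i) - mbar x f) ^+ 2) =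
  n%:R^-1 * (\sum_(i < n) f (x i) ^+ 2) - mbar x f ^+ 2.
Proof.
move=> n0; have nn0 : n%:R != 0 :> R by rewrite pnatr_eq0 -lt0n.
set m := mbar x f.
have mE : \sum_(i < n) f (x i) = n%:R * m by rewrite /m /mbar mulrA divff// mul1r.
have -> : \sum_(i < n) (f (x i) - m) ^+ 2 =
    \sum_(i < n) f (x i) ^+ 2 - 2 * m * \sum_(i < n) f (x i) + n%:R * m ^+ 2.
  rewrite mulr_sumr -sumrB; have -> : n%:R * m ^+ 2 = \sum_(i < n) m ^+ 2.
    by rewrite sumr_const card_ord mulr_natl.
  by rewrite -big_split/=; apply: eq_bigr => i _; ring.
by rewrite mE; field.
Qed.

Section ExpBounds.
Variable R : realType.
Implicit Types u : R.

Lemma expRN_le u : 0 <= u -> expR (- u) <= 1 - u + u ^+ 2.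
Proof.
move=> u0; rewrite expRN -[leLHS]mul1r ler_pdivrMr ?expR_gt0//.
have h : 1 + u <= expR u by exact: expR_ge1Dx.
have p0 : 0 <= 1 - u + u ^+ 2 by have := sqr_ge0 (u - 1 / 2); lra.
have : (1 - u + u ^+ 2) * (1 + u) <= (1 - u + u ^+ 2) * expR u by rewrite ler_wpM2l.
have : 0 <= u ^+ 3 by nonneg.
lra.
Qed.

Lemma expR_le_quad u : 0 <= u <= 1 -> expR u <= 1 + u + (1 + expR 1) * u ^+ 2.
Proof.
move=> /andP[u0 u1]; have u1' : `|u| <= 1 by rewrite ger0_norm.
have := expR_taylor u1'; rewrite ger0_norm//.
have : u ^+ 3 * expR 1 <= u ^+ 2 * expR 1.
  by rewrite ler_wpM2r ?expR_ge0// ler_wiXn2l.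
have := sqr_ge0 u; lra.
Qed.

End ExpBounds.

Lemma sqr_moment_le (R : realType) (A L N C1 r : R) :
  0 < A -> 0 < N -> 0 < C1 -> 0 < r -> A * L ^+ 2 <= C1 * N * r ^+ 16 ->
  (A * L ^+ 2 / N) ^+ 2 <= C1 ^+ 2 * r ^+ 32.
Proof.
move=> A0 N0 C10 r0 ALN.
have -> : C1 ^+ 2 * r ^+ 32 = (C1 * r ^+ 16) ^+ 2 by ring.
have L2 : 0 <= L ^+ 2 by exact: sqr_ge0.
rewrite lerXn2r ?nnegrE//; last by rewrite ler_pdivrMr//; lra.
  by rewrite divr_ge0 ?(ltW N0)// mulr_ge0 ?(ltW A0).
nonneg.
Qed.

Section CoordinateEvents.
Context (R : realType) (d1 d2 : measure_display) (Omega : measurableType d1)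
  (Pr : probability Omega R) (S : measurableType d2) (mu : probability S R).
Variables (n : nat) (W : 'I_n -> Omega -> S).
Hypothesis n0 : (0 < n)%N.
Hypothesis mW : forall i, measurable_fun setT (W i).
Hypothesis lawW : forall i (A : set S), measurable A -> Pr (W i @^-1` A) = mu A.
Hypothesis indepW : forall A : 'I_n -> set S, (forall i, measurable (A i)) ->
  Pr (\bigcap_i (W i @^-1` A i)) = (\big[*%E/1%E]_(i < n) Pr (W i @^-1` A i))%E.
Variables (Z : S -> R) (A : R).
Hypothesis mZ : measurable_fun setT Z.
Hypothesis iZ : mu.-integrable setT (EFin \o Z).
Hypothesis EZ : (\int[mu]_s (Z s)%:E = 0)%E.
Hypothesis iZ2 : mu.-integrable setT (fun s => (Z s ^+ 2)%:E).
Hypothesis EZ2 : (\int[mu]_s (Z s ^+ 2)%:E = 1)%E.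
Hypothesis EZ4 : (\int[mu]_s (Z s ^+ 4)%:E <= (A ^+ 2)%:E)%E.
Hypothesis A1 : 1 <= A.
Local Notation N := (Num.sqrt n%:R : R).
Variables (C1 r L : R).
Hypotheses (C10 : 0 < C1) (r0 : 0 < r) (r4 : r <= 1 / 4) (L1 : 1 <= L).
Hypothesis ALN : A * L ^+ 2 <= C1 * N * r ^+ 16.
Local Notation t := (trunc_level r L N).

Let N0 : 0 < N. Proof. by rewrite sqrtr_gt0 ltr0n. Qed.
Let N2 : N ^+ 2 = n%:R. Proof. by rewrite sqr_sqrtr ?ler0n. Qed.
Let nN2 u : n%:R * u = N ^+ 2 * u. Proof. by rewrite N2. Qed.
Let L0 : 0 < L. Proof. exact: lt_le_trans L1. Qed.
Let A0 : 0 < A. Proof. exact: lt_le_trans A1. Qed.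
Let r1 : r <= 1. Proof. move: r4; lra. Qed.
Let t0 : 0 < t. Proof. exact: trunc_level_gt0. Qed.

(** Chernoff parameter for sums of squares: [lam * t ^+ 2 = r ^+ 4] keeps the exponent bounded,
    while the gain [N ^+ 2 * lam * (r / (4 * L)) = L * r ^- 3 / 4] far exceeds [L]. *)
Let lam := L ^+ 2 / (N ^+ 2 * r ^+ 4).
Let lam0 : 0 < lam. Proof. by rewrite divr_gt0 ?mulr_gt0 ?exprn_gt0. Qed.

Let sqr_AL : (A * L ^+ 2 / N) ^+ 2 <= C1 ^+ 2 * r ^+ 32.
Proof. exact: sqr_moment_le. Qed.

Let lamA : N ^+ 2 * (lam ^+ 2 * A ^+ 2) <= C1 ^+ 2.
Proof.
have -> : N ^+ 2 * (lam ^+ 2 * A ^+ 2) = (A * L ^+ 2 / N) ^+ 2 / r ^+ 8.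
  by rewrite /lam; field; rewrite ?gt_eqF.
rewrite ler_pdivrMr ?exprn_gt0//; apply: (le_trans sqr_AL).
by rewrite ler_wpM2l ?exprn_ge0 ?(ltW C10)// ler_wiXn2l// ltW.
Qed.

Definition tiny : R := expR (- L) * r.

(* [expR (-L) <= 1/p] pays for the union over the p coordinates. *)
Let tinyE c : 0 <= c -> expR (- (L * (r ^- 3 / 4)) + c) <= expR c * tiny.
Proof.
move=> c0; rewrite expRD mulrC ler_wpM2l ?expR_ge0//.
have rV4 : 4 <= r^-1 by rewrite -[4]invrK lef_pV2 ?posrE//; move: r4; lra.
have h1 : 1 + r^-1 <= r ^- 3 / 4.
  have -> : r ^- 3 = r^-1 * (r^-1 * r^-1) by field; rewrite gt_eqF.
  have : 16 <= r^-1 * r^-1 by nra.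
  nra.
have h2 : L + r^-1 <= L * (r ^- 3 / 4).
  apply: (@le_trans _ _ (L * (1 + r^-1))); last by rewrite ler_wpM2l// ltW.
  rewrite mulrDr mulr1 lerD2l ler_peMl// invr_ge0 ltW//.
apply: (@le_trans _ _ (expR (- (L + r^-1)))); first by rewrite ler_expR lerN2.
rewrite opprD expRD /tiny ler_wpM2l ?expR_ge0// expRN invf_ple ?posrE ?expR_gt0//.
by apply: le_trans (expR_ge1Dx _); rewrite lerDr.
Qed.

Definition sqr_const : R := expR ((1 + expR 1) * C1 ^+ 2).

Let mY : measurable_fun setT (trunc Z t). Proof. exact: measurable_trunc. Qed.

(** Serves both tails, with [e = 1] and [e = - 1]. The quadratic term contributes at most the
    constant in [sqr_const], by [lamA]. *)
Let chernoff_sqr (g : S -> R) (e x : R) : measurable_fun setT g ->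
  (forall s, expR (g s) <= 1 + e * lam * Z s ^+ 2 + (1 + expR 1) * lam ^+ 2 * Z s ^+ 4) ->
  x = e * lam + lam * (r / (4 * L)) -> 0 <= 1 + e * lam + (1 + expR 1) * lam ^+ 2 * A ^+ 2 ->
  (Pr [set w | (N ^+ 2 * x <= \sum_(i < n) g (W i w))%R] <= (sqr_const * tiny)%:E)%E.
Proof.
move=> mg hg xE q0.
have := chernoff_iid mW lawW indepW mg (N ^+ 2 * x) q0.
have hq : (\int[mu]_s (expR (g s))%:E <=
    (1 + e * lam + (1 + expR 1) * lam ^+ 2 * A ^+ 2)%:E)%E.
  apply: (@integral_le_poly _ _ _ mu Z A mZ iZ EZ iZ2 EZ2 EZ4 _ _ 0) => //.
  - exact: measurableT_comp.
  - by rewrite mulr_ge0 ?exprn_ge0 ?(ltW lam0)// addr_ge0 ?expR_ge0.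
  - by move=> s; rewrite mul0r addr0.
move=> /(_ hq)/le_trans; apply; rewrite lee_fin.
apply: (@le_trans _ _ (expR (- (N ^+ 2 * x)) *
   expR (n%:R * (e * lam + (1 + expR 1) * lam ^+ 2 * A ^+ 2)))).
  rewrite ler_wpM2l ?expR_ge0// expRM_natl lerXn2r ?nnegrE ?expR_ge0//.
  by rewrite -addrA expR_ge1Dx.
rewrite -expRD nN2 xE.
have -> : - (N ^+ 2 * (e * lam + lam * (r / (4 * L)))) +
  N ^+ 2 * (e * lam + (1 + expR 1) * lam ^+ 2 * A ^+ 2) =
  - (N ^+ 2 * lam * (r / (4 * L))) + (1 + expR 1) * (N ^+ 2 * (lam ^+ 2 * A ^+ 2)).
  by ring.
have -> : N ^+ 2 * lam * (r / (4 * L)) = L * (r ^- 3 / 4).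
  by rewrite /lam; field; rewrite ?gt_eqF.
apply: (@le_trans _ _ (expR (- (L * (r ^- 3 / 4)) + (1 + expR 1) * C1 ^+ 2))).
  by rewrite ler_expR lerD2l ler_wpM2l// addr_ge0// expR_ge0.
by apply: tinyE; nonneg.
Qed.

Lemma sqr_upper_tail :
  (Pr [set w | (N ^+ 2 * (1 + r / (4 * L)) <= \sum_(i < n) trunc Z t (W i w) ^+ 2)%R] <=
   (sqr_const * tiny)%:E)%E.
Proof.
have mg : measurable_fun setT (fun s => lam * trunc Z t s ^+ 2).
  by apply: measurable_funM => //; exact: measurable_funX.
have := @chernoff_sqr _ 1 (lam * (1 + r / (4 * L))) mg.
have -> : [set w | N ^+ 2 * (lam * (1 + r / (4 * L))) <=
      \sum_(i < n) lam * trunc Z t (W i w) ^+ 2] =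
    [set w | N ^+ 2 * (1 + r / (4 * L)) <= \sum_(i < n) trunc Z t (W i w) ^+ 2].
  by apply/seteqP; split => w /=; rewrite -mulr_sumr mulrCA ler_pM2l.
apply; [|by ring|].
- move=> s; set y2 := trunc Z t s ^+ 2.
  have y20 : 0 <= y2 by exact: sqr_ge0.
  have yt : y2 <= t ^+ 2.
    have := trunc_le Z s (ltW t0); rewrite -ler_sqr ?nnegrE// ?(ltW t0)//.
    by rewrite -normrX ger0_norm// sqr_ge0.
  have lt : lam * t ^+ 2 <= 1.
    have -> : lam * t ^+ 2 = r ^+ 4.
      by rewrite /lam /trunc_level; field; rewrite ?gt_eqF.
    by rewrite exprn_ile1// ltW.
  have ly : 0 <= lam * y2 <= 1.
    rewrite mulr_ge0 ?(ltW lam0)//=; apply: le_trans lt.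
    by rewrite ler_wpM2l// ltW.
  apply: (le_trans (expR_le_quad ly)); rewrite mul1r.
  have : lam * y2 <= lam * Z s ^+ 2.
    by rewrite ler_wpM2l ?(ltW lam0)//; exact: trunc_sqr_le.
  have : (1 + expR 1) * (lam * y2) ^+ 2 <= (1 + expR 1) * lam ^+ 2 * Z s ^+ 4.
    rewrite exprMn mulrA ler_wpM2l//.
      by rewrite mulr_ge0 ?sqr_ge0// addr_ge0 ?expR_ge0.
    by rewrite -exprM; exact: trunc_pow4_le.
  lra.
- by have l0 := ltW lam0; nonneg.
Qed.

(** Stated for [Z] itself: squares are nonnegative, so their Laplace transform at [- lam] is
    controlled by [exp(- u) <= 1 - u + u^2] and the fourth moment. *)
Lemma sqr_lower_tail :
  (Pr [set w | (\sum_(i < n) Z (W i w) ^+ 2 <= N ^+ 2 * (1 - r / (4 * L)))%R] <=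
   (sqr_const * tiny)%:E)%E.
Proof.
have mg : measurable_fun setT (fun s => - lam * Z s ^+ 2).
  by apply: measurable_funM => //; exact: measurable_funX.
have := @chernoff_sqr _ (- 1) (- lam * (1 - r / (4 * L))) mg.
have -> : [set w | N ^+ 2 * (- lam * (1 - r / (4 * L))) <=
      \sum_(i < n) - lam * Z (W i w) ^+ 2] =
    [set w | \sum_(i < n) Z (W i w) ^+ 2 <= N ^+ 2 * (1 - r / (4 * L))].
  by apply/seteqP; split => w /=; rewrite -mulr_sumr mulrCA !mulNr lerN2 ler_pM2l.
apply; [|by ring|].
- move=> s; have u0 : 0 <= lam * Z s ^+ 2 by rewrite mulr_ge0 ?sqr_ge0// ltW.
  have := expRN_le u0; rewrite mulNr mulN1r => /le_trans; apply.
  have : 0 <= (expR 1 : R) * (lam * Z s ^+ 2) ^+ 2 by nonneg.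
  lra.
- have : expR (- lam) <= 1 - lam + lam ^+ 2 by apply: expRN_le; exact: ltW.
  have := expR_ge0 (- lam).
  have e1 := expR_ge0 (1 : R).
  have : lam ^+ 2 * 1 <= lam ^+ 2 * A ^+ 2.
    by rewrite ler_wpM2l ?sqr_ge0// expr_ge1// ltW.
  have : 0 <= (expR 1 : R) * (lam ^+ 2 * A ^+ 2) by nonneg.
  lra.
Qed.

Definition sum_const : R := expR (mgf_bound C1).

(** A deliberately crude level: the bound only has to make the squared sample mean negligible in the
    empirical variance. The tilt is [sqrt L]. *)
Lemma sum_upper_tail :
  (Pr [set w | (4 * Num.sqrt L / r <= \sum_(i < n) trunc Z t (W i w) / N)%R] <=
   (sum_const * tiny)%:E)%E.
Proof.
pose b := Num.sqrt L.
have b0 : 0 <= b by exact: sqrtr_ge0.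
have bb : b ^+ 2 = L by rewrite sqr_sqrtr// ltW.
have bL : b ^+ 2 <= 2 * L by rewrite bb; move: L0; lra.
have b00 : 0 < b by rewrite sqrtr_gt0.
have btD := tilt_trunc_level_le r0 r1 L1 N0 b0 bL.
have h := mgf_trunc mZ iZ EZ iZ2 EZ2 EZ4 A0 N0 t0 b0 btD.
have mg : measurable_fun setT (fun s => b * (trunc Z t s / N)).
  by apply: measurable_funM => //; exact: measurable_funM.
have := chernoff_iid mW lawW indepW mg (b * (4 * b / r)) (expR_ge0 _) h.
have -> : [set w | b * (4 * b / r) <= \sum_(i < n) b * (trunc Z t (W i w) / N)] =
    [set w | 4 * Num.sqrt L / r <= \sum_(i < n) trunc Z t (W i w) / N].
  by apply/seteqP; split => w /=; rewrite -mulr_sumr ler_pM2l.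
move/le_trans; apply; rewrite lee_fin -expRM_natl -expRD nN2.
have mr := mgf_rate_le C10 r0 r1 L1 A1 N0 ALN b0 bL.
set rho := mgf_rate _ _ _ _ _ in mr *.
have -> : N ^+ 2 * ((b ^+ 2 / 2 + rho) / N ^+ 2) = L / 2 + rho.
  by rewrite bb; field; rewrite gt_eqF.
have -> : b * (4 * b / r) = 4 * L / r by rewrite -bb; field; rewrite gt_eqF.
rewrite /sum_const /tiny.
have rV4 : 4 <= r^-1 by rewrite -[4]invrK lef_pV2 ?posrE//; move: r4; lra.
have h1 : 2 * L + r^-1 <= 4 * L / r.
  have : r^-1 <= L * r^-1 by rewrite ler_peMl// invr_ge0 ltW.
  have : L * 4 <= L * r^-1 by rewrite ler_wpM2l// ltW.
  by move: L0; lra.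
apply: (@le_trans _ _ (expR (mgf_bound C1 + (- L + - r^-1)))).
  by rewrite ler_expR; move: L0; lra.
rewrite !expRD ler_wpM2l ?expR_ge0// ler_wpM2l ?expR_ge0// expRN invf_ple ?posrE ?expR_gt0//.
by apply: le_trans (expR_ge1Dx _); rewrite lerDr.
Qed.

End CoordinateEvents.

Section Standardized.
Context (R : realType) (d2 : measure_display) (S : measurableType d2)
  (mu : probability S R).

Definition standardized (Z : S -> R) (A : R) : Prop :=
  [/\ measurable_fun setT Z, mu.-integrable setT (EFin \o Z),
      (\int[mu]_s (Z s)%:E = 0)%E &
   [/\ mu.-integrable setT (fun s => (Z s ^+ 2)%:E),
      (\int[mu]_s (Z s ^+ 2)%:E = 1)%E &
      (\int[mu]_s (Z s ^+ 4)%:E <= (A ^+ 2)%:E)%E]].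

Lemma standardizedN Z A : standardized Z A -> standardized (fun s => - Z s) A.
Proof.
move=> [mZ iZ EZ [iZ2 EZ2 EZ4]].
have e2 : (fun s => ((- Z s) ^+ 2)%:E) = (fun s => (Z s ^+ 2)%:E).
  by apply/funext => s; rewrite sqrrN.
have e4 : (fun s => ((- Z s) ^+ 4)%:E) = (fun s => (Z s ^+ 4)%:E).
  by apply/funext => s; rewrite exprNn; congr (_%:E); ring.
split; last by rewrite e2 e4.
- exact: measurableT_comp.
- have := integrableN iZ.
  by congr integrable; apply/funext => s /=; rewrite EFinN.
- under eq_integral do rewrite EFinN.
  by rewrite integralN/= ?EZ ?oppe0//; exact: integrable_add_def.
Qed.

Lemma truncN (Z : S -> R) t s : trunc (fun s => - Z s) t s = - trunc Z t s.
Proof. by rewrite /trunc normrN; case: ifP; rewrite ?oppr0. Qed.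

End Standardized.

Lemma measurable_bigmaxr_pow4 (R : realType) (d : measure_display)
    (S : measurableType d) (p : nat) (Z : 'I_p -> S -> R) :
  (forall j, measurable_fun setT (Z j)) ->
  measurable_fun setT (fun s => \big[Num.max/0]_(j < p) `|Z j s| ^+ 4).
Proof.
move=> mZ; elim: (index_enum _) => [|j s IH].
  by under eq_fun do rewrite big_nil; exact: measurable_cst.
under eq_fun do rewrite big_cons; apply: measurable_maxr => //.
by apply: measurable_funX; apply: measurableT_comp.
Qed.

Section Iid.
Context (R : realType) (d1 d2 : measure_display) (Omega : measurableType d1)
  (Pr : probability Omega R) (S : measurableType d2) (mu : probability S R).

Definition iid n (W : 'I_n -> Omega -> S) : Prop :=
  [/\ forall i, measurable_fun setT (W i),
      forall i (A : set S), measurable A -> Pr (W i @^-1` A) = mu A &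
      forall A : 'I_n -> set S, (forall i, measurable (A i)) ->
        Pr (\bigcap_i (W i @^-1` A i)) = (\big[*%E/1%E]_(i < n) Pr (W i @^-1` A i))%E].

Variables (n p : nat) (W : 'I_n -> Omega -> S) (Z : 'I_p -> S -> R) (A : R).
Hypotheses (n0 : (0 < n)%N) (iidW : iid W).
Hypothesis stdZ : forall j, standardized mu (Z j) A.
Hypothesis EmaxZ4 :
  (\int[mu]_s (\big[Num.max/0]_(j < p) `|Z j s| ^+ 4)%:E <= (A ^+ 2)%:E)%E.
Hypothesis A1 : 1 <= A.
Local Notation N := (Num.sqrt n%:R : R).
Variables (C1 r L : R).
Hypotheses (C10 : 0 < C1) (r0 : 0 < r) (r4 : r <= 1 / 4) (L1 : 1 <= L).
Hypothesis rC : 64 * C1 ^+ 2 * r <= 1.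
Hypothesis ALN : A * L ^+ 2 <= C1 * N * r ^+ 16.
Hypothesis pL : p%:R * expR (- L) <= 1.
Local Notation t := (trunc_level r L N).

Let N0 : 0 < N. Proof. by rewrite sqrtr_gt0 ltr0n. Qed.
Let N2 : N ^+ 2 = n%:R. Proof. by rewrite sqr_sqrtr ?ler0n. Qed.
Let L0 : 0 < L. Proof. exact: lt_le_trans L1. Qed.
Let A0 : 0 < A. Proof. exact: lt_le_trans A1. Qed.
Let r1 : r <= 1. Proof. move: r4; lra. Qed.
Let t0 : 0 < t. Proof. exact: trunc_level_gt0. Qed.

Let maxZ4 s := \big[Num.max/0]_(j < p) `|Z j s| ^+ 4.

Let mmaxZ4 : measurable_fun setT maxZ4.
Proof. by apply: measurable_bigmaxr_pow4 => j; have [] := stdZ j. Qed.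

Let sqr_AL : (A * L ^+ 2 / N) ^+ 2 <= C1 ^+ 2 * r ^+ 32.
Proof. exact: sqr_moment_le. Qed.

Let large := [set s | t ^+ 4 <= maxZ4 s].

Let mlarge : measurable large.
Proof.
rewrite -[X in measurable X]setTI.
have := mmaxZ4 measurableT (measurable_itv `[t ^+ 4, +oo[).
by congr measurable; apply/seteqP; split=> w /=; rewrite in_itv/= andbT.
Qed.

(** The maximum over the moments stands inside the expectation, so Markov's inequality and a union
    over the sample involve no factor [p]. *)
Let Pr_large : measurable (\bigcup_(i in [set` predT]) (W i @^-1` large)) /\
  (Pr (\bigcup_(i in [set` predT]) (W i @^-1` large)) <= (C1 ^+ 2 * r)%:E)%E.
Proof.
have [mW lawW _] := iidW.
have t40 : 0 < t ^+ 4 by rewrite exprn_gt0.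
have hl i : (Pr (W i @^-1` large) <= (A ^+ 2 / t ^+ 4)%:E)%E.
  rewrite lawW// EFinM lee_pdivlMr// muleC.
  apply: (le_trans _ EmaxZ4); apply: markov_nonneg => //.
  - exact: ltW.
  - by move=> s; rewrite /maxZ4; elim/big_ind: _ => // x y x0 y0; rewrite le_max x0.
have [||mU] := @union_bound _ _ _ Pr _ (@predT 'I_n) (fun i => W i @^-1` large) (A ^+ 2 / t ^+ 4).
- by move=> i; rewrite -[X in measurable X]setTI; exact: mW.
- by move=> i _; exact: hl.
move=> h; split; first exact: mU.
apply: (le_trans h); rewrite lee_fin card_ord.
have -> : n%:R * (A ^+ 2 / t ^+ 4) = (A * L ^+ 2 / N) ^+ 2 / r ^+ 16.
  transitivity (N ^+ 2 * (A ^+ 2 / t ^+ 4)); first by rewrite N2.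
  by rewrite /trunc_level; field; rewrite ?gt_eqF.
rewrite ler_pdivrMr ?exprn_gt0//; apply: (le_trans sqr_AL).
have -> : C1 ^+ 2 * r * r ^+ 16 = C1 ^+ 2 * r ^+ 17 by ring.
by rewrite ler_wpM2l ?exprn_ge0 ?(ltW C10)// ler_wiXn2l// ltW.
Qed.

Definition good_const : R := C1 ^+ 2 + 2 * sqr_const C1 + 2 * sum_const C1.

Let bad j : set Omega :=
  ([set w | (N ^+ 2 * (1 + r / (4 * L)) <= \sum_(i < n) trunc (Z j) t (W i w) ^+ 2)%R] `|`
   [set w | (\sum_(i < n) Z j (W i w) ^+ 2 <= N ^+ 2 * (1 - r / (4 * L)))%R]) `|`
  ([set w | (4 * Num.sqrt L / r <= \sum_(i < n) trunc (Z j) t (W i w) / N)%R] `|`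
   [set w | (4 * Num.sqrt L / r <=
     \sum_(i < n) trunc (fun s => - Z j s) t (W i w) / N)%R]).

Let Pr_bad j : measurable (bad j) /\
  (Pr (bad j) <= ((2 * sqr_const C1 + 2 * sum_const C1) * tiny r L)%:E)%E.
Proof.
have [mW lawW indepW] := iidW.
have [mZ iZ EZ [iZ2 EZ2 EZ4]] := stdZ j.
have [mZ' iZ' EZ' [iZ2' EZ2' EZ4']] := standardizedN (stdZ j).
have m1 : measurable [set w | (N ^+ 2 * (1 + r / (4 * L)) <= \sum_(i < n) trunc (Z j) t (W i w) ^+ 2)%R].
  apply: (measurable_sumW_ge mW (g := fun s => trunc (Z j) t s ^+ 2)).
  by apply: measurable_funX; exact: measurable_trunc.
have m2 : measurable [set w | (\sum_(i < n) Z j (W i w) ^+ 2 <= N ^+ 2 * (1 - r / (4 * L)))%R].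
  have mg : measurable_fun setT (fun s => - Z j s ^+ 2).
    by apply: measurableT_comp => //; exact: measurable_funX.
  have := measurable_sumW_ge mW mg (- (N ^+ 2 * (1 - r / (4 * L)))).
  by congr measurable; apply/seteqP; split => w /=; rewrite sumrN lerN2.
have m3 : measurable [set w | (4 * Num.sqrt L / r <= \sum_(i < n) trunc (Z j) t (W i w) / N)%R].
  apply: (measurable_sumW_ge mW (g := fun s => trunc (Z j) t s / N)).
  by apply: measurable_funM => //; exact: measurable_trunc.
have m4 : measurable [set w | (4 * Num.sqrt L / r <=
     \sum_(i < n) trunc (fun s => - Z j s) t (W i w) / N)%R].
  apply: (measurable_sumW_ge mW (g := fun s => trunc (fun s => - Z j s) t s / N)).
  by apply: measurable_funM => //; exact: measurable_trunc.
split; first by apply: measurableU; exact: measurableU.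
have u1 := sqr_upper_tail n0 mW lawW indepW mZ iZ EZ iZ2 EZ2 EZ4 A1 C10 r0 r4 L1 ALN.
have u2 := sqr_lower_tail n0 mW lawW indepW mZ iZ EZ iZ2 EZ2 EZ4 A1 C10 r0 r4 L1 ALN.
have u3 := sum_upper_tail n0 mW lawW indepW mZ iZ EZ iZ2 EZ2 EZ4 A1 C10 r0 r4 L1 ALN.
have u4 := sum_upper_tail n0 mW lawW indepW mZ' iZ' EZ' iZ2' EZ2' EZ4' A1 C10 r0 r4 L1 ALN.
rewrite (_ : (2 * _ + 2 * _) * _ = (sqr_const C1 * tiny r L + sqr_const C1 * tiny r L) +
  (sum_const C1 * tiny r L + sum_const C1 * tiny r L)); last by ring.
rewrite !EFinD.
apply: (le_trans (measureU2 _ _ _)); [exact: measurableU|exact: measurableU|].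
by apply: leeD; apply: (le_trans (measureU2 _ _ _)) => //; apply: leeD.
Qed.

(** Two unions: over the sample for the truncation, and over the coordinates for four exponential
    tails, whose factor [expR (- L)] offsets [p]. *)
Lemma good_event : exists Bad : set Omega,
  [/\ measurable Bad, (Pr Bad <= (good_const * r)%:E)%E &
   forall w, ~ Bad w -> forall j,
    (forall i, trunc (Z j) t (W i w) = Z j (W i w)) /\
    `|sighat (fun i => W i w) (Z j) - 1| <= r / (2 * L)].
Proof.
have [mT PT] := Pr_large.
have [||mB PB] := @union_bound _ _ _ Pr _ (@predT 'I_p) bad
    ((2 * sqr_const C1 + 2 * sum_const C1) * tiny r L).
- by move=> j; have [] := Pr_bad j.
- by move=> j _; have [] := Pr_bad j.
exists ((\bigcup_(i in [set` predT]) (W i @^-1` large)) `|`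
  \bigcup_(j in [set` predT]) bad j); split.
- exact: measurableU.
- apply: (le_trans (measureU2 _ mT mB)).
  rewrite /good_const -addrA mulrDl EFinD; apply: leeD; first exact: PT.
  apply: (le_trans PB); rewrite lee_fin card_ord /tiny.
  set c := _ + _; have c0 : 0 <= c by rewrite /c /sqr_const /sum_const; nonneg.
  have -> : p%:R * (c * (expR (- L) * r)) = (p%:R * expR (- L)) * (c * r) by ring.
  by rewrite ler_piMl// mulr_ge0// ltW.
move=> w /not_orP[nT nB] j.
have tr i : trunc (Z j) t (W i w) = Z j (W i w).
  rewrite /trunc; case: ifPn => // /negP tZ; exfalso; apply: nT.
  exists i => //=; rewrite /large/= /maxZ4.
  apply: (@le_trans _ _ (`|Z j (W i w)| ^+ 4)); last first.
    by apply: (le_bigmax _ (fun j => `|Z j (W i w)| ^+ 4)).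
  rewrite lerXn2r ?nnegrE ?(ltW t0)//.
  by move/negP: tZ; rewrite -ltNge => /ltW.
split; first exact: tr.
have nb : ~ bad j w by move=> b; apply: nB; exists j.
move/not_orP: nb => [/not_orP[/negP b1 /negP b2] /not_orP[/negP b3 /negP b4]].
move: b1 b2 b3 b4; rewrite -!ltNge.
have -> : \sum_(i < n) trunc (Z j) t (W i w) ^+ 2 = \sum_(i < n) Z j (W i w) ^+ 2.
  by apply: eq_bigr => i _; rewrite tr.
have -> : \sum_(i < n) trunc (fun s => - Z j s) t (W i w) / N =
    - (\sum_(i < n) Z j (W i w) / N).
  by rewrite -sumrN; apply: eq_bigr => i _; rewrite truncN tr mulNr.
have -> : \sum_(i < n) trunc (Z j) t (W i w) / N = \sum_(i < n) Z j (W i w) / N.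
  by apply: eq_bigr => i _; rewrite tr.
move=> b1 b2 b3 b4.
set x := fun i => W i w; set T := \sum_(i < n) Z j (W i w) / N in b3 b4.
have mT' : mbar x (Z j) = T / N.
  transitivity ((N ^+ 2)^-1 * \sum_(i < n) Z j (x i)); first by rewrite N2.
  by rewrite /T -mulr_suml; field; rewrite gt_eqF.
have s2 := sighat_sqr x (Z j) n0.
have nn : 0 < n%:R :> R by rewrite ltr0n.
have sg0 : 0 <= sighat x (Z j) by exact: sqrtr_ge0.
have sgE : sighat x (Z j) ^+ 2 = n%:R^-1 * (\sum_(i < n) Z j (x i) ^+ 2) - (T / N) ^+ 2.
  rewrite /sighat sqr_sqrtr ?s2 ?mT'// -mT' -s2 mulr_ge0 ?invr_ge0 ?ler0n//.
  by apply: sumr_ge0 => i _; exact: sqr_ge0.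
pose dl := r / (4 * L).
have V1 : n%:R^-1 * (\sum_(i < n) Z j (x i) ^+ 2) <= 1 + dl.
  by rewrite mulrC ler_pdivrMr// -[X in _ <= _ * X]N2 mulrC ltW.
have V2 : 1 - dl <= n%:R^-1 * (\sum_(i < n) Z j (x i) ^+ 2).
  by rewrite mulrC ler_pdivlMr// -[X in _ * X <= _]N2 mulrC ltW.
(* The squared mean is at most [16 * L / (r * N) ^+ 2]; the moment condition makes it small compared
   with [r / L], and [rC] absorbs the constant 64. *)
have T2 : (T / N) ^+ 2 <= dl.
  have aT : `|T| <= 4 * Num.sqrt L / r.
    by rewrite ler_norml; apply/andP; split; apply: ltW; rewrite ?b3//; move: b4; lra.
  have T16 : T ^+ 2 <= 16 * L / r ^+ 2.
    have -> : T ^+ 2 = `|T| ^+ 2 by rewrite -normrX ger0_norm// sqr_ge0.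
    have -> : 16 * L / r ^+ 2 = (4 * Num.sqrt L / r) ^+ 2.
      rewrite -[in LHS](@sqr_sqrtr _ L) ?(ltW L0)//; field; by rewrite gt_eqF.
    by rewrite lerXn2r ?nnegrE//; nonneg.
  have LN : L ^+ 2 / N ^+ 2 <= C1 ^+ 2 * r ^+ 32.
    apply: le_trans sqr_AL.
    have -> : (A * L ^+ 2 / N) ^+ 2 = (A ^+ 2 * L ^+ 2) * (L ^+ 2 / N ^+ 2).
      by field; rewrite gt_eqF.
    rewrite ler_peMl//; first by nonneg.
    by rewrite -exprMn expr_ge1 ?mulr_ege1// mulr_ge0// ltW.
  have -> : (T / N) ^+ 2 = T ^+ 2 / N ^+ 2 by rewrite expr_div_n.
  apply: (@le_trans _ _ (16 * L / r ^+ 2 / N ^+ 2)).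
    by rewrite ler_wpM2r// invr_ge0 exprn_ge0// ltW.
  have -> : 16 * L / r ^+ 2 / N ^+ 2 = 64 * (L ^+ 2 / N ^+ 2) / (r ^+ 3) * dl.
    by rewrite /dl; field; rewrite ?gt_eqF.
  rewrite ler_piMl//; first by rewrite /dl; nonneg.
  rewrite ler_pdivrMr ?exprn_gt0// mul1r.
  apply: (@le_trans _ _ (64 * (C1 ^+ 2 * r ^+ 32))); first by rewrite ler_wpM2l.
  have -> : 64 * (C1 ^+ 2 * r ^+ 32) = (64 * C1 ^+ 2 * r) * r ^+ 31 by ring.
  apply: (@le_trans _ _ (r ^+ 31)); last by rewrite ler_wiXn2l// ltW.
  by rewrite ler_piMl// exprn_ge0// ltW.
(* One [dl] is for the second moment, the other for the squared mean; factoring [s^2 - 1] then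
   passes from [s^2] to [s]. *)
have -> : r / (2 * L) = dl + dl by rewrite /dl; field; rewrite gt_eqF.
have sq : `|sighat x (Z j) ^+ 2 - 1| <= dl + dl.
  rewrite sgE ler_norml; have := sqr_ge0 (T / N); lra.
apply: le_trans sq.
have -> : sighat x (Z j) ^+ 2 - 1 = (sighat x (Z j) - 1) * (sighat x (Z j) + 1) by ring.
by rewrite normrM ler_peMr// ger0_norm ?lerDr// addr_ge0.
Qed.

End Iid.

(** * Critical values and the rejection event *)

Section CriticalValue.
Variable R : realType.
Implicit Types z u : R.

Let sqrt_le1 u : 0 <= u -> Num.sqrt (1 - u) <= 1.
Proof. by move=> u0; rewrite -[leRHS]sqrtr1 ler_wsqrtr// gerBl. Qed.

Lemma studentized_ge z u : 0 <= z -> 0 <= u < 1 -> z <= z / Num.sqrt (1 - u).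
Proof.
move=> z0 /andP[u0 u1].
by rewrite ler_pdivlMr ?sqrtr_gt0 ?subr_gt0// ler_piMr// sqrt_le1.
Qed.

(** For negative [z] the division lowers the value, but by no more than the factor [1 + u], because
    [(1 + u)^2 (1 - u) >= 1] on [[0, 1/2]]. *)
Lemma studentized_neg z u : z <= 0 -> 0 <= u <= 1 / 2 ->
  z * (1 + u) <= z / Num.sqrt (1 - u) <= 0.
Proof.
move=> z0 /andP[u0 u1].
have s0 : 0 < Num.sqrt (1 - u) by rewrite sqrtr_gt0; lra.
rewrite mulr_le0_ge0 ?invr_ge0 ?(ltW s0)// andbT ler_pdivlMr// -mulrA.
rewrite ler_neMr//.
have : 1 <= ((1 + u) * Num.sqrt (1 - u)) ^+ 2.
  rewrite exprMn sqr_sqrtr; last by lra.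
  nra.
by rewrite expr_ge1// mulr_ge0 ?(ltW s0)//; lra.
Qed.

End CriticalValue.

(* [rho j] is the studentized moment, [m j] its (nonpositive) drift and [s j] the ratio
   of empirical to true standard deviation; [J] is the set of selected moments and
   [J1] that of the moments whose drift exceeds [- cp]. *)
Section Containment.
Context (R : realType) (p : nat).
Variables (T m s : 'I_p -> R) (dl e K zp cp : R) (z c : nat -> R).
Let rho j := (T j + m j) / s j.
Let J : {set 'I_p} := [set j | - 2 * cp < rho j].
Let J1 : {set 'I_p} := [set j | - cp < m j].
Let c2 := if (0 < #|J|)%N then c #|J| else 0.
Hypotheses (m0 : forall j, m j <= 0) (dl0 : 0 <= dl <= 1 / 4)
  (sdl : forall j, `|s j - 1| <= dl) (K0 : 0 <= K) (zp0 : 0 < zp) (zcp : zp <= cp)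
  (edl : dl <= e) (ezp : e <= zp).
Hypothesis z_homo : forall k k', (0 < k)%N -> (k <= k')%N -> (k' <= p)%N -> z k <= z k'.
Hypothesis c_ge : forall k, (0 < k <= p)%N -> 0 <= z k -> z k <= c k.
Hypothesis z_neg : forall k, (0 < k <= p)%N -> z k < 0 -> k = 1%N.
Hypothesis c1_ge : z 1 < 0 -> z 1 - e <= c 1 <= 0.
Hypothesis c1_K : z 1 < 0 -> - (K + 1) <= c 1.
Hypothesis z1_zp : - zp <= z 1.
Hypothesis rejected : (exists j, cp < rho j) \/ (exists j, c2 < rho j).

Let s0 j : 0 < s j.
Proof. by move: (sdl j) dl0; rewrite ler_norml => /andP[h _] /andP[_ h']; lra. Qed.

Let rhoE x j : (x < rho j) = (x * s j < T j + m j).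
Proof. by rewrite ltr_pdivlMr. Qed.

Let s_lb j x : 0 <= x -> x * (1 - dl) <= x * s j.
Proof.
move=> x0; rewrite ler_wpM2l//.
by move: (sdl j); rewrite ler_norml => /andP[h _]; lra.
Qed.

Let e0 : 0 <= e.
Proof. by move: dl0 => /andP[h _]; exact: le_trans edl. Qed.

Let cp0 : 0 < cp. Proof. exact: lt_le_trans zcp. Qed.

Let exceed j : cp < rho j -> zp * (1 - dl) <= T j.
Proof.
rewrite rhoE => h; move: (s_lb j (ltW zp0)) (m0 j) => h1 h2.
have : zp * s j <= cp * s j by rewrite ler_wpM2r// ltW.
by move: h; lra.
Qed.

(** A negative critical value may be lowered both by its own studentization, costing [e], and by
    [s j > 1], costing [(K + 1) * dl]. *)
Let sc_lb j : z 1 < 0 -> z 1 - (2 + K) * e <= c 1 * s j.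
Proof.
move=> z10; have /andP[h1 h2] := c1_ge z10; have h3 := c1_K z10.
have h4 : (- c 1) * (s j - 1) <= (K + 1) * dl.
  have [sj|sj] := leP 0 (s j - 1).
    apply: ler_pM => //; [lra|lra|].
    exact: le_trans (ler_norm _) (sdl j).
  have : (- c 1) * (s j - 1) <= 0 by rewrite mulr_ge0_le0//; lra.
  have : 0 <= (K + 1) * dl by rewrite mulr_ge0 ?addr_ge0//; move: dl0 => /andP[].
  lra.
have : (K + 1) * dl <= (K + 1) * e by rewrite ler_wpM2l// addr_ge0.
lra.
Qed.

Let c2_neg_card : c2 < 0 -> [/\ #|J| = 1%N, z 1 < 0 & c2 = c 1].
Proof.
rewrite /c2; case: ifPn => [J0|_]; last by rewrite ltxx.
have kp : (0 < #|J| <= p)%N by rewrite J0/= (leq_trans (max_card _))// card_ord.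
move=> c0; have zJ : z #|J| < 0.
  by rewrite ltNge; apply/negP => h; have := c_ge kp h; lra.
by have E := z_neg kp zJ; rewrite E in zJ c0 *.
Qed.

Let cp_c1 : z 1 < 0 -> - 2 * cp <= c 1.
Proof. move=> z10; have /andP[h1 _] := c1_ge z10; move: z1_zp zcp ezp; lra. Qed.

Definition threshold k : R :=
  if 0 <= z k then z k * (1 - dl) else z k - (2 + K) * e.

(** An element of [J1] that is not selected has drift above [- cp] but studentized value at most
    [- 2 * cp], hence a downward deviation of about [cp]. Without such a deviation [J1] is contained
    in [J], and monotonicity of [z] replaces the random [#|J|] by the fixed [#|J1|]. *)
Lemma containment_binding : (0 < #|J1|)%N ->
  [\/ exists j, zp * (1 - dl) <= T j,
      exists2 j, j \in J1 & zp * (1 - 2 * dl) <= - T j |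
      exists2 j, j \in J1 & threshold #|J1| <= T j].
Proof.
move=> J10.
have [[j hj]|nE1] := pselect (exists j, zp * (1 - dl) <= T j); first by constructor 1; exists j.
have [[j jJ hj]|nE2] := pselect (exists2 j, j \in J1 & zp * (1 - 2 * dl) <= - T j).
  by constructor 2; exists j.
constructor 3.
have J1J : J1 \subset J.
  apply/fintype.subsetP => j jJ1; move: (jJ1); rewrite !inE => mj; rewrite ltNge; apply/negP => hr.
  apply: nE2; exists j => //.
  move: hr; rewrite leNgt rhoE -leNgt => hr.
  have := s_lb j (ltW cp0) => h1.
  have : zp * (1 - 2 * dl) <= cp * (1 - 2 * dl).
    by rewrite ler_wpM2r//; move: dl0 => /andP[]; lra.
  lra.
have k1k := subset_leq_card J1J.
have k1p : (#|J1| <= p)%N by rewrite (leq_trans (max_card _))// card_ord.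
have kp : (#|J| <= p)%N by rewrite (leq_trans (max_card _))// card_ord.
have J0 : (0 < #|J|)%N by exact: leq_trans k1k.
case: rejected => [[j hj]|[j hj]]; first by exfalso; apply: nE1; exists j; exact: exceed.
have zz := z_homo J10 k1k kp.
have c2E : c2 = c #|J| by rewrite /c2 J0.
have jJ1 : j \in J1.
  apply/negPn/negP => nj.
  have rj0 : rho j <= 0.
    rewrite leNgt; apply/negP; rewrite rhoE mul0r => h; apply: nE1; exists j.
    move: nj; rewrite inE -leNgt => h2.
    have : zp * dl >= 0 by rewrite mulr_ge0 ?(ltW zp0)//; move: dl0 => /andP[].
    by move: zcp; lra.
  have [E z10 cE] := c2_neg_card (lt_le_trans hj rj0).
  have /eqP J1E : J1 == J by rewrite eqEcard J1J E.
  move: nj; rewrite J1E inE => /negP; apply.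
  by apply: le_lt_trans hj; rewrite cE cp_c1.
exists j => //; move: hj; rewrite c2E rhoE => hj; have mj := m0 j.
rewrite /threshold; case: ifPn => [z0|].
  have ck : z #|J| <= c #|J| by apply: c_ge; rewrite ?J0// (le_trans z0).
  have : z #|J1| * s j <= c #|J| * s j.
    by rewrite ler_wpM2r ?(ltW (s0 j))// (le_trans zz).
  by have := s_lb j z0; lra.
rewrite -ltNge => z0.
have E1 : #|J1| = 1%N by apply: z_neg => //; rewrite J10.
rewrite E1 in z0 *.
have [zk|zk] := leP 0 (z #|J|).
  have ck : 0 <= c #|J| by apply: (le_trans zk); apply: c_ge; rewrite ?J0.
  have : 0 <= c #|J| * s j by rewrite mulr_ge0// ltW.
  have : 0 <= (2 + K) * e.
    by rewrite mulr_ge0 ?addr_ge0.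
  lra.
have E2 : #|J| = 1%N by apply: z_neg => //; rewrite J0.
by rewrite E2 in hj; have := sc_lb j z0; lra.
Qed.

(* Without nearly binding moments the critical value can only be exceeded when it
   is negative, which forces a single selected moment [j]; all the other studentized
   moments are then very small. *)
Lemma containment_slack : #|J1| = 0%N ->
  (exists j, zp * (1 - dl) <= T j) \/
  (z 1 < 0 /\ exists j, [/\ z 1 - (2 + K) * e - m j <= T j &
     forall i, i != j -> 2 * zp * (1 - dl) + m i <= - T i]).
Proof.
move=> J10.
have mc j : m j <= - cp.
  by have := cards0_eq J10 => /setP/(_ j); rewrite !inE => /negbT; rewrite -leNgt.
have [[j hj]|nE1] := pselect (exists j, zp * (1 - dl) <= T j); first by left; exists j.
right.
case: rejected => [[j hj]|[j hj]]; first by exfalso; apply: nE1; exists j; exact: exceed.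
have rj0 : rho j <= 0.
  rewrite leNgt; apply/negP; rewrite rhoE mul0r => h; apply: nE1; exists j.
  have : zp * dl >= 0 by rewrite mulr_ge0 ?(ltW zp0)//; move: dl0 => /andP[].
  by move: (mc j) zcp; lra.
have [E z10 cE] := c2_neg_card (lt_le_trans hj rj0).
split => //; exists j.
have jJ : j \in J by rewrite inE; apply: le_lt_trans hj; rewrite cE cp_c1.
have /cards1P[j' JE] : #|J| == 1%N by rewrite E.
split.
  move: hj; rewrite cE rhoE => hj; have := sc_lb j z10; lra.
move=> i ij; have : i \notin J.
  by move: jJ; rewrite JE !inE => /eqP <-.
rewrite inE -leNgt leNgt rhoE -leNgt => h.
have h1 := s_lb i (ltW cp0).
have : zp * (1 - dl) <= cp * (1 - dl).
  by rewrite ler_wpM2r//; move: dl0 => /andP[]; lra.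
lra.
Qed.

End Containment.

Section ProbLe.
Context (R : realType) (d : measure_display) (Omega : measurableType d)
  (Pr : probability Omega R).

(** Measurability travels with the bound so that unions compose. *)
Definition prob_le (X : set Omega) (x : R) := measurable X /\ (Pr X <= x%:E)%E.

Lemma prob_leU X Y x y : prob_le X x -> prob_le Y y -> prob_le (X `|` Y) (x + y).
Proof.
move=> [mX hX] [mY hY]; split; first exact: measurableU.
by apply: (le_trans (measureU2 _ mX mY)); rewrite EFinD leeD.
Qed.

Lemma prob_le_sub X Y y : measurable X -> X `<=` Y -> prob_le Y y -> (Pr X <= y%:E)%E.
Proof. by move=> mX XY [mY hY]; apply: le_trans hY; apply: le_measure; rewrite ?inE. Qed.

Lemma prob_le_le X x y : x <= y -> prob_le X x -> prob_le X y.
Proof. by move=> xy [mX hX]; split => //; apply: le_trans hX _; rewrite lee_fin. Qed.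

Lemma prob_le_union (I : finType) (J : pred I) (E : I -> set Omega) (c : R) :
  (forall j, prob_le (E j) c) -> prob_le (\bigcup_(j in [set` J]) E j) (#|J|%:R * c).
Proof. by move=> h; apply: union_bound => j; have [] := h j. Qed.

End ProbLe.

Section Constants.
Variables (R : realType) (C1 K : R).
Hypotheses (C10 : 0 < C1) (K0 : 0 <= K).

Definition shift_const : R := 4 * expR (5 / 2) * (2 + K).
Definition slack_const : R :=
  shift_const + tail_const C1 + shift_const * tail_const C1.
(** Besides the bad event, each case of the proof combines at most three deviation events. *)
Definition total_const : R := good_const C1 + 3 * slack_const.

Lemma shift_const_ge0 : 0 <= shift_const.
Proof. rewrite /shift_const; nonneg. Qed.

Lemma slack_const_ge0 : 0 <= slack_const.
Proof.
have := shift_const_ge0; have := tail_const_ge0 C10; rewrite /slack_const.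
by move=> *; apply: addr_ge0; [exact: addr_ge0|exact: mulr_ge0].
Qed.

Lemma total_const_ge0 : 0 <= total_const.
Proof.
have s0 := slack_const_ge0; rewrite /total_const /good_const /sqr_const /sum_const.
by apply: addr_ge0; [nonneg|rewrite mulr_ge0].
Qed.

End Constants.

(** * Rejection probability for standardized moments *)

Section Main.
Context (R : realType) (d1 d2 : measure_display) (Omega : measurableType d1)
  (Pr : probability Omega R) (S : measurableType d2) (mu : probability S R).
Variables (n p : nat) (W : 'I_n -> Omega -> S) (Z : 'I_p -> S -> R) (A : R).
Hypotheses (n0 : (0 < n)%N) (p0 : (0 < p)%N) (iidW : iid Pr mu W).
Hypothesis stdZ : forall j, standardized mu (Z j) A.
Hypothesis EmaxZ4 :
  (\int[mu]_s (\big[Num.max/0]_(j < p) `|Z j s| ^+ 4)%:E <= (A ^+ 2)%:E)%E.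
Hypothesis A1 : 1 <= A.
Local Notation N := (Num.sqrt n%:R : R).
Variables (C1 r L alpha gam K : R).
Hypotheses (C10 : 0 < C1) (r0 : 0 < r) (r4 : r <= 1 / 4) (L1 : 1 <= L).
Hypothesis rC : 64 * C1 ^+ 2 * r <= 1.
Hypotheses (K0 : 0 <= K) (rK : K ^+ 3 * C1 ^+ 2 * r <= 1) (rK' : 3 * (2 + K) * r <= 1).
Hypothesis ALN : A * L ^+ 2 <= C1 * N * r ^+ 16.
Hypotheses (alpha1 : alpha < 1) (gam0 : 0 < gam) (gam4 : gam < alpha / 4).
Hypothesis pL : p%:R * expR (- L) = gam.
Hypothesis KE : - K <= Phi_inv (1 - alpha).
Local Notation t := (trunc_level r L N).
Local Notation a := (alpha - 3 * gam).
Local Notation zp := (Phi_inv (1 - gam / p%:R)).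
Local Notation z k := (Phi_inv (1 - a / k%:R)).
Local Notation dl := (r / (2 * L)).
Local Notation e := (r / L).

Let N0 : 0 < N. Proof. by rewrite sqrtr_gt0 ltr0n. Qed.
Let N2 : N ^+ 2 = n%:R. Proof. by rewrite sqr_sqrtr ?ler0n. Qed.
Let L0 : 0 < L. Proof. exact: lt_le_trans L1. Qed.
Let r1 : r <= 1. Proof. move: r4; lra. Qed.
Let pR0 : 0 < p%:R :> R. Proof. by rewrite ltr0n. Qed.
Let pR1 : 1 <= p%:R :> R. Proof. by rewrite ler1n. Qed.
Let e0 : 0 < e. Proof. exact: divr_gt0. Qed.
Let er : e <= r. Proof. by rewrite ler_pdivrMr// ler_peMr// ltW. Qed.

Let Ln : L ^+ 2 / n%:R <= C1 ^+ 2 * r ^+ 32.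
Proof.
rewrite -[X in _ / X]N2.
have -> : L ^+ 2 / N ^+ 2 = (L / N) ^+ 2 by rewrite expr_div_n.
have -> : C1 ^+ 2 * r ^+ 32 = (C1 * r ^+ 16) ^+ 2 by ring.
rewrite lerXn2r ?nnegrE; [by []|by nonneg|by nonneg|].
rewrite ler_pdivrMr//; have : L <= A * L ^+ 2.
  have -> : A * L ^+ 2 = L * (A * L) by ring.
  by rewrite ler_peMr ?(ltW L0)// mulr_ege1.
by move: ALN; lra.
Qed.

Let L2n : 2 * L / n%:R <= 1 / 32.
Proof.
have nn : 0 <= n%:R^-1 :> R by rewrite invr_ge0.
have : L / n%:R <= L ^+ 2 / n%:R by rewrite ler_wpM2r// expr2 ler_peMl// ltW.
have : C1 ^+ 2 * r ^+ 32 <= C1 ^+ 2 * r.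
  by rewrite ler_wpM2l ?sqr_ge0// exprS ler_piMr ?(ltW r0)// exprn_ile1// ltW.
move: Ln rC; lra.
Qed.

Let gp01 : 0 < gam / p%:R <= gam.
Proof. by rewrite divr_gt0//= ler_pdivrMr// ler_peMr// ltW. Qed.

Let gam14 : gam < 1 / 4. Proof. move: alpha1 gam4; lra. Qed.

Let Phi_zp : Phi zp = 1 - gam / p%:R.
Proof. apply: Phi_invK; move: gp01 gam14 => /andP[]; lra. Qed.

Let zp14 : 1 / 4 <= zp.
Proof.
rewrite leNgt; apply/negP => h.
have := Phi_homo (ltW h); have : 0 <= (1 / 4 : R) by lra.
move=> /(@Phi_lipschitz R); rewrite Phi0 Phi_zp.
move: gp01 gam14 => /andP[]; lra.
Qed.

Let zp0 : 0 < zp. Proof. by apply: lt_le_trans zp14; rewrite divr_gt0. Qed.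

(** Since [gam / p = expR (- L)], the Gaussian tail bound places every level up to [zp] in the range
    of [moderate_deviation]. *)
Let zp2L : zp ^+ 2 <= 2 * L.
Proof.
have [z1|z1] := leP 1 zp; last first.
  have : zp ^+ 2 <= 1 by rewrite exprn_ile1// ltW.
  by move: L1; lra.
have := le_trans (Phi_tail_le z1) (gauss_density_le _).
rewrite Phi_zp subKr -pL mulrAC divff ?gt_eqF// mul1r ler_expR.
lra.
Qed.

Let zpL : zp * (1 + zp) <= 4 * L.
Proof. have := sqr_ge0 (zp - 1); move: zp2L L1; lra. Qed.

Let zpL1 : 1 + zp <= 5 / 2 * L.
Proof. have := sqr_ge0 (zp - 1); move: zp2L L1; lra. Qed.

Let a01 : 0 < a < 1. Proof. move: gam0 gam4 alpha1; lra. Qed.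
Let gam_a : gam < a. Proof. move: gam0 gam4 alpha1; lra. Qed.

Let ak01 k : (0 < k)%N -> 0 < a / k%:R <= a.
Proof.
move=> k0; have kR : 0 < k%:R :> R by rewrite ltr0n.
have kR1 : 1 <= k%:R :> R by rewrite ler1n.
by have /andP[ha _] := a01; rewrite divr_gt0//= ler_pdivrMr// ler_peMr// ltW.
Qed.

Let Phi_z k : (0 < k)%N -> Phi (z k) = 1 - a / k%:R.
Proof. move=> /ak01/andP[h1 h2]; apply: Phi_invK; have /andP[] := a01; lra. Qed.

Let z_homo k k' : (0 < k)%N -> (k <= k')%N -> (k' <= p)%N -> z k <= z k'.
Proof.
move=> k0 kk _; have k'0 := leq_trans k0 kk.
have /andP[h1 h2] := ak01 k0; have /andP[h3 h4] := ak01 k'0; have /andP[h5 h6] := a01.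
apply: Phi_inv_le; [lra| |lra].
by rewrite lerD2l lerN2 ler_wpM2l ?(ltW h5)// lef_pV2 ?posrE ?ltr0n// ler_nat.
Qed.

Let z_zp k : (0 < k <= p)%N -> z k <= zp.
Proof.
move=> /andP[k0 kp]; have /andP[h1 h2] := ak01 k0; have /andP[h3 h4] := gp01.
have /andP[h5 h6] := a01.
apply: Phi_inv_le; [lra| |lra].
rewrite lerD2l lerN2; apply: ler_pM; [exact: ltW|by rewrite invr_ge0|exact: ltW|].
by rewrite lef_pV2 ?posrE ?ltr0n// ler_nat.
Qed.

Let sqr_n y : 0 <= y <= zp -> 0 <= y ^+ 2 / n%:R <= 1 / 32.
Proof.
move=> /andP[y0 yz]; rewrite divr_ge0 ?sqr_ge0//=; apply: le_trans L2n.
rewrite ler_wpM2r ?invr_ge0//; apply: le_trans zp2L.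
by rewrite lerXn2r ?nnegrE// ltW.
Qed.

Let cSN_ge k b : 0 <= Phi_inv (1 - b / k%:R) <= zp -> Phi_inv (1 - b / k%:R) <= cSN n k b.
Proof.
move=> h; have /andP[h1 h2] := sqr_n h; have /andP[h3 _] := h.
by apply: studentized_ge => //; rewrite h1/=; lra.
Qed.

Let zp_cp : zp <= cSN n p gam.
Proof. by apply: cSN_ge; rewrite (ltW zp0) lexx. Qed.

Let c_ge k : (0 < k <= p)%N -> 0 <= z k -> z k <= cSN n k a.
Proof. by move=> kp z0; apply: cSN_ge; rewrite z0 z_zp. Qed.

(** As [a < 1], two or more moments give [a / k <= 1 / 2]. *)
Let z_neg k : (0 < k <= p)%N -> z k < 0 -> k = 1%N.
Proof.
move=> /andP[k0 kp] zk; case: k k0 kp zk => [//|[//|k]] _ _ zk.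
have := Phi_lt zk; rewrite Phi_z// Phi0 => h.
have k2 : 2 <= k.+2%:R :> R by rewrite ler_nat.
have hh : a / k.+2%:R <= 1 / 2.
  rewrite ler_pdivrMr ?ltr0n//; have /andP[] := a01; lra.
by exfalso; move: h hh; move: (a / _) => c; lra.
Qed.

Let z1_zp : - zp <= z 1.
Proof.
rewrite leNgt; apply/negP => /Phi_lt; rewrite PhiN Phi_zp Phi_z// divr1.
move: gp01 alpha1 gam0 => /andP[]; lra.
Qed.

Let z1K : - K <= z 1.
Proof.
apply: (le_trans KE); rewrite divr1; have /andP[h1 h2] := a01.
apply: Phi_inv_le; move: alpha1 gam0; lra.
Qed.

(** [K] bounds [- z 1] uniformly in [gam], so studentization lowers [z 1] by at most [K ^+ 3 / n],
    which [rK] makes smaller than [e]. *)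
Let c1_ge : z 1 < 0 -> z 1 - e <= cSN n 1 a <= 0.
Proof.
move=> zn; have zz : 0 <= - z 1 <= zp by rewrite oppr_ge0 (ltW zn) lerNl z1_zp.
have := sqr_n zz; rewrite sqrrN => /andP[h1 h2].
have := @studentized_neg R (z 1) (z 1 ^+ 2 / n%:R) (ltW zn).
rewrite h1 /= => /(_ _)/andP[]; first lra.
move=> h3 h4; rewrite /cSN h4 andbT; apply: le_trans h3.
rewrite mulrDr mulr1 lerD2l lerNl -mulNr.
have zK : - z 1 <= K by move: z1K; lra.
have z2 : z 1 ^+ 2 <= K ^+ 2 by rewrite -sqrrN lerXn2r ?nnegrE ?oppr_ge0// ltW.
apply: (@le_trans _ _ (K * (K ^+ 2 / n%:R))).
  by apply: ler_pM => //; rewrite ?oppr_ge0 ?(ltW zn)// ler_wpM2r// invr_ge0.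
rewrite ler_pdivlMr//.
have -> : K * (K ^+ 2 / n%:R) * L = K ^+ 3 * (L / n%:R) by ring.
apply: (@le_trans _ _ (K ^+ 3 * (C1 ^+ 2 * r ^+ 32))).
  rewrite ler_wpM2l ?exprn_ge0//; apply: le_trans Ln.
  by rewrite ler_wpM2r ?invr_ge0// expr2 ler_peMl// ltW.
have -> : K ^+ 3 * (C1 ^+ 2 * r ^+ 32) = K ^+ 3 * C1 ^+ 2 * r * (r ^+ 30 * r) by ring.
rewrite -[leRHS]mul1r; apply: ler_pM => //; [by nonneg|by nonneg|].
by rewrite ler_piMl ?(ltW r0)// exprn_ile1// ltW.
Qed.

Let c1_K : z 1 < 0 -> - (K + 1) <= cSN n 1 a.
Proof. by move=> /c1_ge/andP[h _]; move: z1K er r1; lra. Qed.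

Let dl01 : 0 <= dl <= 1 / 4.
Proof.
have -> : dl = e / 2 by field; rewrite gt_eqF.
by move: er r4 e0; lra.
Qed.

Let edl : dl <= e.
Proof.
have -> : dl = e / 2 by field; rewrite gt_eqF.
by move: e0; lra.
Qed.

Let ezp : e <= zp. Proof. by move: er r4 zp14; lra. Qed.

Let up j x := [set w | (x <= \sum_(i < n) trunc (Z j) t (W i w) / N)%R].
Let dn j x := [set w | (x <= \sum_(i < n) trunc (fun s => - Z j s) t (W i w) / N)%R].

Let Ct := tail_const C1.
Let Ct0 : 0 <= Ct. Proof. exact: tail_const_ge0. Qed.

Let tail_gen (Y : S -> R) x : standardized mu Y A -> (0 <= x -> x ^+ 2 <= 2 * L) ->
  prob_le Pr [set w | (x <= \sum_(i < n) trunc Y t (W i w) / N)%R]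
    ((1 - Phi x) * (1 + Ct * r)).
Proof.
move=> [mY iY EY [iY2 EY2 EY4]] xL; have [mW lawW indepW] := iidW.
split.
  apply: (measurable_sumW_ge mW (g := fun s => trunc Y t s / N)).
  by apply: measurable_funM => //; exact: measurable_trunc.
have r2 : r <= 1 / 2 by move: r4; lra.
exact: (moderate_deviation n0 mW lawW indepW mY iY EY iY2 EY2 EY4 A1 C10 r0 r2 L1 ALN xL).
Qed.

Let D := shift_const K.
Let M := slack_const C1 K.

Let e52 : 1 <= expR (5 / 2) :> R. Proof. by rewrite -[leLHS]expR0 ler_expR divr_ge0. Qed.
Let D8 : 2 + K <= D.
Proof. by rewrite /D /shift_const ler_peMl ?addr_ge0//; move: e52; lra. Qed.
Let D0 : 0 <= D. Proof. by apply: le_trans D8; rewrite addr_ge0. Qed.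
Let M0 : 0 <= M. Proof. exact: slack_const_ge0. Qed.

Let rr : 0 <= (1 - r) * r. Proof. by rewrite mulr_ge0 ?(ltW r0)// subr_ge0. Qed.

Let slackM : (1 + D * r) * (1 + Ct * r) <= 1 + M * r.
Proof.
have : 0 <= D * Ct * ((1 - r) * r) by apply: mulr_ge0 rr; exact: mulr_ge0.
rewrite /M /slack_const -/D -/Ct; lra.
Qed.

(** For a single event an additive error in the tail is affordable; unions go through [rel_tail]. *)
Let abs_tail x b : b <= 1 -> 1 - Phi x <= b + D * r ->
  (1 - Phi x) * (1 + Ct * r) <= b + M * r.
Proof.
move=> b1 h; have Cr : 0 <= Ct * r by rewrite mulr_ge0// ltW.
have h1 : (1 - Phi x) * (1 + Ct * r) <= (b + D * r) * (1 + Ct * r).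
  by rewrite ler_wpM2r// addr_ge0.
have : b * (Ct * r) <= Ct * r by rewrite ler_piMl.
have : 0 <= D * Ct * ((1 - r) * r) by apply: mulr_ge0 rr; exact: mulr_ge0.
rewrite /M /slack_const -/D -/Ct; lra.
Qed.

Let rel_tail (k : nat) x b : 0 <= b -> k%:R * b <= 1 ->
  1 - Phi x <= b * (1 + D * r) ->
  k%:R * ((1 - Phi x) * (1 + Ct * r)) <= k%:R * b + M * r.
Proof.
move=> b0 kb h; have Cr : 0 <= 1 + Ct * r by rewrite addr_ge0// mulr_ge0// ltW.
have Mr : 0 <= M * r by rewrite mulr_ge0// ltW.
have k0 : 0 <= k%:R :> R by [].
apply: (@le_trans _ _ (k%:R * (b * (1 + D * r) * (1 + Ct * r)))).
  by rewrite ler_wpM2l// ler_wpM2r.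
apply: (@le_trans _ _ (k%:R * (b * (1 + M * r)))).
  by rewrite ler_wpM2l// -mulrA ler_wpM2l.
have : k%:R * b * (M * r) <= M * r by rewrite ler_piMl.
lra.
Qed.

(** The allowance equals [(2 + K) * r * (5 / 2)]: it fits the shift [(2 + K) * e] at level [zp],
    where [1 + zp <= 5 / 2 * L]. *)
Let shift_tail y d b : 0 <= y -> 1 - Phi y = b -> 0 <= d ->
  d * (1 + y) <= (2 + K) * (4 * r) / 4 * (5 / 2) -> d * (1 + y) <= 1 ->
  1 - Phi (y - d) <= b * (1 + D * r).
Proof.
move=> y0 yb dd h h1.
apply: (le_trans (Phi_tail_shift y0 dd h1)); rewrite yb.
rewrite ler_wpM2l//; first by rewrite -yb subr_ge0 Phi_le1.
rewrite lerD2l /D /shift_const.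
apply: (@le_trans _ _ (expR (5 / 2) * ((2 + K) * (4 * r) / 4 * (5 / 2)))).
  by rewrite ler_wpM2l// expR_ge0.
have : 0 <= expR (5 / 2) * ((2 + K) * r) by rewrite !mulr_ge0 ?expR_ge0 ?addr_ge0// ltW.
lra.
Qed.

(** Scaling by [1 - d] shifts the level by [y * d], and [y * (1 + y)] may be of order [L]; hence the
    accuracy [r / L] asked of the standard deviations. *)
Let scale_tail y d b : 0 <= y <= zp -> 1 - Phi y = b -> 0 <= d <= e ->
  1 - Phi (y - y * d) <= b * (1 + D * r).
Proof.
move=> /andP[y0 yz] yb /andP[d0 de].
have h : y * d * (1 + y) <= 4 * r.
  have -> : y * d * (1 + y) = d * (y * (1 + y)) by ring.
  have -> : 4 * r = e * (4 * L) by field; rewrite gt_eqF.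
  apply: ler_pM => //; first by rewrite mulr_ge0// addr_ge0.
  apply: le_trans zpL; apply: ler_pM => //; first by rewrite addr_ge0.
  by rewrite lerD2l.
apply: shift_tail => //.
- exact: mulr_ge0.
- have : 0 <= K * r by rewrite mulr_ge0// ltW.
  by move: h r0; lra.
- by move: h r4; lra.
Qed.

Let sq_le x : x <= zp -> 0 <= x -> x ^+ 2 <= 2 * L.
Proof. by move=> xz x0; apply: le_trans zp2L; rewrite lerXn2r ?nnegrE// ltW. Qed.

Let gp_tail : 1 - Phi zp = gam / p%:R. Proof. by rewrite Phi_zp subKr. Qed.

Let pgam : p%:R * (gam / p%:R) = gam.
Proof. by rewrite mulrCA divff ?mulr1// gt_eqF. Qed.

Let E1 := \bigcup_(j in [set` predT]) up j (zp * (1 - dl)).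

Let scaled_union (f : bool) (J : pred 'I_p) d : 0 <= d <= e ->
  prob_le Pr (\bigcup_(j in [set` J]) (if f then up else dn) j (zp * (1 - d))) (gam + M * r).
Proof.
move=> de.
have xE : zp * (1 - d) = zp - zp * d by ring.
have xz : zp * (1 - d) <= zp.
  by rewrite xE gerBl mulr_ge0 ?(ltW zp0)//; case/andP: de.
have h := @scale_tail zp d _ _ gp_tail de.
have {}h : 1 - Phi (zp * (1 - d)) <= gam / p%:R * (1 + D * r).
  by rewrite xE h// (ltW zp0) lexx.
have /andP[g0 g1] := gp01.
have Jp : #|J|%:R * (gam / p%:R) <= gam.
  rewrite -[leRHS]pgam ler_wpM2r ?(ltW g0)// ler_nat.
  by rewrite (leq_trans (max_card _))// card_ord.
have J1 : #|J|%:R * (gam / p%:R) <= 1 by apply: (le_trans Jp); move: gam14; lra.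
have := rel_tail (ltW g0) J1 h => hr.
apply: prob_le_le (_ : _ <= _) (_ : prob_le _ _ _); last first.
  apply: prob_le_union => j.
  by case: f; [apply: tail_gen (stdZ j) _|apply: tail_gen (standardizedN (stdZ j)) _];
    exact: sq_le.
by apply: (le_trans hr); rewrite lerD2r.
Qed.

Variables (sg : Omega -> 'I_p -> R) (mj : 'I_p -> R) (rej Bad : set Omega).
Hypotheses (mj0 : forall j, mj j <= 0) (mrej : measurable rej).
Hypothesis pBad : prob_le Pr Bad (good_const C1 * r).
Let Tj w j := \sum_(i < n) trunc (Z j) t (W i w) / N.
Let rho w j := (Tj w j + mj j) / sg w j.
Hypothesis goodsg : forall w, ~ Bad w -> forall j, `|sg w j - 1| <= dl.
Let Jset w : {set 'I_p} := [set j | - 2 * cSN n p gam < rho w j].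
Hypothesis rejP : forall w, ~ Bad w -> rej w ->
  (exists j, cSN n p gam < rho w j) \/
  (exists j, (if (0 < #|Jset w|)%N then cSN n #|Jset w| a else 0) < rho w j).
Let J1 : {set 'I_p} := [set j | - cSN n p gam < mj j].

Let dnE w j : \sum_(i < n) trunc (fun s => - Z j s) t (W i w) / N = - Tj w j.
Proof. by rewrite /Tj -sumrN; apply: eq_bigr => i _; rewrite truncN mulNr. Qed.

Let dlE : 2 * dl = e. Proof. by field; rewrite gt_eqF. Qed.

(** The alternatives of [containment_binding] cost about [gam], [gam] and [alpha - 3 * gam], within
    the budget [alpha]. *)
Let bind_case : (0 < #|J1|)%N -> (Pr rej <= (alpha + total_const C1 K * r)%:E)%E.
Proof.
move=> J10.
pose thr := threshold dl e K (fun k => z k) #|J1|.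
pose E4 := \bigcup_(j in [set` (fun j => j \in J1)]) up j thr.
pose E2 := \bigcup_(j in [set` (fun j => j \in J1)]) dn j (zp * (1 - 2 * dl)).
have J1p : (0 < #|J1| <= p)%N by rewrite J10 (leq_trans (max_card _))// card_ord.
have p1 : prob_le Pr E1 (gam + M * r).
  by apply: (@scaled_union true); have /andP[-> _] := dl01; exact: edl.
have p2 : prob_le Pr E2 (gam + M * r).
  by apply: (@scaled_union false); rewrite dlE (ltW e0) lexx.
have /andP[ak0 ak1] := ak01 J10; have /andP[a0 a1] := a01.
have J1R : 0 < #|J1|%:R :> R by rewrite ltr0n.
have Ja : #|J1|%:R * (a / #|J1|%:R) = a by rewrite mulrCA divff ?mulr1// gt_eqF.
have ztail : 1 - Phi (z #|J1|) = a / #|J1|%:R by rewrite Phi_z// subKr.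
have p4 : prob_le Pr E4 (a + M * r).
  rewrite /E4 /thr /threshold; case: ifPn => [zz|].
    have h : 1 - Phi (z #|J1| * (1 - dl)) <= a / #|J1|%:R * (1 + D * r).
      have -> : z #|J1| * (1 - dl) = z #|J1| - z #|J1| * dl by ring.
      apply: (scale_tail _ ztail); first by rewrite zz z_zp.
      by have /andP[-> _] := dl01; exact: edl.
    have Ja1 : #|J1|%:R * (a / #|J1|%:R) <= 1 by rewrite Ja ltW.
    apply: prob_le_le (_ : _ <= _) (_ : prob_le _ _ _); last first.
      apply: prob_le_union => j; apply: tail_gen (stdZ j) _; apply: sq_le.
      have : 0 <= z #|J1| * dl by rewrite mulr_ge0//; have /andP[] := dl01.
      by have := z_zp J1p; lra.
    have := rel_tail (ltW ak0) Ja1 h; rewrite Ja.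
    by congr (_ * _ <= _); congr (_%:R); apply: eq_card.
  (* A negative threshold concerns one moment only, so the Lipschitz bound for [Phi] and [abs_tail]
     suffice. *)
  rewrite -ltNge => zz; have E := z_neg J1p zz.
  rewrite E in zz ztail *.
  apply: prob_le_le (_ : _ <= _) (_ : prob_le _ _ _); last first.
    apply: prob_le_union => j; apply: tail_gen (stdZ j) _ => h0.
    exfalso; have : 0 <= (2 + K) * e by rewrite mulr_ge0 ?addr_ge0// ltW.
    by lra.
  rewrite (_ : #|_| = 1%N); last by rewrite -E; apply: eq_card.
  rewrite mul1r; apply: abs_tail; first exact: ltW.
  have dd : 0 <= (2 + K) * e by rewrite mulr_ge0 ?addr_ge0// ltW.
  have := @Phi_lipschitz R (z 1 - (2 + K) * e) (z 1); rewrite subKr gerBl => /(_ dd).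
  have : (2 + K) * e <= D * r by apply: ler_pM => //; rewrite ?addr_ge0// ltW.
  by move: ztail; rewrite divr1; lra.
have := prob_le_sub mrej _ (prob_leU pBad (prob_leU p1 (prob_leU p2 p4))).
move=> /(_ _)/le_trans; apply.
  move=> w rw; have [bw|/[dup] nb bw] := pselect (Bad w); [by left|right].
  have [h|h|h] := containment_binding mj0 dl01 (goodsg bw) K0 zp0 zp_cp edl ezp
    z_homo c_ge z_neg c1_ge c1_K z1_zp (rejP bw rw) J10.
  - by left; case: h => j hj; exists j.
  - by right; left; case: h => j jJ hj; exists j => //; rewrite /dn/= dnE.
  - by right; right; case: h => j jJ hj; exists j.
rewrite lee_fin /total_const -/M; move: gam0; lra.
Qed.

(** If [z 1 >= 0] only an upper deviation of size [zp] remains. A negative [z 1] means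
    [alpha - 3 * gam > 1 / 2], which leaves room for events of probability about 1/2. *)
Let slack_case : #|J1| = 0%N -> (Pr rej <= (alpha + total_const C1 K * r)%:E)%E.
Proof.
move=> J10.
have p1 : prob_le Pr E1 (gam + M * r).
  by apply: (@scaled_union true); have /andP[-> _] := dl01; exact: edl.
have Mr : 0 <= M * r by rewrite mulr_ge0// ltW.
have cont w (bw : ~ Bad w) (rw : rej w) := containment_slack mj0 dl01 (goodsg bw) K0 zp0
  zp_cp edl ezp c_ge z_neg c1_ge c1_K z1_zp (rejP bw rw) J10.
have [z1|z1] := leP 0 (z 1).
  apply: (le_trans (prob_le_sub mrej _ (prob_leU pBad p1))).
    move=> w rw; have [bw|bw] := pselect (Bad w); [by left|right].
    have [[j hj]|[h _]] := cont w bw rw; first by exists j.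
    by move: h; rewrite ltNge z1.
  by rewrite lee_fin /total_const -/M; move: gam0 gam4; lra.
have mc j : mj j <= - zp.
  have : mj j <= - cSN n p gam.
    by have := cards0_eq J10 => /setP/(_ j); rewrite !inE => /negbT; rewrite -leNgt.
  by move: zp_cp; lra.
have [j0 j0max] : exists j0, forall j, mj j <= mj j0.
  pose i0 : 'I_p := Ordinal p0.
  by case: (@arg_maxP _ _ _ i0 predT mj isT) => j0 _ h; exists j0 => j; exact: h.
(* [nu] is how far the largest drift lies below [- zp]: if it exceeds [- z 1] a union
   bound suffices; otherwise only [j0] matters, and [Phi_subadditive] bounds the two tails. *)
pose nu := - mj j0 - zp.
have nu0 : 0 <= nu by rewrite /nu; have := mc j0; lra.
have ke0 : 0 <= (2 + K) * e by rewrite mulr_ge0 ?addr_ge0// ltW.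
have kea : (2 + K) * e <= D * r by apply: ler_pM => //; rewrite ?addr_ge0// ltW.
have [nuz|nuz] := leP (- z 1) nu.
  pose F := \bigcup_(j in [set` predT]) up j (zp - (2 + K) * e).
  have pF : prob_le Pr F (gam + M * r).
    have /andP[g0 g1] := gp01.
    have h : 1 - Phi (zp - (2 + K) * e) <= gam / p%:R * (1 + D * r).
      have hd : (2 + K) * e * (1 + zp) <= (2 + K) * r * (5 / 2).
        have -> : (2 + K) * r * (5 / 2) = (2 + K) * e * (5 / 2 * L).
          by field; rewrite gt_eqF.
        by rewrite ler_wpM2l.
      apply: shift_tail => //; [exact: ltW|by lra|by move: hd rK'; lra].
    have p1' : #|@predT 'I_p|%:R * (gam / p%:R) <= 1.
      by rewrite card_ord pgam; move: gam14; lra.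
    have := rel_tail (ltW g0) p1' h.
    rewrite [X in _ <= X + _](_ : _ = gam); last by rewrite card_ord pgam.
    move=> hr; apply: (prob_le_le hr); apply: prob_le_union => j; apply: tail_gen (stdZ j) _; apply: sq_le.
    by rewrite gerBl.
  apply: (le_trans (prob_le_sub mrej _ (prob_leU pBad (prob_leU p1 pF)))).
    move=> w rw; have [bw|bw] := pselect (Bad w); [by left|right].
    have [[j hj]|[_ [j [h _]]]] := cont w bw rw; first by left; exists j.
    right; exists j => //; apply: le_trans h; have := j0max j; move: nuz; rewrite /nu; lra.
  by rewrite lee_fin /total_const -/M; move: gam0 gam4; lra.
(* An exceedance by [j0] needs an upward deviation of [j0] of about [u = z 1 - mj j0]; one by
   another moment leaves [j0] unselected, so needs a downward deviation of about
   [v = 2 * zp + mj j0]. Their sum is at least [zp]. *)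
pose u := zp + nu + z 1; pose v := zp - nu.
have u0 : 0 <= u by rewrite /u; move: z1_zp; lra.
have v0 : 0 <= v by rewrite /v; move: z1_zp; lra.
have uv : Phi u + Phi v >= 1 / 2 + Phi zp.
  have := Phi_subadditive u0 v0; rewrite Phi0.
  have zz : zp <= u + v by rewrite /u /v; move: z1_zp; lra.
  by have := Phi_homo zz; lra.
have pu : prob_le Pr (up j0 (u - (2 + K) * e)) (1 - Phi u + M * r).
  have ux : u - (2 + K) * e <= zp by rewrite /u; lra.
  apply: (prob_le_le _ (tail_gen (stdZ j0) (sq_le ux))).
  apply: abs_tail; first by have := Phi_ge0 u; lra.
  have := @Phi_lipschitz R (u - (2 + K) * e) u; rewrite subKr gerBl => /(_ ke0); lra.
have zpe0 : 0 <= e * zp by rewrite mulr_ge0// ltW.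
have pv : prob_le Pr (dn j0 (v - e * zp)) (1 - Phi v + M * r).
  have vx : v - e * zp <= zp by rewrite /v; lra.
  apply: (prob_le_le _ (tail_gen (standardizedN (stdZ j0)) (sq_le vx))).
  apply: abs_tail; first by have := Phi_ge0 v; lra.
  have : e * zp <= D * r.
    have h : e * zp <= 2 * r.
      have -> : 2 * r = e * (2 * L) by field; rewrite gt_eqF.
      by rewrite ler_wpM2l ?(ltW e0)//; have := sqr_ge0 (zp - 1); move: zp2L L1; lra.
    apply: (le_trans h); rewrite ler_wpM2r ?(ltW r0)//.
    by apply: le_trans D8; rewrite lerDl.
  have := @Phi_lipschitz R (v - e * zp) v; rewrite subKr gerBl => /(_ zpe0); lra.
apply: (le_trans (prob_le_sub mrej _ (prob_leU pBad (prob_leU p1 (prob_leU pu pv))))).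
  move=> w rw; have [bw|bw] := pselect (Bad w); [by left|right].
  have [[j hj]|[_ [j [h hi]]]] := cont w bw rw; first by left; exists j.
  right; have [jj|jj] := eqVneq j0 j.
    by left; rewrite -jj in h; apply: le_trans h; rewrite /u /nu; lra.
  right; rewrite /dn/= dnE; have h2 := hi j0 jj; apply: le_trans h2.
  by rewrite /v /nu -dlE; lra.
rewrite lee_fin /total_const -/M.
(* The two tails add up to at most [1 / 2 + gam / p]; with the [gam] of [E1] this stays below
   [a + 3 * gam = alpha]. *)
have ha : 1 / 2 < a by have := Phi_lt z1; rewrite Phi_z// divr1 Phi0; lra.
have /andP[_ g1] := gp01.
by move: uv; rewrite Phi_zp; move: gam0; lra.
Qed.

Lemma rejection_bound : (Pr rej <= (alpha + total_const C1 K * r)%:E)%E.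
Proof. by have [/slack_case|/bind_case] := posnP #|J1|. Qed.

End Main.

(** * From the raw moments to standardized ones *)

Section Standardization.
Context (R : realType) (d2 : measure_display) (S : measurableType d2)
  (mu : probability S R).
Variable f : S -> R.
Hypothesis mf : measurable_fun setT f.
Hypothesis if2 : mu.-integrable setT (fun s => (f s ^+ 2)%:E).
Local Notation E := (Emean mu f).
Local Notation sd := (Esd mu f).
Hypothesis sd0 : 0 < sd.
Let Z s := sd^-1 * (f s - E).

Let icst (k : R) : mu.-integrable setT (fun=> k%:E).
Proof. exact: finite_measure_integrable_cst. Qed.

Let if1 : mu.-integrable setT (EFin \o f).
Proof.
have h : mu.-integrable setT (fun s => (1%:E + (f s ^+ 2)%:E)%E).
  exact: integrableD.
apply: le_integrable h => //; first exact/measurable_EFinP.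
move=> s _; rewrite -[leLHS]/(`|f s|%:E) -[leRHS]/(`|1 + f s ^+ 2|%:E) lee_fin.
have f2 : f s ^+ 2 = `|f s| ^+ 2 by rewrite -normrX ger0_norm// sqr_ge0.
rewrite (@ger0_norm _ (1 + _)) ?addr_ge0 ?sqr_ge0//.
by rewrite f2; have := sqr_ge0 (`|f s| - 1 / 2); lra.
Qed.

Let Ef : (\int[mu]_s (f s)%:E = E%:E)%E.
Proof. by rewrite /Emean fineK//; exact: (integrable_fin_num measurableT if1). Qed.

Let mZ : measurable_fun setT Z.
Proof. by apply: measurable_funM => //; exact: measurable_funB. Qed.

Let ic : mu.-integrable setT (fun s => (f s - E)%:E).
Proof.
have := integrableB measurableT if1 (icst E).
by congr integrable; apply/funext => s /=; rewrite EFinB.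
Qed.

Let ic2 : mu.-integrable setT (fun s => ((f s - E) ^+ 2)%:E).
Proof.
have h1 : mu.-integrable setT (fun s => ((- 2 * E)%:E * (f s)%:E)%E).
  exact: integrableZl.
have := integrableD measurableT (integrableD measurableT if2 h1) (icst (E ^+ 2)).
congr integrable; apply/funext => s /=; rewrite -EFinM -!EFinD; congr (_%:E); ring.
Qed.

Lemma standardized_of A : (\int[mu]_s (Z s ^+ 4)%:E <= (A ^+ 2)%:E)%E ->
  standardized mu Z A.
Proof.
move=> EZ4.
have zE : (fun s => (Z s)%:E) = (fun s => (sd^-1%:E * (f s - E)%:E)%E).
  by apply/funext => s; rewrite EFinM.
have z2E : (fun s => (Z s ^+ 2)%:E) = (fun s => ((sd ^- 2)%:E * ((f s - E) ^+ 2)%:E)%E).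
  by apply/funext => s; rewrite -EFinM /Z exprMn exprVn.
split => //.
- have : mu.-integrable setT (fun s => (Z s)%:E) by rewrite zE; exact: integrableZl.
  by [].
- rewrite zE integralZl//.
  have -> : (fun s => (f s - E)%:E) = (fun s => ((f s)%:E - E%:E)%E).
    by apply/funext => s; rewrite EFinB.
  rewrite integralB// Ef.
  by rewrite [X in (_ * (_ - X))%E](integral_cst1 mu) subee// mule0.
split => //.
- by rewrite z2E; exact: integrableZl.
rewrite z2E integralZl//.
have I0 : (0 <= \int[mu]_s ((f s - E) ^+ 2)%:E)%E.
  by apply: integral_ge0 => s _; rewrite lee_fin sqr_ge0.
have Ifin := integrable_fin_num measurableT ic2.
have -> : (\int[mu]_s ((f s - E) ^+ 2)%:E = (sd ^+ 2)%:E)%E.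
  by rewrite /Esd sqr_sqrtr ?fine_ge0// fineK.
by rewrite -EFinM mulVf// expf_neq0// gt_eqF.
Qed.

Variables (n : nat) (x : 'I_n -> S).
Hypothesis n0 : (0 < n)%N.

(** Location and scale equivariance: [f] enters through its standardized version plus the
    deterministic drift [sqrt n * E / sd], nonpositive at the true parameter. *)
Lemma ratioE : sighat x Z != 0 ->
  Defs.ratio x f = ((\sum_(i < n) Z (x i) / Num.sqrt n%:R + Num.sqrt n%:R * E / sd)
               / sighat x Z)%:E.
Proof.
move=> s0.
have nn0 : n%:R != 0 :> R by rewrite pnatr_eq0 -lt0n.
have N0 : 0 < Num.sqrt n%:R :> R by rewrite sqrtr_gt0 ltr0n.
have mbE : mbar x Z = sd^-1 * (mbar x f - E).
  rewrite /mbar /Z -mulr_sumr sumrB sumr_const card_ord -mulr_natl.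
  by field; rewrite nn0 gt_eqF.
have sgE : sighat x Z = sd^-1 * sighat x f.
  rewrite /sighat mbE.
  have -> : \sum_(i < n) (Z (x i) - sd^-1 * (mbar x f - E)) ^+ 2 =
      sd^-1 ^+ 2 * \sum_(i < n) (f (x i) - mbar x f) ^+ 2.
    by rewrite mulr_sumr; apply: eq_bigr => i _; rewrite /Z; ring.
  rewrite mulrCA sqrtrM ?sqr_ge0// sqrtr_sqr ger0_norm// invr_ge0 ltW//.
have sf0 : sighat x f != 0 by move: s0; rewrite sgE mulf_eq0 negb_or => /andP[].
rewrite /Defs.ratio sf0; congr (_%:E).
have -> : \sum_(i < n) Z (x i) / Num.sqrt n%:R = Num.sqrt n%:R * mbar x Z.
  rewrite /mbar -mulr_suml -{3}(@sqr_sqrtr _ n%:R) ?ler0n//.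
  by field; rewrite gt_eqF.
by rewrite mbE sgE; field; rewrite sf0 gt_eqF.
Qed.

End Standardization.

Lemma lt_bigmaxP (R : realType) (p : nat) (F : 'I_p -> \bar R) (y : \bar R) :
  (y < \big[Order.max/-oo]_(j < p) F j)%E -> exists j, (y < F j)%E.
Proof.
move=> h; apply: contrapT => nex; move: h; rewrite ltNge => /negP; apply.
apply/bigmax_leP; split; first exact: leNye.
by move=> j _; rewrite leNgt; apply/negP => hj; apply: nex; exists j.
Qed.

(** Yields [L >= 1], because [p / gam >= 4]. *)
Lemma expR1_le4 (R : realType) : expR 1 <= 4 :> R.
Proof.
have h : 1 / 2 <= expR (- (1 / 2)) :> R.
  by apply: le_trans (expR_ge1Dx _); lra.
have e0 := expR_gt0 (1 / 2 : R).
have h2 : expR (1 / 2) <= 2 :> R.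
  move: h; rewrite expRN -[leRHS]mul1r ler_pdivlMr//; lra.
have -> : 1 = 1 / 2 + 1 / 2 :> R by lra.
by rewrite expRD; nra.
Qed.

Unset Implicit Arguments.

Theorem theorem4p6 (R : realType) (alpha c1 C1 : R) :
  0 < alpha < 1 -> 0 < c1 < 1 / 2 -> 0 < C1 ->
  exists c C : R, 0 < c /\ 0 < C /\
  forall (n p dth dh : nat) (d1 d2 : measure_display)
    (Omega : measurableType d1) (Pr : probability Omega R)
    (S : measurableType d2) (mu : probability S R)
    (W : 'I_n -> Omega -> S) (m : 'I_p -> S -> 'rV[R]_dth -> R)
    (Theta : set 'rV[R]_dth) (h : 'rV[R]_dth -> 'rV[R]_dh) (hbar : 'rV[R]_dh)
    (thstar : 'rV[R]_dth) (gam : R),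
  (0 < n)%N -> (0 < p)%N ->
  (* W_1, ..., W_n i.i.d. with law mu *)
  (forall i, measurable_fun setT (W i)) ->
  (forall i (A : set S), measurable A -> Pr (W i @^-1` A) = mu A) ->
  (forall A : 'I_n -> set S, (forall i, measurable (A i)) ->
     Pr (\bigcap_i (W i @^-1` A i)) =
     (\big[*%E/1%E]_(i < n) Pr (W i @^-1` A i))%E) ->
  (forall j th, measurable_fun setT (fun s => m j s th)) ->
  (* thstar in Theta_I, and H_0 : h thstar = hbar *)
  Theta thstar -> h thstar = hbar ->
  (forall j, mu.-integrable setT (fun s => ((m j s thstar) ^+ 2)%:E)) ->
  (forall j, Emean mu (fun s => m j s thstar) <= 0) ->
  (forall j, 0 < Esd mu (fun s => m j s thstar)) ->
  0 < gam < alpha / 4 ->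
  ((\big[Order.max/-oo%E]_(j < p)
      \int[mu]_s ((`| (Esd mu (fun s => m j s thstar))^-1 *
                     (m j s thstar - Emean mu (fun s => m j s thstar)) | ^+ 3)%:E))
    * ((ln (p%:R / alpha)) `^ (3 / 2))%:E
   <= (C1 * n%:R `^ (1 / 2 - c1))%:E)%E ->
  (poweR (\int[mu]_s ((\big[Num.max/0]_(j < p)
       `| (Esd mu (fun s => m j s thstar))^-1 *
          (m j s thstar - Emean mu (fun s => m j s thstar)) | ^+ 4)%:E)) (1 / 2)
    * ((ln (p%:R / gam)) ^+ 2)%:E
   <= (C1 * n%:R `^ (1 / 2 - c1))%:E)%E ->
  measurable (reject W m Theta h hbar alpha gam) ->
  (Pr (reject W m Theta h hbar alpha gam) <= (alpha + C * n%:R `^ (- c))%:E)%E.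
Proof.
move=> /andP[alpha0 alpha1] /andP[c10 c12] C10.
pose K := `|Phi_inv (1 - alpha)|.
have K0 : 0 <= K by exact: normr_ge0.
(* The sum of the coefficients in the four smallness conditions on [r], so that [Q * r <= 1] gives
   them all; adding [Q] to the final constant covers [Q * r > 1]. *)
pose Q := 4 + 64 * C1 ^+ 2 + K ^+ 3 * C1 ^+ 2 + 3 * (2 + K).
have q2 : 0 <= C1 ^+ 2 by exact: sqr_ge0.
have q3 : 0 <= K ^+ 3 * C1 ^+ 2 by rewrite mulr_ge0// exprn_ge0.
have Q0 : 0 < Q by rewrite /Q; lra.
have tc0 := total_const_ge0 C10 K0.
(* With [r = n^(- c1 / 16)] the rate [n^(1/2 - c1)] is exactly [sqrt n * r ^+ 16]. *)
exists (c1 / 16), (total_const C1 K + Q); split; first by rewrite divr_gt0.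
split; first by rewrite ltr_wpDl.
move=> n p dth dh d1 d2 Omega Pr S mu W m Theta h hbar thstar gam n0 p0.
move=> mW lawW indepW mm Th hth im2 Em0 sd0 /andP[gam0 gam4] _ hmax mrej.
set r := n%:R `^ (- (c1 / 16)).
have nR0 : 0 < n%:R :> R by rewrite ltr0n.
have r0 : 0 < r by exact: powR_gt0.
(* For small n the bound is trivial. *)
have [Qr|Qr] := leP (Q * r) 1; last first.
  apply: (le_trans (probability_le1 _ mrej)); rewrite lee_fin.
  have : 0 <= total_const C1 K * r by rewrite mulr_ge0// ltW.
  by lra.
have qr2 : 0 <= C1 ^+ 2 * r by rewrite mulr_ge0// ltW.
have qr3 : 0 <= K ^+ 3 * C1 ^+ 2 * r by rewrite mulr_ge0// ltW.
have kr : 0 <= K * r by rewrite mulr_ge0// ltW.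
have QrE : Q * r = 4 * r + 64 * C1 ^+ 2 * r + K ^+ 3 * C1 ^+ 2 * r + 3 * (2 + K) * r.
  by rewrite /Q; ring.
move: Qr; rewrite QrE => Qr; clear QrE.
have rC : 64 * C1 ^+ 2 * r <= 1 by lra.
have r4 : r <= 1 / 4 by lra.
have rK : K ^+ 3 * C1 ^+ 2 * r <= 1 by lra.
have rK' : 3 * (2 + K) * r <= 1 by lra.
pose f j s := m j s thstar.
pose Z j s := (Esd mu (f j))^-1 * (f j s - Emean mu (f j)).
pose L := ln (p%:R / gam).
have pR1 : 1 <= p%:R :> R by rewrite ler1n.
have pg4 : 4 <= p%:R / gam.
  by rewrite ler_pdivlMr//; move: gam4 alpha1 pR1; clear; lra.
have pg0 : 0 < p%:R / gam by exact: lt_le_trans pg4.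
have L1 : 1 <= L.
  by rewrite -[leLHS](@expRK R) ler_ln ?posrE ?expR_gt0//; apply: le_trans pg4; exact: expR1_le4.
have L0 : 0 < L by exact: lt_le_trans L1.
have pL : p%:R * expR (- L) = gam.
  by rewrite expRN lnK ?posrE// invf_div mulrCA divff ?mulr1// gt_eqF// ltr0n.
pose I := (\int[mu]_s (\big[Num.max/0]_(j < p) `|Z j s| ^+ 4)%:E)%E.
have max0 s : 0 <= \big[Num.max/0]_(j < p) `|Z j s| ^+ 4.
  by elim/big_ind: _ => // x y x0 y0; rewrite le_max x0.
have I0 : (0 <= I)%E by apply: integral_ge0 => s _; rewrite lee_fin.
(* An infinite moment would make the left side of the moment condition infinite, as [L > 0]. *)
have Ifin : I \is a fin_num.
  rewrite ge0_fin_numE// ltNge; apply/negP; rewrite leye_eq => /eqP Iy.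
  move: hmax; rewrite -/I Iy poweRyr ?lt0r_neq0//.
  by rewrite gt0_mulye ?lte_fin ?exprn_gt0.
pose A := Num.sqrt (fine I).
have fI0 : 0 <= fine I by exact: fine_ge0.
have A2 : A ^+ 2 = fine I by rewrite sqr_sqrtr.
have EmaxZ4 : (I <= (A ^+ 2)%:E)%E by rewrite A2 fineK.
have mZ j : measurable_fun setT (Z j).
  by apply: measurable_funM => //; apply: measurable_funB => //; exact: mm.
have mmaxZ : measurable_fun setT (fun s => \big[Num.max/0]_(j < p) `|Z j s| ^+ 4).
  exact: measurable_bigmaxr_pow4.
have stdZ j : standardized mu (Z j) A.
  apply: (standardized_of (f := f j) (mm j thstar) (im2 j) (sd0 j)).
  apply: le_trans EmaxZ4; apply: ge0_le_integral => //.
  - by move=> s _; rewrite lee_fin exprn_even_ge0.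
  - by apply/measurable_EFinP; apply: measurable_funX; exact: mZ.
  - exact/measurable_EFinP.
  - move=> s _; rewrite lee_fin.
    have -> : (Esd mu (f j))^-1 * (f j s - Emean mu (f j)) = Z j s by [].
    have -> : Z j s ^+ 4 = `|Z j s| ^+ 4 by rewrite -normrX ger0_norm// exprn_even_ge0.
    exact: (le_bigmax _ (fun j => `|Z j s| ^+ 4)).
have A1 : 1 <= A.
  have [mZj iZ EZ [iZ2 EZ2 EZ4]] := stdZ (Ordinal p0).
  have := moment4_ge1 mZj iZ EZ iZ2 EZ2 EZ4.
  by rewrite expr_ge1// sqrtr_ge0.
(* This is the second moment condition; by Lyapunov it implies the first one. *)
have ALN : A * L ^+ 2 <= C1 * Num.sqrt n%:R * r ^+ 16.
  have -> : C1 * Num.sqrt n%:R * r ^+ 16 = C1 * n%:R `^ (1 / 2 - c1).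
    rewrite -mulrA powRD; last by apply/implyP => _; rewrite gt_eqF.
    rewrite div1r powR12_sqrt ?ler0n// -powR_mulrn ?(ltW r0)// -powRrM.
    by rewrite mulNr divfK.
  move: hmax; rewrite -/I -(fineK Ifin) poweR_EFin -EFinM lee_fin.
  by rewrite div1r powR12_sqrt.
have KE : - K <= Phi_inv (1 - alpha) by rewrite lerNl; apply: le_trans (ler_norm _) _; rewrite normrN.
have iidW : iid Pr mu W by split.
have pL1 : p%:R * expR (- L) <= 1 by rewrite pL; move: gam4 alpha1; clear; lra.
have [Bad [mBad PBad good]] := good_event n0 iidW stdZ EmaxZ4 A1 C10 r0 r4 L1 rC ALN pL1.
pose mj j := Num.sqrt n%:R * Emean mu (f j) / Esd mu (f j).
have mj0 j : mj j <= 0.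
  rewrite /mj mulr_le0_ge0 ?invr_ge0 ?(ltW (sd0 j))//.
  by rewrite mulr_ge0_le0 ?sqrtr_ge0//; exact: Em0.
pose sg w j := sighat (fun i => W i w) (Z j).
have goodsg w : ~ Bad w -> forall j, `|sg w j - 1| <= r / (2 * L).
  by move=> nb j; have [_] := good w nb j.
pose rho w j := (\sum_(i < n) trunc (Z j) (trunc_level r L (Num.sqrt n%:R)) (W i w)
   / Num.sqrt n%:R + mj j) / sg w j.
have rhoE w : ~ Bad w -> forall j, Defs.ratio (fun i => W i w) (f j) = (rho w j)%:E.
  move=> nb j; have [tr hs] := good w nb j.
  have s0 : sighat (fun i => W i w) (Z j) != 0.
    apply/eqP => s0; move: hs; rewrite s0 sub0r normrN normr1.
    rewrite ler_pdivlMr ?mulr_gt0// mul1r; move: L1 r4; clear; lra.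
  rewrite (@ratioE _ _ _ mu _ (sd0 j) _ _ n0 s0) /rho /mj.
  by congr (((_ + _) / _)%:E); apply: eq_bigr => i _; rewrite tr.
have := @rejection_bound _ _ _ _ Pr _ mu n p W Z A n0 p0 iidW stdZ A1 C1 r L alpha gam K
  C10 r0 r4 L1 rC K0 rK rK' ALN alpha1 gam0 gam4 pL KE sg mj
  (reject W m Theta h hbar alpha gam) Bad mj0 mrej (conj mBad PBad) goodsg.
move=> /(_ _)/le_trans; apply; last first.
  by rewrite lee_fin lerD2l ler_wpM2r ?(ltW r0)// lerDl ltW.
move=> w nb rw.
set x := fun i => W i w.
have JE : [set j | - 2 * cSN n p gam < rho w j]%SET = Jhat x m gam thstar.
  by apply/finset.setP => j; rewrite !inE -lte_fin -rhoE.
rewrite -/(rho w) JE.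
have Thh : Theta_h Theta h hbar thstar by split.
(* Reduction to [thstar]: its statistic dominates the infimum. Either it lies in the estimated set,
   and its critical value is below the maximum, or its statistic exceeds [cSN n p gam]. *)
have Tle : (Tn x m Theta h hbar <= maxratio x m thstar)%E.
  by apply: ereal_inf_lbound; exists thstar.
have [hin|hout] := pselect (maxratio x m thstar <= (cSN n p gam)%:E)%E.
  right; have cle : ((c2S x m alpha gam thstar)%:E <= maxc2S x m Theta h hbar alpha gam)%E.
    by apply: ereal_sup_ubound; exists thstar.
  have := le_lt_trans cle (lt_le_trans rw Tle).
  move/lt_bigmaxP => [j hj]; exists j; move: hj.
  by rewrite (rhoE w nb j) lte_fin.
left; move/negP: hout; rewrite -ltNge => /lt_bigmaxP[j hj].
by exists j; move: hj; rewrite (rhoE w nb j) lte_fin.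
Qed.
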